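(* Let $\Gamma$ be the diagram associated to a seed in a cluster algebra of finite type, and let $\Delta$ be the Dynkin type of this cluster algebra. Let $W(\Gamma)$ be the group with generators $s_i$, $i$ a vertex of $\Gamma$, subject to the following relations (where $e$ denotes the identity element): (1) $s_i^2=e$ for all $i$; (2) $(s_is_j)^{m_{ij}}=e$ for all $i\neq j$; (3) for any chordless cycle $i_0\xrightarrow{w_1} i_1\xrightarrow{w_2}\cdots\rightarrow i_{d-1}\xrightarrow{w_0} i_0$ in $\Gamma$ (with edge weights $w_0,\dots,w_{d-1}$ as indicated, and any choice of starting vertex $i_0$) such that either all of the weights are $1$, or $w_0=2$: $$(s_{i_0}s_{i_1}\cdots s_{i_{d-2}}s_{i_{d-1}}s_{i_{d-2}}\cdots s_{i_1})^2=e.$$ Then $W(\Gamma)$ is isomorphic to the (finite crystallographic) reflection group of type $\Delta$.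
   Context: Cluster algebras. Let $\mathbb{F}=\mathbb{Q}(u_1,\dots,u_n)$. An $n\times n$ integer matrix $B$ is skew-symmetrisable if $DB$ is skew-symmetric for some diagonal matrix $D$ with positive diagonal entries. Consider pairs $(\mathbf{x},B)$ with $\mathbf{x}=\{x_1,\dots,x_n\}$ a free generating set of $\mathbb{F}$ and $B$ an $n\times n$ skew-symmetrisable matrix. For $k\in[1,n]$ the mutation $\mu_k(\mathbf{x},B)=(\mathbf{x}',B')$ is given by $B'_{ij}=-B_{ij}$ if $i=k$ or $j=k$, and $B'_{ij}=B_{ij}+\frac{|B_{ik}|B_{kj}+B_{ik}|B_{kj}|}{2}$ otherwise; $\mathbf{x}'$ is obtained from $\mathbf{x}$ by replacing $x_k$ with $x_k'$ where $x_k'x_k=\prod_{B_{ik}>0}x_i^{B_{ik}}+\prod_{B_{ik}<0}x_i^{-B_{ik}}$. Write $\mu_k(B)=B'$. Fix an initial seed; the seeds are all pairs obtained from it by sequences of mutations (identified up to simultaneous relabelling by permutations of $[1,n]$). The cluster algebra $\mathcal{A}(B)$ is the $\mathbb{Q}$-subalgebra of $\mathbb{F}$ generated by all elements $x_i$ appearing in seeds. It is of finite type if it has finitely many seeds. The Cartan counterpart $A(B)$ of $B$ has entries $2$ on the diagonal and $-|B_{ij}|$ off the diagonal. A cluster algebra of finite type has Dynkin type $\Delta$ if it contains a seed whose matrix has Cartan counterpart equal to the Cartan matrix of $\Delta$ (up to simultaneous permutation of rows and columns); by Fomin-Zelevinsky, every cluster algebra of finite type has exactly one such type. Diagrams. The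 diagram $\Gamma(B)$ of $B$ is the weighted oriented graph with vertices $[1,n]$ and an arrow from $i$ to $j$ if and only if $B_{ij}>0$, with weight $|B_{ij}B_{ji}|$. The diagram of a seed $(\mathbf{x},B)$ is $\Gamma(B)$. In finite type all weights are at most $3$. A chordless cycle in $\Gamma$ is an induced subgraph of the underlying unoriented graph that is a cycle; in finite type these are always cyclically oriented in $\Gamma$ (Fomin-Zelevinsky). For vertices $i\neq j$ of $\Gamma$: $m_{ij}=2$ if $i$ and $j$ are not joined by an edge; $m_{ij}=3,4,6$ if they are joined by an edge of weight $1,2,3$ respectively. *)

(* Defs.v *)
From HB Require Import structures.
From mathcomp Require Import all_boot all_order all_algebra.
From mathcomp Require Import perm fraction mpoly boolp.

Set Implicit Arguments.
Unset Strict Implicit.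
Unset Printing Implicit Defensive.

Import Order.TTheory GRing.Theory Num.Theory.
Local Open Scope ring_scope.

Definition ambient_field (n : nat) : fieldType := {fraction {mpoly rat[n]}}.

Definition ambient_const (n : nat) (c : rat) : ambient_field n :=
  tofrac (mpolyC n c).

Definition poly_eval (n : nat) (x : {ffun 'I_n -> ambient_field n})
    (p : {mpoly rat[n]}) : ambient_field n :=
  mmap (@ambient_const n) x p.

Definition free_generating (n : nat) (x : {ffun 'I_n -> ambient_field n}) :
    Prop :=
  (forall p : {mpoly rat[n]}, poly_eval x p = 0 -> p = 0) /\
  (forall f : ambient_field n, exists p q : {mpoly rat[n]},
     poly_eval x q != 0 /\ f = poly_eval x p / poly_eval x q).

Definition skew_symmetrisable (n : nat) (B : 'M[int]_n) : Prop :=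
  exists d : 'rV[rat]_n, (forall i, 0 < d 0 i) /\
    let DB := diag_mx d *m map_mx intr B in DB^T = - DB.

Definition labelled_pair (n : nat) : Type :=
  ({ffun 'I_n -> ambient_field n} * 'M[int]_n)%type.

Definition is_seed_pair (n : nat) (s : labelled_pair n) : Prop :=
  free_generating s.1 /\ skew_symmetrisable s.2.

Definition mutate_matrix (n : nat) (k : 'I_n) (B : 'M[int]_n) : 'M[int]_n :=
  \matrix_(i, j)
    if (i == k) || (j == k) then - B i j
    else B i j + ((`|B i k| * B k j + B i k * `|B k j|) %/ 2)%Z.

Definition mutate_cluster (n : nat) (k : 'I_n) (s : labelled_pair n) :
    {ffun 'I_n -> ambient_field n} :=
  let: (x, B) := s in
  [ffun j => if j == k then
      (\prod_(i < n | 0 < B i k) x i ^+ absz (B i k)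
       + \prod_(i < n | B i k < 0) x i ^+ absz (B i k)) / x k
    else x j].

Definition mutate (n : nat) (k : 'I_n) (s : labelled_pair n) :
    labelled_pair n :=
  (mutate_cluster k s, mutate_matrix k s.2).

Inductive mutation_reachable (n : nat) (s0 : labelled_pair n) :
    labelled_pair n -> Prop :=
| reach_refl : mutation_reachable s0 s0
| reach_step s k :
    mutation_reachable s0 s -> mutation_reachable s0 (mutate k s).

Definition relabelled (n : nat) (s t : labelled_pair n) : Prop :=
  exists sigma : 'S_n,
    (forall i, t.1 (sigma i) = s.1 i) /\
    (forall i j, t.2 (sigma i) (sigma j) = s.2 i j).

(* The cluster algebra is represented by its initial seed [s0]; every
   relabelling of a pair obtained by mutations represents one of its seeds. *)
Definition seed_of (n : nat) (s0 s : labelled_pair n) : Prop :=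
  exists2 s', mutation_reachable s0 s' & relabelled s' s.

Definition finite_type (n : nat) (s0 : labelled_pair n) : Prop :=
  exists L : seq (labelled_pair n),
    forall s, seed_of s0 s -> exists2 t, t \in L & relabelled s t.

Definition cartan_counterpart (n : nat) (B : 'M[int]_n) : 'M[int]_n :=
  \matrix_(i, j) if i == j then 2 else - `|B i j|.

Inductive connected_dynkin : Type :=
| TypeA of nat | TypeB of nat | TypeC of nat | TypeD of nat
| TypeE6 | TypeE7 | TypeE8 | TypeF4 | TypeG2.

Definition dynkin_rank (t : connected_dynkin) : nat :=
  match t with
  | TypeA n | TypeB n | TypeC n | TypeD n => n
  | TypeE6 => 6 | TypeE7 => 7 | TypeE8 => 8 | TypeF4 => 4 | TypeG2 => 2
  end.

Definition dynkin_wf (t : connected_dynkin) : bool :=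
  match t with
  | TypeA n => 1 <= n
  | TypeB n => 2 <= n
  | TypeC n => 3 <= n
  | TypeD n => 4 <= n
  | _ => true
  end%N.

(* Opposites of the off-diagonal entries of the Cartan matrix
   a_ij = 2 (alpha_i, alpha_j) / (alpha_i, alpha_i), with the simple roots in
   Bourbaki order, numbered from 0. *)
Definition dynkin_bond (t : connected_dynkin) (i j : nat) : nat :=
  (let path_edge : nat := ((i.+1 == j) || (j.+1 == i)) in
  let a := minn i j in
  let b := maxn i j in
  match t with
  | TypeA _ => path_edge
  | TypeB n => if (i == n.-1) && (j == n.-2) then 2 else path_edge
  | TypeC n => if (i == n.-2) && (j == n.-1) then 2 else path_edge
  | TypeD n => if b == n.-1 then a.+2 == n.-1 : nat else path_edge
  | TypeE6 | TypeE7 | TypeE8 => if a < 2 then a.+2 == b : nat else path_edge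
  | TypeF4 => if (i == 2) && (j == 1) then 2 else path_edge
  | TypeG2 => if (i == 0) && (j == 1) then 3 else path_edge
  end)%N.

Definition connected_cartan (t : connected_dynkin) :
    'M[int]_(dynkin_rank t) :=
  \matrix_(i, j) if i == j then 2 else - (dynkin_bond t i j)%:Z.

(* A Dynkin type may be reducible: it is the list of its components. *)
Record dynkin_type : Type := DynkinType {
  components :> seq connected_dynkin;
  _ : all dynkin_wf components
}.

Definition component (D : dynkin_type) (i : 'I_(size D)) : connected_dynkin :=
  tnth (in_tuple D) i.

Definition total_rank (D : dynkin_type) : nat :=
  (\sum_(i < size D) dynkin_rank (component i))%N.

Definition cartan_matrix (D : dynkin_type) : 'M[int]_(total_rank D) :=
  \mxdiag_(i < size D) connected_cartan (component i).

Definition equal_up_to_permutation (m n : nat)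
    (A : 'M[int]_m) (C : 'M[int]_n) : Prop :=
  exists sigma : 'I_m -> 'I_n, bijective sigma /\
    forall i j, C (sigma i) (sigma j) = A i j.

Definition has_dynkin_type (n : nat) (s0 : labelled_pair n) (D : dynkin_type) :
    Prop :=
  exists2 s, seed_of s0 s &
    equal_up_to_permutation (cartan_counterpart s.2) (cartan_matrix D).

Record diagram (n : nat) : Type := Diagram {
  arrow : rel 'I_n;
  weight : 'I_n -> 'I_n -> nat
}.

Definition diagram_of (n : nat) (B : 'M[int]_n) : diagram n :=
  Diagram (fun i j => 0 < B i j) (fun i j => absz (B i j * B j i)).

Definition edge (n : nat) (G : diagram n) : rel 'I_n :=
  fun i j => arrow G i j || arrow G j i.

Definition chordless_cycle (n : nat) (G : diagram n) (c : seq 'I_n) : Prop :=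
  [/\ (2 < size c)%N, uniq c, cycle (edge G) c &
      {in c &, forall i j, edge G i j -> (j == next c i) || (i == next c j)}].

(* Weights above 3 do not occur in finite type; the value 0 makes the
   corresponding relation void. *)
Definition coxeter_exponent (n : nat) (G : diagram n) (i j : 'I_n) : nat :=
  (if edge G i j then
    match weight G i j with 1 => 3 | 2 => 4 | 3 => 6 | _ => 0 end
  else 2)%N.

(* A letter [(i, false)] stands for the generator i, [(i, true)] for its
   inverse. *)
Definition word (I : Type) : Type := seq (I * bool).
HB.instance Definition _ (I : choiceType) := Choice.on (word I).

Definition pos_word (I : Type) (s : seq I) : word I :=
  [seq (i, false) | i <- s].

Definition letter_inv (I : Type) (l : I * bool) : I * bool := (l.1, ~~ l.2).

Definition word_inv (I : Type) (w : word I) : word I :=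
  rev (map (@letter_inv I) w).

Section Presentation.
Variables (I : choiceType) (R : word I -> Prop).

Inductive word_cong : word I -> word I -> Prop :=
| cong_refl u : word_cong u u
| cong_sym u v : word_cong u v -> word_cong v u
| cong_trans u v w : word_cong u v -> word_cong v w -> word_cong u w
| cong_cat u u' v v' :
    word_cong u u' -> word_cong v v' -> word_cong (u ++ v) (u' ++ v')
| cong_cancel l : word_cong [:: l; letter_inv l] [::]
| cong_relator r : R r -> word_cong r [::].

Definition word_congb : rel (word I) := fun u v => `[< word_cong u v >].

Lemma word_congb_refl : reflexive word_congb.
Proof. by move=> u; apply/asboolP/cong_refl. Qed.

Lemma word_congb_sym : ssrbool.symmetric word_congb.
Proof. by move=> u v; apply/asboolP/asboolP; apply: cong_sym. Qed.

Lemma word_congb_trans : transitive word_congb.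
Proof.
move=> v u w /asboolP uv /asboolP vw; apply/asboolP.
exact: cong_trans uv vw.
Qed.

Canonical word_cong_equiv :=
  EquivRel word_congb word_congb_refl word_congb_sym word_congb_trans.

Definition presented : Type := {eq_quot word_cong_equiv}%qT.
HB.instance Definition _ := Choice.on presented.
HB.instance Definition _ := EqQuotient.on presented.

Local Open Scope quotient_scope.

Definition class_of (w : word I) : presented := \pi_presented w.

Lemma class_ofP u v : class_of u = class_of v <-> word_cong u v.
Proof.
by split=> [/eqmodP/asboolP //|uv]; apply/eqmodP/asboolP.
Qed.

Lemma repr_class u : word_cong (repr (class_of u)) u.
Proof. by apply/class_ofP; rewrite /class_of reprK. Qed.

Lemma word_invK : involutive (@word_inv I).
Proof.
move=> w; rewrite /word_inv map_rev revK -map_comp -[RHS]map_id.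
by apply: eq_map => -[i b]; rewrite /letter_inv /= negbK.
Qed.

Lemma cong_mulV u : word_cong (u ++ word_inv u) [::].
Proof.
elim: u => [|l u IHu]; first exact: cong_refl.
rewrite /word_inv map_cons rev_cons -cats1 -/(word_inv u) cat_cons catA -cat1s.
apply: cong_trans (cong_cancel l); rewrite -[X in word_cong _ X]/([:: l] ++ _).
apply: cong_cat; first exact: cong_refl.
rewrite -[X in word_cong _ X]cat0s.
by apply: cong_cat => //; apply: cong_refl.
Qed.

Lemma cong_Vmul u : word_cong (word_inv u ++ u) [::].
Proof. by rewrite -{2}[u]word_invK; apply: cong_mulV. Qed.

Lemma cong_inv u v : word_cong u v -> word_cong (word_inv u) (word_inv v).
Proof.
move=> uv; pose w := word_inv u ++ v ++ word_inv v.
apply: (@cong_trans _ w).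
  rewrite -[X in word_cong X _]cats0 /w.
  by apply: cong_cat; [apply: cong_refl | apply/cong_sym/cong_mulV].
rewrite /w catA -[X in word_cong _ X]cat0s.
apply: cong_cat (cong_refl _); apply: cong_trans (cong_Vmul u).
by apply: cong_cat; [apply: cong_refl | apply: cong_sym].
Qed.

Definition pres_one : presented := class_of [::].
Definition pres_mul (x y : presented) : presented :=
  class_of (repr x ++ repr y).
Definition pres_inv (x : presented) : presented := class_of (word_inv (repr x)).

Lemma class_of_cat u v : pres_mul (class_of u) (class_of v) = class_of (u ++ v).
Proof. by apply/class_ofP/cong_cat; apply: repr_class. Qed.

Lemma class_of_inv u : pres_inv (class_of u) = class_of (word_inv u).
Proof. by apply/class_ofP/cong_inv/repr_class. Qed.

Lemma class_of_ind (P : presented -> Prop) :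
  (forall u, P (class_of u)) -> forall x, P x.
Proof. by move=> Pc x; have := Pc (repr x); rewrite /class_of reprK. Qed.

Lemma pres_mulA : associative pres_mul.
Proof.
elim/class_of_ind=> u; elim/class_of_ind=> v; elim/class_of_ind=> w.
by rewrite !class_of_cat catA.
Qed.

Lemma pres_mul1 : left_id pres_one pres_mul.
Proof. by elim/class_of_ind=> u; rewrite class_of_cat. Qed.

Lemma pres_mulr1 : right_id pres_one pres_mul.
Proof. by elim/class_of_ind=> u; rewrite class_of_cat cats0. Qed.

Lemma pres_mulV : left_inverse pres_one pres_inv pres_mul.
Proof.
elim/class_of_ind=> u; rewrite class_of_inv class_of_cat.
exact/class_ofP/cong_Vmul.
Qed.

Lemma pres_mulrV : right_inverse pres_one pres_inv pres_mul.
Proof.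
elim/class_of_ind=> u; rewrite class_of_inv class_of_cat.
exact/class_ofP/cong_mulV.
Qed.

HB.instance Definition _ := isGroup.Build presented
  pres_mulA pres_mul1 pres_mulr1 pres_mulV pres_mulrV.

End Presentation.

Inductive diagram_relator (n : nat) (G : diagram n) : word 'I_n -> Prop :=
| rel_involution i : diagram_relator G (pos_word [:: i; i])
| rel_braid i j : i != j ->
    diagram_relator G
      (pos_word (flatten (nseq (coxeter_exponent G i j) [:: i; j])))
| rel_cycle i0 p :
    let c := i0 :: p in
    chordless_cycle G c -> cycle (arrow G) c ->
    {in c, forall i, weight G i (next c i) = 1%N}
      \/ weight G (last i0 p) i0 = 2%N ->
    (* for p = i_1, ..., i_{d-1}, the path
       i_0, i_1, ..., i_{d-2}, i_{d-1}, i_{d-2}, ..., i_1 *)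
    let w := i0 :: p ++ behead (rev p) in
    diagram_relator G (pos_word (w ++ w)).

Definition diagram_group (n : nat) (G : diagram n) : groupType :=
  presented (diagram_relator G).

(* The reflection s_i (alpha_j) = alpha_j - a_ij alpha_i of the root space
   \bigoplus_j Q alpha_j, acting on column vectors of coordinates. *)
Definition simple_reflection (r : nat) (A : 'M[int]_r) (i : 'I_r) :
    'M[rat]_r :=
  1%:M - delta_mx i i *m map_mx intr A.

Section ReflectionGroup.
Variable D : dynkin_type.
Let r := total_rank D.

Inductive in_reflection_group : 'M[rat]_r -> Prop :=
| refl_gen i : in_reflection_group (simple_reflection (cartan_matrix D) i)
| refl_one : in_reflection_group 1%:M
| refl_mul M N : in_reflection_group M -> in_reflection_group N ->
    in_reflection_group (M *m N)
| refl_inv M : in_reflection_group M -> in_reflection_group (invmx M).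

Lemma cartan_matrix_diag i : cartan_matrix D i i = 2.
Proof. by rewrite !mxE eqxx conform_mx_id mxE eqxx. Qed.

Lemma simple_reflection_sqr i :
  simple_reflection (cartan_matrix D) i *m simple_reflection (cartan_matrix D) i
  = 1%:M.
Proof.
rewrite /simple_reflection; set A := map_mx intr _.
have Aii : A i i = 2 by rewrite mxE cartan_matrix_diag.
set E := delta_mx i i; have EAE : E *m A *m E = 2 *: E.
  clearbody A; apply/matrixP=> j k; rewrite !mxE (bigD1 i) //= big1 ?addr0; last first.
    by move=> l li; rewrite !mxE (negbTE li) mulr0.
  rewrite !mxE (bigD1 i) //= big1 ?addr0; last first.
    by move=> l li; rewrite !mxE (negbTE li) andbF mul0r.
  rewrite Aii !mxE !eqxx andbT /=.
  by case: (j == i); case: (k == i); rewrite /= ?(mulr0, mul0r, mulr1, mul1r).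
rewrite mulmxBl mul1mx mulmxBr mulmx1 mulmxA EAE -scalemxAl scaler_nat mulr2n.
by rewrite opprB addrK subrK.
Qed.

Lemma in_reflection_group_unit M : in_reflection_group M -> M \in unitmx.
Proof.
elim=> [i||{}M N _ uM _ uN|{}M _ uM].
- by case: (mulmx1_unit (simple_reflection_sqr i)).
- exact: unitmx1.
- by rewrite unitmx_mul uM.
- by rewrite unitmx_inv.
Qed.

Definition reflection_group_carrier : Type :=
  {M : 'M[rat]_r | `[< in_reflection_group M >]}.
HB.instance Definition _ := Choice.on reflection_group_carrier.

Lemma in_reflection_groupP (g : reflection_group_carrier) :
  in_reflection_group (val g).
Proof. by case: g => M /= /asboolP. Qed.

Definition to_reflection_group (M : 'M[rat]_r) (hM : in_reflection_group M) :
    reflection_group_carrier := exist _ M (asboolT hM).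

Definition refl_group_one : reflection_group_carrier :=
  to_reflection_group refl_one.
Definition refl_group_mul (g h : reflection_group_carrier) :
    reflection_group_carrier :=
  to_reflection_group
    (refl_mul (in_reflection_groupP g) (in_reflection_groupP h)).
Definition refl_group_inv (g : reflection_group_carrier) :
    reflection_group_carrier :=
  to_reflection_group (refl_inv (in_reflection_groupP g)).

Lemma refl_group_mulA : associative refl_group_mul.
Proof. by move=> f g h; apply: val_inj; rewrite /= mulmxA. Qed.

Lemma refl_group_mul1 : left_id refl_group_one refl_group_mul.
Proof. by move=> g; apply: val_inj; rewrite /= mul1mx. Qed.

Lemma refl_group_mulr1 : right_id refl_group_one refl_group_mul.
Proof. by move=> g; apply: val_inj; rewrite /= mulmx1. Qed.

Lemma refl_group_mulV : left_inverse refl_group_one refl_group_inv refl_group_mul.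
Proof.
move=> g; apply: val_inj; rewrite /= mulVmx //.
exact/in_reflection_group_unit/in_reflection_groupP.
Qed.

Lemma refl_group_mulrV :
  right_inverse refl_group_one refl_group_inv refl_group_mul.
Proof.
move=> g; apply: val_inj; rewrite /= mulmxV //.
exact/in_reflection_group_unit/in_reflection_groupP.
Qed.

HB.instance Definition _ := isGroup.Build reflection_group_carrier
  refl_group_mulA refl_group_mul1 refl_group_mulr1
  refl_group_mulV refl_group_mulrV.

Definition reflection_group : groupType := reflection_group_carrier.

End ReflectionGroup.

Definition isomorphic (G H : groupType) : Prop :=
  exists f : {multiplicative G -> H}, bijective f.

(* Main.v *)
(** A cluster algebra of finite type has only finitely many cluster variables.
    If some seed had |B_ij B_ji| >= 4, specialising its other variables to 1 and
    mutating alternately at i and j would produce cluster variables with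
    unbounded positive values; so |B_ij B_ji| <= 3 in all seeds.  This bound
    alone forces the chordless cycles of all diagrams to be cyclically oriented,
    with weights 1,...,1 or 1,2,2 or 1,2,1,2: mutating at a vertex of a chordless
    cycle replaces the path through it by an edge, which reduces everything to
    triangles.

    W(Gamma) is invariant under mutation at k: if s_i are the generators for
    mu_k(Gamma), the elements t_i = s_k s_i s_k for arrows k -> i of Gamma and
    t_i = s_i otherwise satisfy the relations of Gamma.  Applying the same
    construction to mu_k(Gamma) gives a homomorphism the other way, and both
    composites are conjugation by s_k.

    Hence W(Gamma) is isomorphic to the group of a seed whose Cartan counterpart
    is the Cartan matrix of the Dynkin type.  Its diagram is a forest, so only the
    Coxeter relations remain, and Tits' argument shows that the representation of
    the Coxeter group on the root space is faithful. *)


From HB Require Import structures.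
Require Import Defs.
From mathcomp Require Import all_boot all_order all_algebra.
From mathcomp Require Import perm fraction mpoly boolp.
From mathcomp Require Import zify ring lra.

Set Implicit Arguments.
Unset Strict Implicit.
Unset Printing Implicit Defensive.

Import Order.TTheory GRing.Theory Num.Theory.

(** * Induced cycles *)

(** Every relation of a diagram is used as a statement about conjugates. For involutions, exponent 2
    says that x and y commute, exponent 3 gives x ^ y = y ^ x, exponent 4 gives that x commutes with
    x ^ y, and the relation of a cycle says that its first generator commutes with the last one
    conjugated along the interior. Invariance under mutation then becomes a calculation with
    conjugations. Its difficulty is the number of configurations: k can lie on a cycle, see at most
    one of its vertices, or see two adjacent ones. Where a closing edge has weight 2 the starting
    vertex matters; on a cycle of weights 1 any single starting vertex suffices.

    Cluster variables enter only through the bound on the weights. Instead of Laurent polynomials,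
    the growth argument uses the evaluation of rational functions at points with positive
    coordinates. Exchange relations are free of subtraction, so a positive point of a mutated seed
    comes from a positive point of the old one, and every seed can be specialised at any positive
    point. *)

Section InducedCycles.
Variable T : eqType.
Implicit Types (e : rel T) (c p : seq T) (x y z : T).

(** Adjacency is prescribed by positions i < j, so that rotations, contractions and insertions
    reduce to index arithmetic; [induced_cycleP] links this to the chordless cycles of the
    statement. *)
Definition induced_cycle e c : Prop :=
  [/\ 2 < size c, uniq c & forall x0 i j, i < j < size c ->
      e (nth x0 c i) (nth x0 c j)
        = (j == i.+1) || ((i == 0) && (j.+1 == size c))].

Lemma induced_cycle_congr e e' c :
  {in c &, e =2 e'} -> induced_cycle e c -> induced_cycle e' c.
Proof.
move=> ee' [sc uc ec]; split=> // x0 i j ij.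
by rewrite -ee' ?ec // mem_nth; lia.
Qed.

Lemma induced_cycle_rot1 e c :
  ssrbool.symmetric e -> induced_cycle e c -> induced_cycle e (rot 1 c).
Proof.
move=> se [sc uc ec]; split; rewrite ?size_rot ?rot_uniq //.
case: c sc uc ec => // x p sc _ ec x0 i j ij; rewrite rot1_cons !nth_rcons.
rewrite /= in sc ij ec *.
have -> : i < size p by lia.
case: ltnP => jp; first by have := ec x0 i.+1 j.+1; rewrite /= => ->; lia.
have -> : j == size p by lia.
by rewrite se; have := ec x0 0 i.+1; rewrite /= => ->; lia.
Qed.

Lemma induced_cycle_rot e c m :
  ssrbool.symmetric e -> induced_cycle e c -> induced_cycle e (rot m c).
Proof.
move=> se ec; have [ms|ms] := leqP m (size c); last by rewrite rot_oversize // ltnW.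
elim: m ms => [|m IHm] ms; first by rewrite rot0.
by rewrite -[m.+1]addn1 addnC rotD //; apply/induced_cycle_rot1/IHm/ltnW.
Qed.

Lemma induced_cycle_rev e c :
  ssrbool.symmetric e -> induced_cycle e c -> induced_cycle e (rev c).
Proof.
move=> se [sc uc ec]; split; rewrite ?size_rev ?rev_uniq // => x0 i j ij.
have [si sj] : i < size c /\ j < size c by lia.
rewrite !nth_rev // se ec; first by clear -ij; lia.
by clear -ij; lia.
Qed.

Lemma induced_cycle_neighbours e x y m z :
    ssrbool.symmetric e -> induced_cycle e (x :: y :: rcons m z) ->
  {in y :: rcons m z, forall w, e x w = (w == y) || (w == z)}.
Proof.
move=> se [sc uc ec] w /(nthP x)[i isz <-].
have := ec x 0 i.+1; rewrite /= => ->; last by move: isz => /=; lia.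
rewrite /= in isz; rewrite size_rcons in isz *.
have ul : uniq (y :: rcons m z) by case/andP: uc.
have -> : (nth x (y :: rcons m z) i == y) = (i == 0).
  by rewrite -(nth_uniq x _ _ ul) //= size_rcons; lia.
have {2}-> : z = nth x (y :: rcons m z) (size m).+1.
  by rewrite /= nth_rcons ltnn eqxx.
by rewrite (nth_uniq x) //= ?size_rcons; lia.
Qed.

(** The effect on the cycle of a mutation at its vertex x. As [m] is nonempty, at least three
    vertices remain. *)
Lemma induced_cycle_contract e e' x y m z :
    ssrbool.symmetric e' -> m != [::] -> induced_cycle e (x :: y :: rcons m z) ->
    e' y z ->
    {in y :: rcons m z &, forall u v, (u, v) != (y, z) -> (u, v) != (z, y) ->
       e' u v = e u v} ->
  induced_cycle e' (y :: rcons m z).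
Proof.
move=> se m0 [sc uc ec] e'yz e'e; split.
- by move: m0; case: m {sc uc ec e'e} => //= ? ?; rewrite size_rcons.
- by case/andP: uc.
move=> x0 i j; set c := _ :: _; move=> ij.
have uc' : uniq c by case/andP: uc.
have yE : y = nth x0 c 0 by [].
have zE : z = nth x0 c (size m).+1 by rewrite /= nth_rcons ltnn eqxx.
have cE : size c = (size m).+2 by rewrite /= size_rcons.
have yP l : l < size c -> (nth x0 c l == y) = (l == 0).
  by move=> lc; rewrite yE nth_uniq // cE.
have zP l : l < size c -> (nth x0 c l == z) = (l == (size m).+1).
  by move=> lc; rewrite zE nth_uniq // cE.
have [si sj] : i < size c /\ j < size c by lia.
have [/andP[/eqP i0 /eqP jm]|ne] := boolP ((i == 0) && (j == (size m).+1)).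
  by rewrite i0 jm -yE -zE e'yz /= !size_rcons eqxx orbT.
rewrite e'e ?mem_nth; try lia.
- have := ec x0 i.+1 j.+1; rewrite [nth _ _ i.+1]/= [nth _ _ j.+1]/= -/c => ->.
    by rewrite -[size (x :: c)]/(size c).+1; lia.
  by rewrite -[size (x :: c)]/(size c).+1; lia.
- by rewrite xpair_eqE yP // zP //; lia.
- by rewrite xpair_eqE yP // zP //; lia.
Qed.

(** Inverse of the contraction: the edge between y and z is replaced by a path through a new vertex
    k. *)
Lemma induced_cycle_insert e e' k y m z :
    ssrbool.symmetric e -> ssrbool.symmetric e' -> m != [::] ->
      k \notin y :: rcons m z ->
    induced_cycle e (y :: rcons m z) ->
    ~~ e' y z ->
    {in y :: rcons m z &, forall u v, (u, v) != (y, z) -> (u, v) != (z, y) ->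
       e' u v = e u v} ->
    {in y :: rcons m z, forall w, e' k w = (w == y) || (w == z)} ->
  induced_cycle e' (k :: y :: rcons m z).
Proof.
move=> se se' m0 kc [sc uc ec] e'yz e'e e'k; split;
  [by rewrite ltnW | by rewrite cons_uniq kc |].
move=> x0 i j; set c := y :: _ in kc sc uc ec e'e e'k *; move=> ij.
have yE : y = nth x0 c 0 by [].
have zE : z = nth x0 c (size m).+1 by rewrite /= nth_rcons ltnn eqxx.
have cE : size c = (size m).+2 by rewrite /= size_rcons.
have yP l : l < size c -> (nth x0 c l == y) = (l == 0).
  by move=> lc; rewrite yE nth_uniq // cE.
have zP l : l < size c -> (nth x0 c l == z) = (l == (size m).+1).
  by move=> lc; rewrite zE nth_uniq // cE.
have m1 : 0 < size m by rewrite lt0n size_eq0.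
case: j ij => // j; rewrite -[size (k :: c)]/(size c).+1 cE => ij.
case: i ij => [|i] ij.
  have cj : nth x0 (k :: c) j.+1 \in c by rewrite /= mem_nth; lia.
  have jc : j < size c by lia.
  by rewrite [nth _ _ 0]/= e'k // -[nth _ _ _]/(nth x0 c j) yP // zP //; lia.
have [si sj] : i < size c /\ j < size c by lia.
rewrite -![nth _ (k :: c) _.+1]/(nth _ c _).
have [/andP[/eqP i0 /eqP jm]|ne] := boolP ((i == 0) && (j == (size m).+1)).
  rewrite i0 jm -yE -zE (negbTE e'yz); lia.
rewrite e'e ?mem_nth; try lia.
- by rewrite ec; lia.
- by rewrite xpair_eqE yP // zP //; lia.
- by rewrite xpair_eqE yP // zP //; lia.
Qed.

(** The arc from x to y closes up through k. If [p2] were empty and [p1] not, the edge closing the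
    old cycle would join x and y and be a chord of the new one. *)
Lemma induced_cycle_attach e k x p1 y p2 :
    ssrbool.symmetric e -> k \notin x :: p1 ++ y :: p2 ->
    induced_cycle e (x :: p1 ++ y :: p2) ->
    (p1 == [::]) || (p2 != [::]) ->
    e k x -> e k y -> {in p1, forall w, ~~ e k w} ->
  induced_cycle e (k :: x :: rcons p1 y).
Proof.
move=> se kc [sc uc ec] p12 ekx eky ekp.
have catE : x :: p1 ++ y :: p2 = (x :: rcons p1 y) ++ p2 by rewrite /= cat_rcons.
rewrite catE in kc uc ec; set c1 := x :: rcons p1 y in kc uc ec *.
move: kc uc; rewrite mem_cat cat_uniq negb_or => /andP[kc1 _] /andP[uc1 _].
have cE : size c1 = (size p1).+2 by rewrite /= size_rcons.
have pE : (p1 == [::]) = (size p1 == 0) by case: (p1).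
have pE2 : (p2 == [::]) = (size p2 == 0) by case: (p2).
rewrite pE pE2 in p12.
split; [by rewrite /= size_rcons | by rewrite cons_uniq kc1 |].
move=> x0 i [//|j]; rewrite -[size (k :: c1)]/(size c1).+1 cE => ij.
case: i ij => [|i] ij.
  rewrite -[nth _ (k :: c1) _.+1]/(nth _ c1 _) [nth _ _ 0]/=.
  case: j ij => [|j] ij; first by rewrite /= ekx.
  rewrite -[nth _ c1 _.+1]/(nth _ (rcons p1 y) j) nth_rcons.
  case: ltnP => jp; first by rewrite (negbTE (ekp _ _)) ?mem_nth; lia.
  have -> : j == size p1 by lia.
  by rewrite eky; lia.
rewrite -![nth _ (k :: c1) _.+1]/(nth _ c1 _).
have nE l : l < size c1 -> nth x0 c1 l = nth x0 (c1 ++ p2) l.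
  by move=> lc; rewrite nth_cat lc.
by rewrite !nE ?ec ?size_cat; lia.
Qed.

End InducedCycles.

Local Open Scope ring_scope.

(** * Matrix mutation and 2-finiteness *)

Lemma divz2_double (x : int) : ((x + x) %/ 2)%Z = x.
Proof. lia. Qed.

Section MatrixMutation.
Variable n : nat.
Implicit Types (B : 'M[int]_n) (i j k : 'I_n).

Lemma skew_symmetrisableP B :
  skew_symmetrisable B <->
  exists d : 'I_n -> rat, (forall i, 0 < d i) /\
    forall i j, d i * (B i j)%:~R = - (d j * (B j i)%:~R).
Proof.
split=> [[d [d0 /matrixP sd]]|[d [d0 sd]]].
  exists (d 0); split=> // i j; have := sd j i.
  by rewrite mul_diag_mx !mxE.
exists (\row_i d i); split=> [i|]; first by rewrite mxE.
by apply/matrixP=> i j; rewrite mul_diag_mx !mxE sd.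
Qed.

Section Skew.
Variable B : 'M[int]_n.
Hypothesis skB : skew_symmetrisable B.

Lemma skew_gt0 i j : (0 < B i j) = (B j i < 0).
Proof.
have /skew_symmetrisableP[d [d0 sd]] := skB.
by rewrite -(ltr0z rat) -(pmulr_rgt0 _ (d0 i)) sd oppr_gt0 pmulr_rlt0 // ltrz0.
Qed.

Lemma skew_eq0 i j : (B i j == 0) = (B j i == 0).
Proof. by have := skew_gt0 i j; have := skew_gt0 j i; lia. Qed.

Lemma skew_diag i : B i i = 0.
Proof. by have := skew_gt0 i i; lia. Qed.

(** The symmetrising factors cancel around a closed walk. This ties together the entries of a
    triangle read in its two directions. *)
Lemma skew_triangle i j k :
  B i j * B j k * B k i = - (B j i * B k j * B i k).
Proof.
have /skew_symmetrisableP[d [d0 sd]] := skB.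
have nz : d i * d j * d k != 0 by rewrite !mulf_neq0 ?gt_eqF.
apply: (@intr_inj rat); apply: (mulfI nz); rewrite rmorphN !rmorphM /=.
have -> : d i * d j * d k * ((B i j)%:~R * (B j k)%:~R * (B k i)%:~R) =
   (d i * (B i j)%:~R) * (d j * (B j k)%:~R) * (d k * (B k i)%:~R) by ring.
by rewrite (sd i j) (sd j k) (sd k i); ring.
Qed.

Lemma mutate_matrix_k k i j : (i == k) || (j == k) ->
  mutate_matrix k B i j = - B i j.
Proof. by rewrite mxE => ->. Qed.

Lemma mutate_matrix_pos k i j : 0 < B i k -> 0 < B k j ->
  mutate_matrix k B i j = B i j + B i k * B k j.
Proof.
move=> ik kj; rewrite mxE; case: eqP ik => [->|_]; first by rewrite skew_diag.
case: eqP kj => [->|_] kj ik; first by rewrite skew_diag in kj.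
by rewrite !gtr0_norm // divz2_double.
Qed.

Lemma mutate_matrix_neg k i j : B i k < 0 -> B k j < 0 ->
  mutate_matrix k B i j = B i j - B i k * B k j.
Proof.
move=> ik kj; rewrite mxE; case: eqP ik => [->|_]; first by rewrite skew_diag.
case: eqP kj => [->|_] kj ik; first by rewrite skew_diag in kj.
by rewrite !ltr0_norm // mulrN mulNr divz2_double.
Qed.

Lemma mutate_matrix_same k i j : i != k -> j != k ->
  ~~ ((0 < B i k) && (0 < B k j)) -> ~~ ((B i k < 0) && (B k j < 0)) ->
  mutate_matrix k B i j = B i j.
Proof.
move=> /negbTE ik /negbTE jk np nn; rewrite mxE ik jk /=.
have -> : `|B i k| * B k j + B i k * `|B k j| = 0.
  have [x0|x0|->] := ltrgtP (B i k) 0; last by rewrite normr0 !mul0r addr0.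
  - have [y0|y0|->] := ltrgtP (B k j) 0; last by rewrite normr0 !mulr0 addr0.
      by rewrite x0 y0 in nn.
    by rewrite ltr0_norm // gtr0_norm // mulNr addNr.
  - have [y0|y0|->] := ltrgtP (B k j) 0; last by rewrite normr0 !mulr0 addr0.
      by rewrite (ltr0_norm y0) (gtr0_norm x0) mulrN subrr.
    by rewrite x0 y0 in np.
by rewrite div0z addr0.
Qed.

Lemma mutate_matrix_nbr k i j : i != k -> j != k -> (B i k == 0) || (B j k == 0) ->
  mutate_matrix k B i j = B i j.
Proof.
move=> ik jk; rewrite (skew_eq0 j k) => /orP[]/eqP z; apply: mutate_matrix_same => //;
 by rewrite z ltxx ?andbF.
Qed.

(** The same d symmetrises the mutated matrix, because d_i B_ik B_kj = d_j B_jk B_ki: the sign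
    changes twice on the way through d_k. *)
Lemma mutate_matrix_skew k : skew_symmetrisable (mutate_matrix k B).
Proof.
have /skew_symmetrisableP[d [d0 sd]] := skB.
apply/skew_symmetrisableP; exists d; split=> // i j.
have [jk|jk] := boolP ((i == k) || (j == k)).
  by rewrite (mutate_matrix_k jk) mutate_matrix_k 1?orbC // !mulrNz !mulrN sd.
have [ik' jk'] : i != k /\ j != k by move: jk; case: (i == k); case: (j == k).
have sik := skew_gt0 i k; have ski := skew_gt0 k i.
have sjk := skew_gt0 j k; have skj := skew_gt0 k j.
have := sd i k; have := sd k j; have := sd i j => sij skj' sik'.
have dk : d k != 0 by rewrite gt_eqF.
have key : d i * ((B i k)%:~R * (B k j)%:~R) = d j * ((B j k)%:~R * (B k i)%:~R).
  rewrite mulrA sik'; apply/(mulfI dk).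
  have -> : d k * (- (d k * (B k i)%:~R) * (B k j)%:~R) =
     - (d k * (B k i)%:~R) * (d k * (B k j)%:~R) by ring.
  by rewrite skj'; ring.
have [/andP[p1 p2]|np] := boolP ((0 < B i k) && (0 < B k j)).
  rewrite mutate_matrix_pos // mutate_matrix_neg -?ski -?skj //; last by rewrite -sik.
  rewrite !(rmorphD, rmorphN, rmorphM) /= mulrDr sij key; ring.
have [/andP[p1 p2]|nn] := boolP ((B i k < 0) && (B k j < 0)).
  rewrite mutate_matrix_neg // mutate_matrix_pos ?sjk ?ski //.
  rewrite !(rmorphD, rmorphN, rmorphM) /= mulrBr sij key; ring.
rewrite !mutate_matrix_same // ?sjk ?ski -?sik -?skj; by rewrite andbC.
Qed.

Lemma mutate_matrixK k : mutate_matrix k (mutate_matrix k B) = B.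
Proof.
apply/matrixP=> i j.
have [jk|jk] := boolP ((i == k) || (j == k)).
  by rewrite mxE jk mutate_matrix_k // opprK.
have ik : (i == k) || (k == k) by rewrite eqxx orbT.
have kj : (k == k) || (j == k) by rewrite eqxx.
rewrite [LHS]mxE (negbTE jk) (mutate_matrix_k ik) (mutate_matrix_k kj).
rewrite mxE (negbTE jk) !normrN mulrN mulNr -opprD.
set s := `|B i k| * B k j + _; rewrite -addrA; suff ->
  : (s %/ 2)%Z + (- s %/ 2)%Z = 0 by rewrite addr0.
(* Floor division by 2 commutes with negation only on even integers, so the evenness of the
   correction term has to be shown. *)
suff [q ->] : exists q, s = q + q by rewrite opprD !divz2_double subrr.
rewrite /s.
have [x0|x0|->] := ltrgtP (B i k) 0; last by exists 0; rewrite normr0 !mul0r.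
- have [y0|y0|->] := ltrgtP (B k j) 0; last by exists 0; rewrite normr0 !mulr0.
    by exists (- (B i k * B k j)); rewrite !ltr0_norm //; ring.
  by exists 0; rewrite ltr0_norm // gtr0_norm //; ring.
- have [y0|y0|->] := ltrgtP (B k j) 0; last by exists 0; rewrite normr0 !mulr0.
    by exists 0; rewrite (ltr0_norm y0) (gtr0_norm x0); ring.
  by exists (B i k * B k j); rewrite !gtr0_norm //; ring.
Qed.

End Skew.

Definition mutations (ks : seq 'I_n) B : 'M[int]_n :=
  foldl (fun B k => mutate_matrix k B) B ks.

Definition edge_weight B i j : nat := absz (B i j * B j i).

(** A condition on the matrix alone and stable under mutation; all arguments on cycles and relations
    run on it without mentioning cluster variables. *)
Definition two_finite B : Prop :=
  skew_symmetrisable B /\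
  forall ks i j, (edge_weight (mutations ks B) i j <= 3)%N.

Lemma two_finite_mutate k B : two_finite B -> two_finite (mutate_matrix k B).
Proof.
move=> [skB bB]; split; first exact: mutate_matrix_skew.
by move=> ks i j; apply: (bB (k :: ks)).
Qed.

End MatrixMutation.

(* x, y, z and x', y', z' are the absolute values of the entries of a cyclically
   oriented triangle read in the two directions; the last three hypotheses bound
   the weight of the edge opposite to a vertex after mutation at that vertex. *)
Lemma triangle_arith (x x' y y' z z' : nat) :
  (0 < x <= 3 -> 0 < x' <= 3 -> 0 < y <= 3 -> 0 < y' <= 3 ->
   0 < z <= 3 -> 0 < z' <= 3 ->
   x * x' <= 3 -> y * y' <= 3 -> z * z' <= 3 ->
   x * y * z = x' * y' * z' ->
   `|x * y - z'| * `|x' * y' - z| <= 3 ->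
   `|y * z - x'| * `|y' * z' - x| <= 3 ->
   `|z * x - y'| * `|z' * x' - y| <= 3 ->
   [|| [&& (x * x' == 1), (y * y' == 1), (z * z' == 1), x * y == z' & x' * y' == z],
       [&& (x * x' == 1), (y * y' == 2), (z * z' == 2), x * y == z' & x' * y' == z],
       [&& (x * x' == 2), (y * y' == 1), (z * z' == 2), x * y == z' & x' * y' == z] |
       [&& (x * x' == 2), (y * y' == 2), (z * z' == 1),
         x * y == z'.+1 & x' * y' == z.+1]])%N.
Proof.
move=> hx hx' hy hy' hz hz'.
pose P x x' y y' z z' := ([==> x * x' <= 3, y * y' <= 3, z * z' <= 3,
   x * y * z == x' * y' * z',
   `|x * y - z'| * `|x' * y' - z| <= 3,
   `|y * z - x'| * `|y' * z' - x| <= 3,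
   `|z * x - y'| * `|z' * x' - y| <= 3 =>
   [|| [&& (x * x' == 1), (y * y' == 1), (z * z' == 1), x * y == z' & x' * y' == z],
       [&& (x * x' == 1), (y * y' == 2), (z * z' == 2), x * y == z' & x' * y' == z],
       [&& (x * x' == 2), (y * y' == 1), (z * z' == 2), x * y == z' & x' * y' == z] |
       [&& (x * x' == 2), (y * y' == 2), (z * z' == 1),
         x * y == z'.+1 & x' * y' == z.+1]]])%N.
have in3 (a : nat) : (0 < a <= 3)%N -> a \in [:: 1; 2; 3]%N.
  by case: a => [|[|[|[|]]]].
have : all (fun x => all (fun x' => all (fun y => all (fun y' => all (fun z =>
   all (P x x' y y' z) [:: 1; 2; 3]%N) [:: 1; 2; 3]%N) [:: 1; 2; 3]%N)
   [:: 1; 2; 3]%N) [:: 1; 2; 3]%N) [:: 1; 2; 3]%N by vm_compute.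
move/allP/(_ _ (in3 _ hx))/allP/(_ _ (in3 _ hx'))/allP/(_ _ (in3 _ hy)).
move/allP/(_ _ (in3 _ hy'))/allP/(_ _ (in3 _ hz))/allP/(_ _ (in3 _ hz')).
by rewrite /P => H h1 h2 h3 /eqP h4 h5 h6 h7; rewrite h1 h2 h3 h4 h5 h6 h7 in H.
Qed.

Section TwoFinite.
Variables (n : nat) (B : 'M[int]_n).
Hypothesis fB : two_finite B.
Let skB : skew_symmetrisable B := fB.1.

Lemma edge_weightC i j : edge_weight B i j = edge_weight B j i.
Proof. by rewrite /edge_weight mulrC. Qed.

Lemma two_finite_weight i j : (edge_weight B i j <= 3)%N.
Proof. exact: (fB.2 [::]). Qed.

Lemma two_finite_weight1 k i j : (edge_weight (mutate_matrix k B) i j <= 3)%N.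
Proof. exact: (fB.2 [:: k]). Qed.

Lemma arrow_entries i j : 0 < B i j ->
  exists x x' : nat, [/\ B i j = x%:Z, B j i = - x'%:Z,
    (0 < x <= 3)%N, (0 < x' <= 3)%N & (x * x' <= 3)%N].
Proof.
move=> ij; have := two_finite_weight i j; have := skew_gt0 skB i j.
rewrite ij /edge_weight => /esym ji wij.
exists (absz (B i j)), (absz (B j i)).
have : (absz (B i j) * absz (B j i) <= 3)%N by rewrite -abszM.
by split; nia.
Qed.

Lemma triangle_oriented i j k :
  0 < B i j -> B j k != 0 -> B k i != 0 -> 0 < B j k /\ 0 < B k i.
Proof.
(* Otherwise mutating at the vertex that is neither source nor sink would create
   an edge of weight at least 4. *)
have nt a b c : 0 < B a b -> 0 < B b c -> 0 < B a c -> False.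
  move=> /[dup] ab /arrow_entries[x [x' [Ex Ex' hx hx' _]]].
  move=> /[dup] bc /arrow_entries[y [y' [Ey Ey' hy hy' _]]].
  move=> /arrow_entries[z [z' [Ez Ez' hz hz' _]]].
  have := two_finite_weight1 b a c; rewrite /edge_weight.
  rewrite (mutate_matrix_pos skB) // (mutate_matrix_neg skB) -?(skew_gt0 skB) //.
  rewrite Ex Ex' Ey Ey' Ez Ez'; clear -hx hx' hy hy' hz hz'.
  have xy : (0 < x * y)%N by rewrite muln_gt0; case/andP: hx => ->; case/andP: hy.
  have xy' : (0 < x' * y')%N by rewrite muln_gt0; case/andP: hx' => ->; case/andP: hy'.
  have -> : (z%:Z + x%:Z * y%:Z) = (z + x * y)%N by rewrite PoszD PoszM.
  have -> : (- z'%:Z - - y'%:Z * - x'%:Z) = - (z' + x' * y')%N%:Z.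
    by rewrite PoszD PoszM; ring.
  by rewrite abszM abszN !absz_nat; nia.
move=> ij jk ki.
have ji : B j i < 0 by rewrite -(skew_gt0 skB).
have [kj|jk0] := ltP 0 (B k j).
  have [ik|ki0] := ltP 0 (B i k); first by case: (nt i k j).
  have ki1 : 0 < B k i by rewrite (skew_gt0 skB) lt_neqAle ki0 -(skew_eq0 skB) ki.
  by case: (nt k i j).
have jk1 : 0 < B j k by rewrite lt_neqAle eq_sym jk leNgt -(skew_gt0 skB k j) -leNgt.
split=> //; rewrite lt_neqAle eq_sym ki leNgt -(skew_gt0 skB i k).
by apply/negP=> ik; case: (nt i j k).
Qed.

(** The edge opposite to j disappears under mutation at j, except when both edges at j have weight
    2: then it is reversed and keeps weight 1. *)
Lemma triangle_weights i j k :
  0 < B i j -> 0 < B j k -> 0 < B k i ->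
  [\/ [/\ edge_weight B i j = 1%N, edge_weight B j k = 1%N, edge_weight B k i = 1%N
        & mutate_matrix j B i k = 0],
      [/\ edge_weight B i j = 1%N, edge_weight B j k = 2%N, edge_weight B k i = 2%N
        & mutate_matrix j B i k = 0],
      [/\ edge_weight B i j = 2%N, edge_weight B j k = 1%N, edge_weight B k i = 2%N
        & mutate_matrix j B i k = 0] |
      [/\ edge_weight B i j = 2%N, edge_weight B j k = 2%N, edge_weight B k i = 1%N,
          0 < mutate_matrix j B i k & edge_weight (mutate_matrix j B) i k = 1%N]].
Proof.
move=> ij jk ki.
have [ji kj ik] : [/\ B j i < 0, B k j < 0 & B i k < 0] by rewrite -!(skew_gt0 skB).
have w1 := two_finite_weight1 j i k.
have w2 := two_finite_weight1 k j i.
have w3 := two_finite_weight1 i k j.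
move: w1 w2 w3 (skew_triangle skB i j k); rewrite /edge_weight.
rewrite (mutate_matrix_pos skB ij jk) (mutate_matrix_neg skB kj ji).
rewrite (mutate_matrix_pos skB jk ki) (mutate_matrix_neg skB ik kj).
rewrite (mutate_matrix_pos skB ki ij) (mutate_matrix_neg skB ji ik).
move: ij jk ki => /arrow_entries[x [x' [Ex Ex' hx hx' hxx]]].
move=> /arrow_entries[y [y' [Ey Ey' hy hy' hyy]]].
move=> /arrow_entries[z [z' [Ez Ez' hz hz' hzz]]].
rewrite Ex Ex' Ey Ey' Ez Ez'.
clear - hx hx' hy hy' hz hz' hxx hyy hzz.
have E (a b c a' b' c' : nat) : absz ((- c'%:Z + a%:Z * b%:Z) * (c%:Z - - b'%:Z * -
  a'%:Z))
    = (`|a * b - c'| * `|a' * b' - c|)%N.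
  rewrite abszM mulrNN -!PoszM [(b' * a')%N]mulnC.
  by congr (_ * _)%N; move: (a * b)%N (a' * b')%N => u v; lia.
rewrite !E !abszM !abszN !absz_nat !mulrN !mulNr !opprK -!PoszM => w1 w2 w3 [w4].
have := triangle_arith hx hx' hy hy' hz hz' hxx hyy hzz w4 w1 w2 w3.
case/or4P=> /and5P[/eqP-> /eqP-> /eqP-> /eqP -> /eqP ->].
- by constructor 1; split=> //; rewrite addNr.
- by constructor 2; split=> //; rewrite addNr.
- by constructor 3; split=> //; rewrite addNr.
- constructor 4; split=> //; first by rewrite addrC subr_gt0 ltz_nat.
  have E1 (a : nat) : Posz a.+1 - Posz a = 1 by lia.
  by rewrite !E1.
Qed.

Lemma path_weight i k j : 0 < B i k -> 0 < B k j -> B i j = 0 ->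
  0 < mutate_matrix k B i j /\
  edge_weight (mutate_matrix k B) i j
    = (edge_weight B i k * edge_weight B k j)%N.
Proof.
move=> ik kj ij.
have ji : B j i = 0 by apply/eqP; rewrite (skew_eq0 skB) ij.
have [ki jk] : B k i < 0 /\ B j k < 0 by rewrite -!(skew_gt0 skB).
rewrite /edge_weight (mutate_matrix_pos skB ik kj) (mutate_matrix_neg skB jk ki).
rewrite ij ji sub0r add0r mulr_gt0 //; split=> //.
by rewrite mulrN abszN -abszM; congr absz; ring.
Qed.

End TwoFinite.

(** * Cycles in 2-finite diagrams *)

Definition adjacent n (B : 'M[int]_n) : rel 'I_n := fun i j => B i j != 0.

Lemma adjacentC n (B : 'M[int]_n) : skew_symmetrisable B ->
  ssrbool.symmetric (adjacent B).
Proof. by move=> skB i j; rewrite /adjacent (skew_eq0 skB). Qed.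

Section CycleOrientation.
Variable n : nat.
Implicit Types (B : 'M[int]_n) (x y z : 'I_n) (p c : seq 'I_n).

Lemma arrowVarrow B x y : skew_symmetrisable B -> B x y != 0 ->
  (0 < B x y) || (0 < B y x).
Proof. by move=> skB xy; rewrite (skew_gt0 skB y x) orbC -neq_lt. Qed.

Lemma mutate_nonneighbour B k i j : skew_symmetrisable B -> i != k ->
  ~~ adjacent B k i -> mutate_matrix k B i j = B i j /\ mutate_matrix k B j i = B j i.
Proof.
move=> skB ik; rewrite /adjacent negbK => /eqP ki0.
have ki : B i k = 0 by apply/eqP; rewrite (skew_eq0 skB) ki0.
have [->|jk] := eqVneq j k.
  by rewrite !mutate_matrix_k ?eqxx ?orbT // ki ki0 oppr0.
by rewrite !(mutate_matrix_nbr skB) // ki eqxx ?orbT.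
Qed.

Lemma contract_cycle B x y m z :
    two_finite B -> m != [::] -> induced_cycle (adjacent B) (x :: y :: rcons m z) ->
    0 < B z x -> 0 < B x y ->
  [/\ induced_cycle (adjacent (mutate_matrix x B)) (y :: rcons m z),
      0 < mutate_matrix x B z y,
      edge_weight (mutate_matrix x B) z y = (edge_weight B z x * edge_weight B x y)%N
    & {in y :: rcons m z &, forall u v, (u, v) != (y, z) -> (u, v) != (z, y) ->
       mutate_matrix x B u v = B u v}].
Proof.
move=> fB m0 ic zx xy; have skB := fB.1; have se := adjacentC skB.
have skB' := mutate_matrix_skew skB x; have se' := adjacentC skB'.
have [_ uc _] := ic.
have nb := induced_cycle_neighbours se ic.
have zc : z \in y :: rcons m z by rewrite inE mem_rcons inE eqxx orbT.
(* The cycle has at least four vertices, so the two neighbours of x are not adjacent. This is read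
   off at y after rotating x to the end. *)
have zy : B z y = 0.
  have ic1 := induced_cycle_rot 1 se ic; rewrite rot1_cons rcons_cons in ic1.
  case: m m0 ic1 {ic uc nb zc} => // w m _ /= ic1.
  have nb := induced_cycle_neighbours se ic1.
  have [_ uc _] := ic1.
  have := nb z; rewrite !(inE, mem_rcons) eqxx !orbT => /(_ isT).
  move: uc; rewrite /= !(inE, mem_rcons, rcons_uniq, negb_or, eqxx) /=.
  case/and3P=> _ /andP[_ /andP[wz _]] /andP[/andP[xz _] _].
  rewrite eq_sym (negbTE wz) eq_sym (negbTE xz) /adjacent => /negbFE/eqP yz.
  by apply/eqP; rewrite (skew_eq0 skB) yz.
have [zy' wzy'] := path_weight fB zx xy zy.
have yz' : adjacent (mutate_matrix x B) y z by rewrite se' /adjacent gt_eqF.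
have same : {in y :: rcons m z &, forall u v, (u, v) != (y, z) -> (u, v) != (z, y) ->
       mutate_matrix x B u v = B u v}.
  move=> u v uc' vc' uv vu.
  have neqx w : w \in y :: rcons m z -> w != x.
    by apply: contraTneq => ->; case/andP: uc.
  have [au|/(mutate_nonneighbour v skB (neqx u uc'))[]//] := boolP (adjacent B x u).
  have [av|/(mutate_nonneighbour u skB (neqx v vc'))[]//] := boolP (adjacent B x v).
  have [uv0|uvn] := eqVneq u v.
    by rewrite uv0 (skew_diag skB) (skew_diag skB').
  move: au av uv vu; rewrite !nb // !xpair_eqE.
  by case/orP=> /eqP Eu; case/orP=> /eqP Ev; move: uvn; rewrite Eu Ev !eqxx.
split=> //.
apply: induced_cycle_contract ic _ _ => // u v uc' vc' uv vu.
by rewrite /adjacent same.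
Qed.

(** Cyclic orientation is a local matter: no vertex of the cycle may be a sink. The induction on the
    length ends at [triangle_oriented]. *)
Lemma cycle_turn m B x y z p : (size p <= m)%N -> two_finite B ->
  induced_cycle (adjacent B) (x :: y :: z :: p) -> 0 < B x y -> 0 < B y z.
Proof.
elim: m => [|m IHm] in B x y z p *.
  rewrite leqn0 size_eq0 => /eqP -> fB ic xy; have skB := fB.1.
  have [_ _ /(_ x)ec] := ic.
  have yz : B y z != 0 by have := ec 1%N 2%N isT.
  have zx : B z x != 0 by rewrite (skew_eq0 skB); have := ec 0%N 2%N isT.
  by case: (triangle_oriented fB xy yz zx).
have [pm _ fB|] := leqP (size p) m; first exact: (IHm _ _ _ _ _ pm fB).
case/lastP: p => // p q; rewrite size_rcons ltnS => mp pm fB.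
have {mp pm} sp : size p = m by apply/eqP; rewrite eqn_leq -ltnS pm mp.
(* If y is a sink and x lies on a directed path, contracting x gives a shorter
   cycle in which y is still a sink; if x is a source, mutate at x first. *)
have sink B1 x1 y1 z1 p1 q1 : size p1 = m -> two_finite B1 ->
    induced_cycle (adjacent B1) (x1 :: y1 :: z1 :: rcons p1 q1) ->
    0 < B1 q1 x1 -> 0 < B1 x1 y1 -> 0 < B1 z1 y1 -> False.
  move=> sp1 fB1 ic qx xy zy; have skB := fB1.1.
  have [ic' qy _ same] := @contract_cycle B1 x1 y1 (z1 :: p1) q1 fB1 isT ic qx xy.
  have se' := adjacentC (mutate_matrix_skew skB x1).
  have fB' := two_finite_mutate x1 fB1.
  have := induced_cycle_rot (size p1).+2 se' ic'.
  rewrite (_ : rot _ _ = q1 :: y1 :: z1 :: p1); last first.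
    by rewrite -cats1; apply: (rot_size_cat [:: y1, z1 & p1] [:: q1]).
  move=> icr.
  have := IHm _ q1 y1 z1 p1 _ fB' icr qy; rewrite sp1 => /(_ (leqnn _)).
  have uc : uniq (y1 :: z1 :: rcons p1 q1) by case: ic'.
  rewrite (skew_gt0 fB'.1) same ?inE ?eqxx ?orbT //.
  - by rewrite ltNge ltW.
  - rewrite xpair_eqE; move: uc; rewrite /= inE => /andP[+ _].
    by rewrite negb_or eq_sym => /andP[/negbTE-> _].
  - rewrite xpair_eqE; move: uc; rewrite /= !inE !mem_rcons !inE.
    by case/and3P=> _ + _; rewrite negb_or => /andP[/negbTE-> _].
move=> ic xy; have skB := fB.1; have se := adjacentC skB.
have [_ uc _] := ic.
have [_ _ /(_ x)ec] := ic.
have yz : B y z != 0 by have := ec 1%N 2%N isT.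
have nb := @induced_cycle_neighbours _ _ x y (z :: p) q se ic.
have xq : adjacent B x q by rewrite nb ?eqxx ?orbT // !(inE, mem_rcons) eqxx !orbT.
case/orP: (arrowVarrow skB yz) => // zy.
case/orP: (arrowVarrow skB xq) => [{}xq|qx]; last by case: (sink B x y z p q).
have src u : u \in x :: y :: z :: rcons p q -> 0 <= B x u.
  rewrite inE => /predU1P[->|uc']; first by rewrite (skew_diag skB).
  have := nb u uc'; case: eqP => [->|_]; first by rewrite ltW.
  by case: eqP => [->|_ /=]; [rewrite ltW | move/negbFE/eqP->].
pose B1 := mutate_matrix x B.
have same u v : u \in x :: y :: z :: rcons p q -> v \in x :: y :: z :: rcons p q ->
    u != x -> v != x -> B1 u v = B u v.
  move=> /src xu /src xv ux vx; rewrite /B1 mutate_matrix_same //.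
    by rewrite (skew_gt0 skB) ltNge xu.
  by rewrite [B x v < 0]ltNge xv andbF.
have B1x u v : (u == x) || (v == x) -> B1 u v = - B u v.
  exact: mutate_matrix_k.
have fB1 : two_finite B1 := two_finite_mutate x fB.
have se1 := adjacentC fB1.1.
have ic1 : induced_cycle (adjacent B1) (x :: y :: z :: rcons p q).
  apply: induced_cycle_congr ic => u v uc' vc'; rewrite /adjacent.
  have [uvx|] := boolP ((u == x) || (v == x)); first by rewrite B1x // oppr_eq0.
  by rewrite negb_or => /andP[ux vx]; rewrite same.
have [yx zx] : y != x /\ z != x.
  move: uc; rewrite cons_uniq !inE !negb_or => /andP[/and3P[xy' xz _] _].
  by rewrite ![_ == x]eq_sym.
(* After the mutation x is a sink and y lies on the path z -> y -> x; reading the cycle backwards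
   from y gives the configuration that [sink] excludes. *)
have /induced_cycle_rev := induced_cycle_rot 2 se1 ic1; move=> /(_ se1).
have -> : rev (rot 2 (x :: y :: z :: rcons p q)) = y :: x :: q :: rcons (rev p) z.
  by rewrite (rot_size_cat [:: x; y]) rev_cat /= rev_cons rev_rcons.
move=> /sink; rewrite size_rev; case=> //.
- by rewrite same // !inE eqxx ?orbT.
- by rewrite B1x ?eqxx ?orbT // oppr_gt0 -(skew_gt0 skB).
- by rewrite B1x ?eqxx ?orbT // oppr_gt0 -(skew_gt0 skB).
Qed.

Lemma cycle_oriented B x y p : two_finite B ->
  induced_cycle (adjacent B) (x :: y :: p) -> 0 < B x y ->
  cycle (fun i j => 0 < B i j) (x :: y :: p).
Proof.
move=> fB ic xy; have se := adjacentC fB.1.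
have H m : (m <= size (x :: y :: p))%N ->
   forall a b l, rot m (x :: y :: p) = a :: b :: l -> 0 < B a b.
  elim: m => [_ a b l|m IHm /[dup] sm /ltnW/IHm{}IHm a b l].
    by rewrite rot0 => -[<- <- _].
  rewrite -addn1 addnC rotD //.
  have := induced_cycle_rot m se ic.
  case: (rot m _) IHm => [|a1 [|b1 [|c1 l1]]] IHm ic1 //; try by case: ic1.
  rewrite rot1_cons /= => -[<- <- _].
  by apply: (cycle_turn (leqnn _) fB ic1); apply: (IHm).
have [sc uc _] := ic.
apply: cycle_from_next => // w wc.
have [i l lE] := rot_to wc.
rewrite -(next_rot i) // lE.
have ic1 := induced_cycle_rot i se ic; rewrite lE in ic1.
case: l => [|b l] in lE ic1 *; first by case: ic1.
rewrite /= eqxx.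
have [il|/ltnW/rot_oversize E] := leqP i (size (x :: y :: p));
  first exact: (H i il w b l).
by move: lE; rewrite E => -[<- <- _].
Qed.
End CycleOrientation.

(** * Weights on chordless cycles *)

Definition triangle_pattern (a b c : nat) : bool :=
  (a, b, c) \in [:: (1, 1, 1); (1, 2, 2); (2, 1, 2); (2, 2, 1)]%N.

Definition square_pattern (a b c d : nat) : bool :=
  (a, b, c, d) \in [:: (1, 1, 1, 1); (1, 2, 1, 2); (2, 1, 2, 1)]%N.

Section CycleWeights.
Variable n : nat.
Implicit Types (B : 'M[int]_n) (x y z : 'I_n) (p c : seq 'I_n).

Lemma triangle_weights_pattern B i j k : two_finite B ->
  0 < B i j -> 0 < B j k -> 0 < B k i ->
  triangle_pattern (edge_weight B i j) (edge_weight B j k) (edge_weight B k i).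
Proof. by move=> fB ij jk ki; case: (triangle_weights fB ij jk ki) => -[-> -> ->]. Qed.

Lemma edge_weight_arrow B i j : two_finite B -> 0 < B i j ->
  (0 < edge_weight B i j <= 3)%N.
Proof.
move=> fB ij; rewrite two_finite_weight // andbT /edge_weight absz_gt0.
have ij0 : B i j != 0 by rewrite gt_eqF.
by rewrite mulf_neq0 // (skew_eq0 fB.1).
Qed.

Lemma contract_edge B x y m z u v :
    two_finite B -> m != [::] -> induced_cycle (adjacent B) (x :: y :: rcons m z) ->
    0 < B z x -> 0 < B x y ->
    u \in y :: rcons m z -> v \in y :: rcons m z ->
    (u \notin [:: y; z]) || (v \notin [:: y; z]) ->
  mutate_matrix x B u v = B u v /\
  edge_weight (mutate_matrix x B) u v = edge_weight B u v.
Proof.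
move=> fB m0 ic zx xy uc vc uvyz.
have [_ _ _ same] := contract_cycle fB m0 ic zx xy.
have ne a b : (a, b) = (y, z) \/ (a, b) = (z, y) ->
    ~~ ((a \notin [:: y; z]) || (b \notin [:: y; z])).
  by case=> -[-> ->]; rewrite !inE !eqxx !orbT.
have vuyz : (v \notin [:: y; z]) || (u \notin [:: y; z]) by rewrite orbC.
have uvE : mutate_matrix x B u v = B u v.
  by apply: same => //; apply: contraTneq uvyz => ?; apply: ne; auto.
have vuE : mutate_matrix x B v u = B v u.
  by apply: same => //; apply: contraTneq vuyz => ?; apply: ne; auto.
by rewrite /edge_weight uvE vuE.
Qed.

Lemma square_contract B x y z w : two_finite B ->
  induced_cycle (adjacent B) [:: x; y; z; w] ->
  0 < B x y -> 0 < B y z -> 0 < B z w -> 0 < B w x ->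
  triangle_pattern (edge_weight B y z) (edge_weight B z w)
    (edge_weight B w x * edge_weight B x y)%N.
Proof.
move=> fB ic xy yz zw wx.
have [_ wy <- same] := @contract_cycle _ B x y [:: z] w fB isT ic wx xy.
have uc : uniq [:: x; y; z; w] by case: ic.
move: uc; rewrite /= !inE !negb_or => /and4P[_ /andP[nyz nyw] nzw _].
have zout : z \notin [:: y; w] by rewrite !inE negb_or eq_sym nyz nzw.
have [yzE wyz] : mutate_matrix x B y z = B y z /\
    edge_weight (mutate_matrix x B) y z = edge_weight B y z.
  by apply: (@contract_edge B x y [:: z] w _ _ fB isT ic wx xy);
    rewrite ?zout ?orbT //= !inE eqxx ?orbT.
have [zwE wzw] : mutate_matrix x B z w = B z w /\
    edge_weight (mutate_matrix x B) z w = edge_weight B z w.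
  by apply: (@contract_edge B x y [:: z] w _ _ fB isT ic wx xy);
    rewrite ?zout ?orbT //= !inE eqxx ?orbT.
rewrite -wyz -wzw; apply: triangle_weights_pattern; rewrite ?yzE ?zwE //.
exact: two_finite_mutate.
Qed.

(** Contracting any of the four vertices gives a triangle in which the two edges at that vertex are
    merged into one of product weight. Of the 81 candidate tuples only the listed ones pass all four
    tests. *)
Lemma square_weights B x y z w : two_finite B ->
  induced_cycle (adjacent B) [:: x; y; z; w] ->
  0 < B x y -> 0 < B y z -> 0 < B z w -> 0 < B w x ->
  square_pattern (edge_weight B x y) (edge_weight B y z) (edge_weight B z w)
    (edge_weight B w x).
Proof.
move=> fB ic xy yz zw wx; have rot_ic m := induced_cycle_rot m (adjacentC fB.1) ic.
have := square_contract fB ic xy yz zw wx.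
have := square_contract fB (rot_ic 1%N) yz zw wx xy.
have := square_contract fB (rot_ic 2%N) zw wx xy yz.
have := square_contract fB (rot_ic 3%N) wx xy yz zw.
have in3 (a : nat) : (0 < a <= 3)%N -> a \in [:: 1; 2; 3]%N.
  by case: a => [|[|[|[|]]]].
have := in3 _ (edge_weight_arrow fB xy); have := in3 _ (edge_weight_arrow fB yz).
have := in3 _ (edge_weight_arrow fB zw); have := in3 _ (edge_weight_arrow fB wx).
move: (edge_weight _ _ _) (edge_weight _ _ _) (edge_weight _ _ _) (edge_weight _ _ _).
move=> a b e d d3 e3 b3 a3 h1 h2 h3 h4.
have : all (fun a => all (fun b => all (fun e => all (fun d =>
   [==> triangle_pattern a b (e * d)%N, triangle_pattern d a (b * e)%N,
        triangle_pattern e d (a * b)%N, triangle_pattern b e (d * a)%N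
      => square_pattern a b e d]) [:: 1; 2; 3]%N) [:: 1; 2; 3]%N)
  [:: 1; 2; 3]%N) [:: 1; 2; 3]%N by vm_compute.
move=> /allP/(_ a a3)/allP/(_ b b3)/allP/(_ e e3)/allP/(_ d d3).
by rewrite h1 h2 h3 h4.
Qed.

Lemma pentagon_contract B x y z w v : two_finite B ->
  induced_cycle (adjacent B) [:: x; y; z; w; v] ->
  0 < B x y -> 0 < B y z -> 0 < B z w -> 0 < B w v -> 0 < B v x ->
  square_pattern (edge_weight B y z) (edge_weight B z w) (edge_weight B w v)
    (edge_weight B v x * edge_weight B x y)%N.
Proof.
move=> fB ic xy yz zw wv vx.
have [ic' wy <- _] := @contract_cycle _ B x y [:: z; w] v fB isT ic vx xy.
have uc : uniq [:: x; y; z; w; v] by case: ic.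
move: uc; rewrite /= !inE !negb_or => /and5P[_ /and3P[nyz nyw nyv] /andP[nzw nzv] nwv
  _].
have zout : z \notin [:: y; v] by rewrite !inE negb_or eq_sym nyz nzv.
have wout : w \notin [:: y; v] by rewrite !inE negb_or eq_sym nyw nwv.
have [yzE wyz] := @contract_edge B x y [:: z; w] v y z fB isT ic vx xy
  ltac:(by rewrite !inE eqxx) ltac:(by rewrite !inE eqxx ?orbT) ltac:(by rewrite zout
    orbT).
have [zwE wzw] := @contract_edge B x y [:: z; w] v z w fB isT ic vx xy
  ltac:(by rewrite !inE eqxx ?orbT) ltac:(by rewrite !inE eqxx ?orbT) ltac:(by rewrite
    zout).
have [wvE wwv] := @contract_edge B x y [:: z; w] v w v fB isT ic vx xy
  ltac:(by rewrite !inE eqxx ?orbT) ltac:(by rewrite !inE eqxx ?orbT) ltac:(by rewrite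
    wout).
rewrite -wyz -wzw -wwv; apply: square_weights; rewrite ?yzE ?zwE ?wvE //.
exact: two_finite_mutate.
Qed.

(** For a pentagon the five contractions to squares leave only weights 1. From six vertices on, the
    edge created by contracting x has weight 1 by induction, and this weight is the product of the
    two weights at x. *)
Lemma long_cycle_weight m B x y p : (size p <= m)%N -> two_finite B ->
  induced_cycle (adjacent B) (x :: y :: p) -> (2 < size p)%N -> 0 < B x y ->
  edge_weight B x y = 1%N.
Proof.
elim: m => [|m IHm] in B x y p *; first by rewrite leqNgt => sp _ _ /ltnW/ltnW sp';
  rewrite sp' in sp.
have [pm _ fB|] := leqP (size p) m; first exact: (IHm _ _ _ _ pm fB).
move=> mp pm fB ic sp xy.
have {mp pm} pm : size p = m.+1 by apply/eqP; rewrite eqn_leq pm mp.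
have co := cycle_oriented fB ic xy.
have [p3|p3] := eqVneq (size p) 3%N.
  move: p p3 ic co {sp pm} => [|z [|w [|v []]]] //= _ ic /and5P[_ yz zw wv /andP[vx _]].
  have rot_ic j := induced_cycle_rot j (adjacentC fB.1) ic.
  have := pentagon_contract fB ic xy yz zw wv vx.
  have := pentagon_contract fB (rot_ic 1%N) yz zw wv vx xy.
  have := pentagon_contract fB (rot_ic 2%N) zw wv vx xy yz.
  have := pentagon_contract fB (rot_ic 3%N) wv vx xy yz zw.
  have := pentagon_contract fB (rot_ic 4%N) vx xy yz zw wv.
  have in3 (a : nat) : (0 < a <= 3)%N -> a \in [:: 1; 2; 3]%N.
    by case: a => [|[|[|[|]]]].
  have := in3 _ (edge_weight_arrow fB xy); have := in3 _ (edge_weight_arrow fB yz).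
  have := in3 _ (edge_weight_arrow fB zw); have := in3 _ (edge_weight_arrow fB wv).
  have := in3 _ (edge_weight_arrow fB vx).
  move: (edge_weight _ _ _) (edge_weight _ _ _) (edge_weight _ _ _) (edge_weight _ _ _)
    (edge_weight _ _ _).
  move=> a b e d f f3 d3 e3 b3 a3 h1 h2 h3 h4 h5; apply/eqP.
  have : all (fun a => all (fun b => all (fun e => all (fun d => all (fun f =>
     [==> square_pattern a b e (d * f)%N, square_pattern f a b (e * d)%N,
          square_pattern d f a (b * e)%N, square_pattern e d f (a * b)%N,
          square_pattern b e d (f * a)%N => a == 1%N])
     [:: 1; 2; 3]%N) [:: 1; 2; 3]%N) [:: 1; 2; 3]%N) [:: 1; 2; 3]%N) [:: 1; 2; 3]%N.
    by vm_compute.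
  move=> /allP/(_ a a3)/allP/(_ b b3)/allP/(_ e e3)/allP/(_ d d3)/allP/(_ f f3).
  by rewrite h1 h2 h3 h4 h5.
case/lastP: p => // p v in ic sp p3 pm co *; rewrite size_rcons in sp p3 pm.
have vx : 0 < B v x.
  by move: co; rewrite /= rcons_path last_rcons => /and3P[].
have p0 : p != [::] by case: (p) sp.
have [ic' vy wvy _] := contract_cycle fB p0 ic vx xy.
have fB' := two_finite_mutate x fB.
have := induced_cycle_rot (size p).+1 (adjacentC fB'.1) ic'.
rewrite -cats1 (rot_size_cat (y :: p)) => icr.
have sp2 : (2 < size p)%N by rewrite ltn_neqAle -ltnS sp andbT;
  apply: contraNneq p3 => <-.
have := IHm _ v y p _ fB' icr sp2 vy; rewrite wvy; case: pm => -> /(_ (leqnn _)).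
by move/eqP; rewrite muln_eq1 => /andP[_ /eqP].
Qed.

End CycleWeights.

Local Close Scope ring_scope.
Local Open Scope group_scope.

(** * Relations between involutions *)

Section Involutions.
Variable G : groupType.
Implicit Types x y z g : G.

Lemma commuteJ x y g : commute (x ^ g) (y ^ g) <-> commute x y.
Proof.
rewrite /commute -!conjMg; split=> [/conjg_inj //|-> //].
Qed.

Lemma commute_conj x y : commute x y -> x ^ y = x.
Proof. by move=> c; rewrite conjgE c mulKg. Qed.

Lemma involutionV x : x * x = 1 -> x^-1 = x.
Proof. exact: mulg1_eq. Qed.

Lemma involutionJ x g : x * x = 1 -> x ^ g * x ^ g = 1.
Proof. by move=> xx; rewrite -conjMg xx conj1g. Qed.

Lemma conj_involutionK g x : g * g = 1 -> (x ^ g) ^ g = x.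
Proof. by move=> gg; rewrite -conjgM gg conjg1. Qed.

Lemma conjg_conjg g h x : g * g = 1 -> x ^ (h ^ g) = ((x ^ g) ^ h) ^ g.
Proof. by move=> gg; rewrite [h ^ g]conjgE (involutionV gg) mulgA !conjgM. Qed.

Lemma commute_conjl x y g : g * g = 1 -> commute (x ^ g) y <-> commute x (y ^ g).
Proof. by move=> gg; rewrite -(commuteJ _ _ g) conj_involutionK. Qed.

Lemma involution_commute x y : x * x = 1 -> y * y = 1 ->
  (x * y) ^+ 2 = 1 <-> commute x y.
Proof.
move=> xx yy; rewrite expg2; split=> [h|c].
  apply: (@mulIg _ (x * y)); rewrite h -[y * x * _]mulgA [x * (x * y)]mulgA xx mul1g.
  by rewrite yy.
by rewrite {2}c mulgA -[x * y * y]mulgA yy mulg1.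
Qed.

(** The form in which an edge of weight 1 is used throughout: it exchanges the conjugated generator
    with the conjugating one. *)
Lemma involution_braid x y : x * x = 1 -> y * y = 1 ->
  (x * y) ^+ 3 = 1 -> x ^ y = y ^ x.
Proof.
move=> xx yy; rewrite !conjgE (involutionV xx) (involutionV yy).
rewrite !expgS expg0 mulg1 => h.
apply: (@mulgI _ (x * (y * x))); transitivity (1 : G).
  by rewrite -[RHS]h !mulgA.
rewrite -[x * (y * x) * _]mulgA -[y * x * _]mulgA [x * (x * _)]mulgA xx mul1g.
by rewrite [y * (y * x)]mulgA yy mul1g xx.
Qed.

Lemma involution_order4 x y : x * x = 1 -> y * y = 1 ->
  (x * y) ^+ 4 = 1 -> commute x (x ^ y).
Proof.
move=> xx yy h; apply/involution_commute => //; first exact: involutionJ.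
by rewrite -h conjgE (involutionV yy) !expgS expg0 !mulg1 !mulgA.
Qed.

Lemma order_swap x y m : x * x = 1 -> y * y = 1 ->
  (x * y) ^+ m = 1 -> (y * x) ^+ m = 1.
Proof.
move=> xx yy h; apply: invg_inj; rewrite invg1 -h -expVgn invgM.
by rewrite (involutionV xx) (involutionV yy).
Qed.

Lemma orderJ x y g m : (x * y) ^+ m = 1 -> (x ^ g * y ^ g) ^+ m = 1.
Proof. by move=> h; rewrite -conjMg -conjXg h conj1g. Qed.

End Involutions.

(** * Iterated conjugates and the relations of a diagram *)

Section IterConj.
Variables (I : eqType) (G : groupType).
Implicit Types (s t : I -> G) (m : seq I).

Definition iter_conj s m (g : G) : G := foldr (fun i h => h ^ s i) g m.

Lemma iter_conj_cat s m1 m2 g :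
  iter_conj s (m1 ++ m2) g = iter_conj s m1 (iter_conj s m2 g).
Proof. exact: foldr_cat. Qed.

Lemma iter_conj_rcons s m i g :
  iter_conj s (rcons m i) g = iter_conj s m (g ^ s i).
Proof. by rewrite -cats1 iter_conj_cat. Qed.

Lemma iter_conj_eq s t m g : {in m, s =1 t} -> iter_conj s m g = iter_conj t m g.
Proof.
elim: m => //= i m IHm st; rewrite IHm ?st ?inE ?eqxx // => j jm.
by rewrite st // inE jm orbT.
Qed.

Lemma iter_conjJ s t m g h : {in m, forall i, t i = s i ^ h} ->
  iter_conj t m (g ^ h) = (iter_conj s m g) ^ h.
Proof.
elim: m => //= i m IHm st; rewrite IHm => [|j jm].
  by rewrite st ?inE ?eqxx // -conjJg.
by rewrite st // inE jm orbT.
Qed.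

Lemma iter_conj_commute s m g h : {in m, forall i, commute (s i) h} ->
  iter_conj s m (g ^ h) = (iter_conj s m g) ^ h.
Proof. by move=> sh; apply: iter_conjJ => i im; rewrite commute_conj //; apply: sh. Qed.

End IterConj.

(** Weight 0 means that there is no edge, so the exponent 2 of non-adjacent vertices needs no
    separate case. *)
Definition bond_order (w : nat) : nat :=
  match w with 0 => 2 | 1 => 3 | 2 => 4 | 3 => 6 | _ => 0 end.

Section DiagramRelations.
Variables (n : nat) (G : groupType).
Implicit Types (B : 'M[int]_n) (s : 'I_n -> G).

Definition coxeter_relations B s : Prop :=
  (forall i, s i * s i = 1) /\
  forall i j, i != j -> (s i * s j) ^+ bond_order (edge_weight B i j) = 1.

Definition arrows B : rel 'I_n := fun i j => (0 < B i j)%R.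

Definition simply_laced B : rel 'I_n := fun i j => edge_weight B i j == 1%N.

(* For c = i_0, ..., i_{d-1} the iterated conjugate is
   s_{i_1} ... s_{i_{d-2}} s_{i_{d-1}} s_{i_{d-2}} ... s_{i_1}. *)
Definition cycle_relations B s : Prop :=
  forall x q z, let c := x :: rcons q z in
  induced_cycle (adjacent B) c -> cycle (arrows B) c ->
  cycle (simply_laced B) c \/ edge_weight B z x = 2 ->
  commute (s x) (iter_conj s q (s z)).

Lemma edge_weight_eq0 B i j : skew_symmetrisable B ->
  (edge_weight B i j == 0%N) = ~~ adjacent B i j.
Proof.
by move=> skB; rewrite /edge_weight /adjacent absz_eq0 mulf_eq0 (skew_eq0 skB j) orbb
  negbK.
Qed.

Section Coxeter.
Variables (B : 'M[int]_n) (s : 'I_n -> G).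
Hypotheses (skB : skew_symmetrisable B) (cox : coxeter_relations B s).

Lemma coxeter_commute i j : ~~ adjacent B i j -> commute (s i) (s j).
Proof.
have [->|ij] := eqVneq i j; first by move=> _; apply: commute_refl.
rewrite -(edge_weight_eq0 _ _ skB) => /eqP w0.
by apply/(involution_commute (cox.1 i) (cox.1 j)); have := cox.2 i j ij; rewrite w0.
Qed.

Lemma weight_neq i j : edge_weight B i j != 0%N -> i != j.
Proof.
by apply: contraNneq => ->; rewrite /edge_weight skew_diag // mul0r.
Qed.

Lemma coxeter_braid i j : edge_weight B i j = 1%N -> s i ^ s j = s j ^ s i.
Proof.
move=> w1; have ij : i != j by apply: weight_neq; rewrite w1.
by apply: involution_braid; rewrite ?cox.1 //; have := cox.2 i j ij; rewrite w1.
Qed.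

Lemma coxeter_order4 i j : edge_weight B i j = 2%N -> commute (s i) (s i ^ s j).
Proof.
move=> w2; have ij : i != j by apply: weight_neq; rewrite w2.
by apply: involution_order4; rewrite ?cox.1 //; have := cox.2 i j ij; rewrite w2.
Qed.

(** The two braid relations at x exchange conjugator and conjugate, and s_x passes through the
    interior generators because they are not neighbours of x. *)
Lemma cycle_relation_rot x y q z :
  induced_cycle (adjacent B) (x :: y :: rcons q z) ->
  edge_weight B x y = 1%N -> edge_weight B z x = 1%N ->
  commute (s x) (iter_conj s (y :: q) (s z)) ->
  commute (s y) (iter_conj s (rcons q z) (s x)).
Proof.
move=> ic xy zx; rewrite /= iter_conj_rcons -(coxeter_braid zx).
have nb := induced_cycle_neighbours (adjacentC skB) ic.
have uc : uniq (x :: y :: rcons q z) by case: ic.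
rewrite iter_conj_commute => [|i iq]; last first.
  apply: coxeter_commute; rewrite adjacentC // nb ?inE ?mem_rcons ?inE ?iq ?orbT //.
  move: uc; rewrite /= rcons_uniq !(inE, mem_rcons).
  case/and3P=> _; rewrite negb_or => /andP[_ yq] /andP[zq _].
  by rewrite negb_or; apply/andP; split; [apply: contraNneq yq | apply: contraNneq zq]
    => <-.
move=> /(commute_conjl _ _ (cox.1 y)); rewrite (coxeter_braid xy).
by move/(commute_conjl _ _ (cox.1 x)).
Qed.

(** On a cycle with weights 1 the relation has to be checked for one starting vertex only, which can
    be chosen conveniently with respect to k. *)
Lemma cycle_relation_rotations m c x q z x' q' z' :
  c = x :: rcons q z -> induced_cycle (adjacent B) c -> cycle (simply_laced B) c ->
  commute (s x) (iter_conj s q (s z)) ->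
  rot m c = x' :: rcons q' z' ->
  commute (s x') (iter_conj s q' (s z')).
Proof.
wlog mc : m / (m <= size c)%N.
  move=> H; have [/H//|/ltnW/rot_oversize E] := leqP m (size c).
  by move=> cE ic sl cxz; rewrite E => E'; apply: (H 0%N _ cE ic sl cxz); rewrite ?rot0.
elim: m mc x' q' z' => [|m IHm] mc x' q' z' cE ic sl cxz.
  by rewrite rot0 cE => -[<-] /rcons_inj[<- <-].
rewrite -addn1 addnC rotD // => E.
have ic1 := induced_cycle_rot m (adjacentC skB) ic.
have sl1 : cycle (simply_laced B) (rot m c) by rewrite rot_cycle.
have [x1 [y1 [q1 [z1 E1]]]] : exists x1 y1 q1 z1, rot m c = x1 :: y1 :: rcons q1 z1.
  case: (rot m c) ic1 => [|x1 [|y1 l]]; try by case.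
  by case/lastP: l => [|q1 z1]; [case | exists x1, y1, q1, z1].
have := IHm (ltnW mc) x1 (y1 :: q1) z1 cE ic sl cxz E1.
move: E; rewrite E1 rot1_cons /= => -[<-] /rcons_inj[<- <-].
apply: cycle_relation_rot; first by rewrite E1 in ic1.
  by move: sl1; rewrite E1 /= => /andP[/eqP].
by move: sl1; rewrite E1 /= rcons_path last_rcons => /and3P[_ _ /eqP].
Qed.

End Coxeter.

Section Triangles.
Variables (B : 'M[int]_n) (s : 'I_n -> G).
Hypotheses (skB : skew_symmetrisable B) (cyc : cycle_relations B s).

Lemma triangle_induced x y z : arrows B x y -> arrows B y z -> arrows B z x ->
  induced_cycle (adjacent B) [:: x; y; z].
Proof.
move=> xy yz zx; have ad a b : arrows B a b -> adjacent B a b by apply: lt0r_neq0.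
have ne a b : arrows B a b -> a != b.
  by apply: contraTneq => ->; rewrite /arrows skew_diag // ltxx.
split=> //=; first by rewrite !inE negb_or (ne x y) // (ne y z) // eq_sym (ne z x).
move=> x0 [|[|[|i]]] [|[|[|j]]] //= ij; try by move: ij; rewrite ?andbF.
- exact: ad.
- by rewrite adjacentC // ad.
- exact: ad.
Qed.

Lemma triangle_relation x y z : arrows B x y -> arrows B y z -> arrows B z x ->
  [&& edge_weight B x y == 1, edge_weight B y z == 1 & edge_weight B z x == 1]%N
    \/ edge_weight B z x = 2 ->
  commute (s x) (s z ^ s y).
Proof.
move=> xy yz zx w; have := cyc (x := x) (q := [:: y]) (z := z); apply.
- exact: triangle_induced.
- by rewrite /= xy yz zx.
- by case: w => [/and3P[w1 w2 w3]|->]; [left; rewrite /= /simply_laced w1 w2 w3 |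
  right].
Qed.

End Triangles.

End DiagramRelations.

(** * The relations are invariant under mutation *)

(** The sign test singles out the arrows k -> i of [A]. The family [s] belongs to the mutated
    matrix, while the new family is to satisfy the relations of [A]. *)
Definition mutated_generators n (G : groupType) (A : 'M[int]_n) (k : 'I_n)
    (s : 'I_n -> G) (i : 'I_n) : G :=
  if (A i k < 0)%R then s i ^ s k else s i.

(** * Coxeter relations for the mutated generators *)

Section MutatedCoxeter.
Variables (n : nat) (G : groupType) (A : 'M[int]_n) (k : 'I_n) (s : 'I_n -> G).
Let B := mutate_matrix k A.
Let t := mutated_generators A k s.
Hypotheses (fA : two_finite A) (cox : coxeter_relations B s).
Hypothesis cyc : cycle_relations B s.
Let fB : two_finite B := two_finite_mutate k fA.
Let skA : skew_symmetrisable A := fA.1.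
Let skB : skew_symmetrisable B := fB.1.
Let ss i : s i * s i = 1 := cox.1 i.

Lemma mutated_in i : (0 < A k i)%R -> t i = s i ^ s k.
Proof. by rewrite (skew_gt0 skA) /t /mutated_generators => ->. Qed.

Lemma mutated_out i : (0 < A i k)%R -> t i = s i.
Proof. by rewrite /t /mutated_generators ltNge => /negbTE;
  rewrite le_eqVlt orbC => /norP[/negbTE ->]. Qed.

Lemma mutated_far i : ~~ adjacent A k i -> t i = s i.
Proof. by rewrite adjacentC // /adjacent negbK /t /mutated_generators => /eqP->. Qed.

Lemma mutated_k : t k = s k.
Proof. by rewrite /t /mutated_generators skew_diag. Qed.

Lemma weight_k i : edge_weight B i k = edge_weight A i k.
Proof.
by rewrite /edge_weight /B !mutate_matrix_k ?eqxx ?orbT // mulrNN.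
Qed.

Lemma mutated_arrow_k i : ((0 < B i k) = (0 < A k i))%R.
Proof. by rewrite /B mutate_matrix_k ?eqxx ?orbT // oppr_gt0 -(skew_gt0 skA). Qed.

Lemma mutated_karrow i : ((0 < B k i) = (0 < A i k))%R.
Proof. by rewrite /B mutate_matrix_k ?eqxx ?orbT // oppr_gt0 -(skew_gt0 skA). Qed.

Lemma far_commute i : ~~ adjacent A k i -> commute (s i) (s k).
Proof.
move=> ki; apply: (coxeter_commute skB cox); rewrite -(edge_weight_eq0 _ _ skB)
  weight_k.
by rewrite (edge_weight_eq0 _ _ skA) adjacentC.
Qed.

Lemma mutated_involution i : t i * t i = 1.
Proof. by rewrite /t /mutated_generators; case: ifP => _; rewrite ?involutionJ ?ss. Qed.

(** The critical pairs: one generator is conjugated, the other is not, and mutation changes their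
    entry. If i and j are not adjacent in [A], then [B] has a triangle through k whose cycle
    relation gives commutation. Otherwise j -> k -> i -> j is a triangle of [A], and its edge
    between i and j vanishes in [B] unless both edges at k have weight 2. *)
Lemma mutated_order_across i j : i != j -> (0 < A j k)%R -> (0 < A k i)%R ->
  (t i * t j) ^+ bond_order (edge_weight A i j) = 1.
Proof.
move=> ij jk ki; rewrite (mutated_out jk) (mutated_in ki).
have [Aij0|Aij] := eqVneq (A j i) 0%R.
  have [Bji Bw] := path_weight fA jk ki Aij0; rewrite -/B in Bji Bw.
  have -> : edge_weight A i j = 0%N by rewrite /edge_weight Aij0 mulr0.
  apply/involution_commute; rewrite ?involutionJ ?ss //.
  have ik' : (0 < B i k)%R by rewrite mutated_arrow_k.
  have kj' : (0 < B k j)%R by rewrite mutated_karrow.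
  have := triangle_weights_pattern fB Bji ik' kj'.
  have R1 := triangle_relation skB cyc Bji ik' kj'.
  have R2 := triangle_relation skB cyc ik' kj' Bji.
  move: R1 R2; rewrite Bw weight_k (edge_weightC B k j) weight_k (edge_weightC A k i).
  rewrite /triangle_pattern !inE => R1 R2.
  (* The triangle j, i, k of [B] has weights c, 1, c with c equal to 1 or 2, or else 2, 2, 1. Each
     branch takes a starting vertex at which the cycle relation is imposed. *)
  have [w1 w|w1] := eqVneq (edge_weight A i k) 1%N.
    have -> : s i ^ s k = s k ^ s i by apply: (coxeter_braid skB cox); rewrite weight_k.
    apply/commute_sym/R1; move: w; rewrite w1 !xpair_eqE.
    by move: (edge_weight A j k) => c; case: (c =P 2%N) => [|c2]; [right | left; lia].
  move=> w; apply/(commute_conjl _ _ (ss k)); apply: R2; right.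
  move: w w1; rewrite !xpair_eqE; lia.
have Aji : (A i j != 0)%R by rewrite (skew_eq0 skA).
have [_ ij'] := triangle_oriented fA jk (lt0r_neq0 ki) Aji.
have wik : edge_weight B i k = edge_weight A k i by rewrite weight_k edge_weightC.
have wkj : edge_weight B k j = edge_weight A j k by rewrite edge_weightC weight_k.
have nij : mutate_matrix k A j i = 0%R -> commute (s i) (s j).
  move=> Bji; apply: (coxeter_commute skB cox).
  by rewrite adjacentC // /adjacent negbK; apply/eqP.
have ik : i != k by apply: (weight_neq skB); rewrite wik -lt0n;
  case/andP: (edge_weight_arrow fA ki).
have kj : k != j by apply: (weight_neq skB); rewrite wkj -lt0n;
  case/andP: (edge_weight_arrow fA jk).
(* When s_i and s_j commute and one edge at k has weight 1, the braid relation on that edge makes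
   t_i t_j a conjugate of the product for the other edge at k. *)
have ordk m : edge_weight A k i = 1%N -> commute (s i) (s j) -> m = edge_weight A j k ->
    (s i ^ s k * s j) ^+ bond_order m = 1.
  move=> w1 ci ->; rewrite (coxeter_braid skB cox) ?wik //.
  rewrite -[X in _ * X](commute_conj (commute_sym ci)) -wkj.
  by apply/orderJ/cox.2.
have ordi m : edge_weight A j k = 1%N -> commute (s i) (s j) -> m = edge_weight A k i ->
    (s i ^ s k * s j) ^+ bond_order m = 1.
  move=> w1 ci ->; rewrite -[X in _ * X](conj_involutionK _ (ss k)); apply: orderJ.
  rewrite -(coxeter_braid skB cox) ?wkj // -[X in X * _](commute_conj ci) -wik.
  by apply/orderJ/cox.2.
case: (triangle_weights fA jk ki ij') => -[wj wi wij].
- by move=> /nij c; apply: ordk; rewrite ?wj.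
- by move=> /nij c; apply: ordi; rewrite ?wi.
- by move=> /nij c; apply: ordk; rewrite ?wj.
- move=> Bji wB; rewrite -/B in Bji wB.
  have ik' : (0 < B i k)%R by rewrite mutated_arrow_k.
  have kj' : (0 < B k j)%R by rewrite mutated_karrow.
  (* b = s j commutes with c ^ a, where c = s k and a = s i; so conjugating
     a ^ c * b by a * c gives a * b ^ a. *)
  have c1 : commute (s j) (s k ^ s i).
    by apply: (triangle_relation skB cyc Bji ik' kj'); right; rewrite wkj wj.
  have c2 : (s i ^ s k) ^ s i = s i ^ s k.
    by apply/commute_conj/commute_sym/(coxeter_order4 skB cox); rewrite wik.
  have c3 : (s j ^ s i) ^ s k = s j ^ s i.
    by apply/commute_conj/(commute_conjl _ _ (ss i)).
  have -> : s i ^ s k * s j = (s i * (s j ^ s i)) ^ (s k * s i).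
    rewrite conjMg !conjgM c2 c3; congr (_ * _); by rewrite conj_involutionK.
  rewrite -conjXg wij; have -> : s j ^ s i = s i ^ s j.
    by apply: (coxeter_braid skB cox); rewrite wB.
  have -> : s i * s i ^ s j = (s i * s j) ^+ 2.
    by rewrite conjgE (involutionV (ss j)) expg2 !mulgA.
  rewrite -expgnA mulnC expgnA.
  have -> : (s i * s j) ^+ 3 = 1 by have := cox.2 i j ij; rewrite edge_weightC wB.
  by rewrite expg1n conj1g.
Qed.

Lemma mutated_coxeter_relations : coxeter_relations A t.
Proof.
split=> [i|i j ij]; first exact: mutated_involution.
have ord_k l : l != k -> (t l * t k) ^+ bond_order (edge_weight A l k) = 1.
  move=> lk; rewrite mutated_k -weight_k /t /mutated_generators.
  case: ifP => _; last exact: cox.2.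
  rewrite -{2}(commute_conj (commute_refl (s k))); apply: orderJ.
  exact: cox.2.
have [jk|jk] := eqVneq j k; first by rewrite jk ord_k // -jk.
have [ik|ik] := eqVneq i k.
  rewrite ik edge_weightC; apply: order_swap; rewrite ?mutated_involution //.
  exact: ord_k.
have [/andP[ki kj]|ac1] := boolP ((0 < A k i) && (0 < A j k))%R.
  exact: mutated_order_across.
have [/andP[ki kj]|ac2] := boolP ((0 < A k j) && (0 < A i k))%R.
  rewrite edge_weightC; apply: order_swap; rewrite ?mutated_involution //.
  by apply: mutated_order_across; rewrite // eq_sym.
have same : edge_weight A i j = edge_weight B i j.
  have := skew_gt0 skA k i; have := skew_gt0 skA k j.
  have := skew_gt0 skA i k; have := skew_gt0 skA j k => h1 h2 h3 h4.
  by rewrite /edge_weight /B !mutate_matrix_same -?h1 -?h2 -?h3 -?h4 // andbC.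
(* A generator not adjacent to k commutes with s_k and counts both as conjugated and as unchanged;
   hence each remaining pair is of a single kind. *)
have tJ l : (A k l == 0)%R || (0 < A k l)%R -> t l = s l ^ s k.
  case/orP=> [kl|/mutated_in//]; have far : ~~ adjacent A k l by rewrite negbK.
  by rewrite mutated_far // commute_conj //; apply: far_commute.
have tid l : (A k l == 0)%R || (0 < A l k)%R -> t l = s l.
  case/orP=> [kl|/mutated_out//]; by rewrite mutated_far // negbK.
have hi := skew_gt0 skA i k; have hj := skew_gt0 skA j k.
rewrite same.
have [h|h] := boolP ((0 < A k i) || (0 < A k j))%R.
  rewrite !tJ; first by apply: orderJ; apply: cox.2.
  - by move: hi hj h ac1 ac2; lia.
  - by move: hi hj h ac1 ac2; lia.
rewrite !tid; first exact: cox.2.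
- by move: hi hj h ac1 ac2; lia.
- by move: hi hj h ac1 ac2; lia.
Qed.

End MutatedCoxeter.

Local Close Scope group_scope.
Local Open Scope ring_scope.

Lemma rot_rot_exists (T : Type) (c : seq T) a b : exists m, rot a (rot b c) = rot m c.
Proof.
have [bs|/ltnW/rot_oversize->] := leqP b (size c); last by exists a.
have [as_|/ltnW] := leqP a (size c); first by rewrite rot_add_mod //; eexists.
by rewrite -(size_rot b) => /rot_oversize ->; exists b.
Qed.

(** * Position of a vertex relative to a chordless cycle *)

Section CycleNeighbours.
Variables (n : nat) (A : 'M[int]_n) (k : 'I_n).
Hypothesis fA : two_finite A.
Let skA : skew_symmetrisable A := fA.1.
Let se : ssrbool.symmetric (adjacent A) := adjacentC skA.

Lemma attached_cycle_oriented x p1 y p2 : k \notin x :: p1 ++ y :: p2 ->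
  induced_cycle (adjacent A) (x :: p1 ++ y :: p2) ->
  cycle (arrows A) (x :: p1 ++ y :: p2) ->
  (p1 == [::]) || (p2 != [::]) ->
  adjacent A k x -> adjacent A k y -> {in p1, forall w, ~~ adjacent A k w} ->
  arrows A y k /\ arrows A k x.
Proof.
move=> kc ic co p12 kx ky kp.
have := induced_cycle_rot 1 se (induced_cycle_attach se kc ic p12 kx ky kp).
rewrite rot1_cons; case: p1 ic co {p12 kp kc} => [|h p1] _ co icr.
  have xy : 0 < A x y by case/andP: co.
  by case/and4P: (cycle_oriented fA icr xy).
have xh : 0 < A x h by case/andP: co.
have := cycle_oriented fA icr xh.
by rewrite /= !rcons_path !last_rcons => /andP[_ /andP[/andP[_ ?] ?]].
Qed.

(** Let x be a neighbour of k on the cycle. The arc from x to the next neighbour, closed through k,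
    would force k -> x by orientation, and the arc from the previous neighbour to x would force x ->
    k. So one of the arcs cannot be attached: it misses only the edge joining its ends, and these
    ends are the only neighbours of k. *)
Lemma cycle_neighbours c : induced_cycle (adjacent A) c -> cycle (arrows A) c ->
  k \notin c ->
  {in c &, forall i j, adjacent A k i -> adjacent A k j -> i = j} \/
  exists m b q a, [/\ rot m c = b :: rcons q a, arrows A b k, arrows A k a, arrows A a b
     & {in q, forall i, ~~ adjacent A k i}].
Proof.
move=> ic co kc.
have [hc|/hasPn hc] := boolP (has (adjacent A k) c); last first.
  by left=> i j ic' _ ki; rewrite (negbTE (hc i ic')) in ki.
have [x xc kx] := hasP hc; have [m p cE] := rot_to xc.
have ic1 := induced_cycle_rot m se ic; rewrite cE in ic1.
have co1 : cycle (arrows A) (x :: p) by rewrite -cE rot_cycle.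
have kc1 : k \notin x :: p by rewrite -cE mem_rot.
have [hp|/hasPn hp] := boolP (has (adjacent A k) p); last first.
  left=> i j; rewrite -[i \in c](mem_rot m) -[j \in c](mem_rot m) cE !inE.
  have nh l : adjacent A k l -> l \in p -> False by move=> kl /hp; rewrite kl.
  move=> /predU1P[->|ip] /predU1P[->|jp] // ki kj; try by case: (nh _ ki ip).
  by case: (nh _ kj jp).
right.
have [p1 [y [p2 [pE ky hp1]]]] : exists p1 y p2, [/\ p = p1 ++ y :: p2,
  adjacent A k y & {in p1, forall w, ~~ adjacent A k w}].
  case: (split_find hp) => y p1 p2 ky /hasPn hp1; exists p1, y, p2; split=> //.
  by rewrite cat_rcons.
have [p2' [z [p3 [pE' kz hp3]]]] : exists p2' z p3, [/\ p = p2' ++ z :: p3,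
  adjacent A k z & {in p3, forall w, ~~ adjacent A k w}].
  have hrp : has (adjacent A k) (rev p) by rewrite has_rev.
  move: (revK p); case: (split_find hrp) => z q1 q2 kz /hasPn hq1.
  rewrite rev_cat rev_rcons => pE'; exists (rev q2), z, (rev q1); split=> // w.
  by rewrite mem_rev; apply: hq1.
have tri a b : arrows A a b -> adjacent A k a -> adjacent A k b ->
  arrows A b k /\ arrows A k a.
  by move=> ab ka kb; apply: triangle_oriented => //; rewrite // -[_ != _]se.
have [b1|] := boolP ((p1 == [::]) || (p2 != [::])); last first.
  rewrite negb_or negbK => /andP[p10 /eqP p20].
  have yx : arrows A y x.
    by move: co1; rewrite pE p20 /= rcons_path cats1 last_rcons => /andP[].
  have [xk ky'] := tri y x yx ky kx.
  by exists m, x, p1, y; rewrite cE pE p20 cats1.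
rewrite pE in ic1 co1 kc1.
have [_ kx'] := attached_cycle_oriented kc1 ic1 co1 b1 kx ky hp1.
rewrite -pE pE' in ic1 co1 kc1.
have icr := induced_cycle_rot (size p2').+1 se ic1.
rewrite (rot_size_cat (x :: p2')) in icr.
have cor : cycle (arrows A) ((z :: p3) ++ x :: p2').
  by rewrite -(rot_size_cat (x :: p2')) rot_cycle.
have kcr : k \notin (z :: p3) ++ x :: p2'.
  by rewrite -(rot_size_cat (x :: p2')) mem_rot.
have [b2|] := boolP ((p3 == [::]) || (p2' != [::])).
  have [xk _] := attached_cycle_oriented kcr icr cor b2 kz kx hp3.
  by move: xk; rewrite /arrows (skew_gt0 skA) ltNge ltW.
rewrite negb_or negbK => /andP[p30 /eqP p20].
have xz : arrows A x z by move: co1; rewrite p20 => /andP[].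
have [zk kx2] := tri x z xz kx kz.
have [m' m'E] := rot_rot_exists c 1 m.
exists m', z, p3, x; split=> //.
by rewrite -m'E cE pE' p20 rot1_cons.
Qed.

Let B := mutate_matrix k A.
Let fB : two_finite B := two_finite_mutate k fA.
Let skB : skew_symmetrisable B := fB.1.

Lemma far_entry i j : i != k -> ~~ adjacent A k i ->
  [/\ B i j = A i j, B j i = A j i & edge_weight B i j = edge_weight A i j].
Proof.
move=> ik ki; have [ij ji] := mutate_nonneighbour j skA ik ki.
by rewrite /edge_weight /B ij ji.
Qed.

(** Mutation at k deletes the edge a -> b of the triangle and puts k into the cycle in its place. *)
Lemma insert_vertex b q a : k \notin b :: rcons q a ->
  induced_cycle (adjacent A) (b :: rcons q a) -> cycle (arrows A) (b :: rcons q a) ->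
  arrows A b k -> arrows A k a -> {in q, forall i, ~~ adjacent A k i} ->
  [/\ induced_cycle (adjacent B) (k :: b :: rcons q a),
      cycle (arrows B) (k :: b :: rcons q a), B b a = 0
    & (edge_weight A b k, edge_weight A k a, edge_weight A a b)
        \in [:: (1, 1, 1); (1, 2, 2); (2, 1, 2)]%N].
Proof.
move=> kc ic co bk ka far.
have q0 : q != [::] by case: ic => + _ _; case: (q).
have [h [q1 qE]] : exists h q1, q = h :: q1 by case: (q) q0 => // h q1; exists h, q1.
have ab : arrows A a b by move: co; rewrite /= rcons_path last_rcons => /andP[].
have bh : arrows A b h by move: co; rewrite qE => /andP[].
have neqk i : i \in b :: rcons q a -> i != k by apply: contraTneq => ->.
have farc i j : i \in b :: rcons q a -> j \in b :: rcons q a ->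
    (i, j) != (b, a) -> (i, j) != (a, b) -> i != j -> B i j = A i j.
  rewrite !inE !mem_rcons !inE => ic' jc' ijba ijab ij.
  have [iq|iq] := boolP (i \in q).
    by have [] := far_entry j (neqk i _) (far i iq);
      rewrite ?inE ?mem_rcons ?inE ?iq ?orbT.
  have [jq|jq] := boolP (j \in q).
    by have [] := far_entry i (neqk j _) (far j jq);
      rewrite ?inE ?mem_rcons ?inE ?jq ?orbT.
  move: ic' jc' ijba ijab ij; rewrite (negbTE iq) (negbTE jq) !orbF.
  by case/orP=> /eqP->; case/orP=> /eqP->; rewrite ?eqxx.
(* Weights 2, 2, 1 on the triangle would reverse the edge between a and b and leave the rest of the
   cycle unchanged, against cyclic orientation in [B]. *)
have BbaP : ~ 0 < B b a.
  move=> Bba.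
  have icB : induced_cycle (adjacent B) (b :: rcons q a).
    apply: induced_cycle_congr ic => i j ic' jc'; rewrite /adjacent.
    have [->|ij] := eqVneq i j; first by rewrite !skew_diag.
    have [[-> ->]|ba] := eqVneq (i, j) (b, a).
      by rewrite (gt_eqF Bba) (skew_eq0 skA) gt_eqF.
    have [[-> ->]|ab'] := eqVneq (i, j) (a, b).
      by rewrite (skew_eq0 skB) (gt_eqF Bba) gt_eqF.
    by rewrite farc.
  have [Bbh _ _] : [/\ B h b = A h b, B b h = A b h & edge_weight B h b = edge_weight A
    h b].
    by apply: far_entry; [apply: neqk | apply: far]; rewrite qE ?inE ?eqxx ?orbT.
  have Bbh' : 0 < B b h by rewrite (skew_gt0 skB) Bbh -(skew_gt0 skA).
  rewrite qE in icB.
  have := cycle_oriented fB icB Bbh'.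
  by rewrite /= rcons_path last_rcons => /and3P[_ _]; rewrite (skew_gt0 skB) ltNge ltW.
have [Bba pat] : B b a = 0 /\ (edge_weight A b k, edge_weight A k a, edge_weight A a b)
        \in [:: (1, 1, 1); (1, 2, 2); (2, 1, 2)]%N.
  by case: (triangle_weights fA bk ka ab) => -[-> -> -> //].
have icB : induced_cycle (adjacent B) (k :: b :: rcons q a).
  apply: (@induced_cycle_insert _ (adjacent A)) => //; first exact: adjacentC.
  - by rewrite /adjacent Bba eqxx.
  - move=> i j ic' jc' ba ab'; rewrite /adjacent.
    have [->|ij] := eqVneq i j; first by rewrite !skew_diag.
    by rewrite farc.
  - move=> w; rewrite /adjacent /B mutate_matrix_k ?eqxx // oppr_eq0.
    rewrite inE mem_rcons inE; case: eqVneq => [->|wb] /=.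
      by rewrite (skew_eq0 skA) gt_eqF.
    case: eqVneq => [->|wa] /=; first by rewrite gt_eqF.
    by move/far/negbTE.
split=> //; apply: (cycle_oriented fB icB).
by rewrite /B mutate_matrix_k ?eqxx // oppr_gt0 -(skew_gt0 skA).
Qed.

(** A closing edge of weight 2 occurs only in triangles and squares, so the relations split into the
    cycles with weights 1 and two small shapes. *)
Lemma cycle_patterns x q z : induced_cycle (adjacent A) (x :: rcons q z) ->
  cycle (arrows A) (x :: rcons q z) ->
  cycle (simply_laced A) (x :: rcons q z) \/ edge_weight A z x = 2%N ->
  [\/ cycle (simply_laced A) (x :: rcons q z),
      exists2 y, q = [:: y] & edge_weight A z x = 2%N /\
        (edge_weight A x y, edge_weight A y z) \in [:: (1, 2); (2, 1)]%N
    | exists y y', [/\ q = [:: y; y'], edge_weight A x y = 1%N,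
      edge_weight A y y' = 2%N,
        edge_weight A y' z = 1%N & edge_weight A z x = 2%N]].
Proof.
move=> ic co [sl|zx2]; first by constructor 1.
have zx : arrows A z x by move: co; rewrite /= rcons_path last_rcons => /andP[].
case: q => [|y [|y' [|w q]]] in ic co *; first by case: ic.
- constructor 2; exists y => //; split=> //.
  case/and4P: co => xy yz _ _.
  have := triangle_weights_pattern fA xy yz zx; rewrite zx2 /triangle_pattern !inE.
  by rewrite !xpair_eqE !andbF !andbT orbF.
- constructor 3; exists y, y'.
  case/and5P: co => xy yy' y'z _ _.
  have := square_weights fA ic xy yy' y'z zx; rewrite zx2 /square_pattern !inE
    !xpair_eqE.
  by rewrite !andbF !andbT /= orbF => /andP[/andP[/eqP-> /eqP->] /eqP->].
have := induced_cycle_rot (size [:: x, y, y', w & q]) se ic.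
rewrite -cats1 (rot_size_cat [:: x, y, y', w & q]) => icr.
by have := long_cycle_weight (leqnn _) fA icr isT zx; rewrite zx2.
Qed.

End CycleNeighbours.

Local Close Scope ring_scope.
Local Open Scope group_scope.

Lemma rot_back (T : Type) (c : seq T) m : exists m', rot m' (rot m c) = c.
Proof. by exists (size c - m)%N; rewrite -[RHS](rotK m) /rotr size_rot. Qed.

Lemma rot_rcons (T : Type) (x y : T) l : rot (size (x :: l)) (x :: rcons l y) = y :: x
  :: l.
Proof. by rewrite -rcons_cons -cats1 rot_size_cat. Qed.

Section RotatedRelations.
Variables (n : nat) (G : groupType) (A : 'M[int]_n) (t : 'I_n -> G).
Hypotheses (skA : skew_symmetrisable A) (cox : coxeter_relations A t).
Let tt i : t i * t i = 1 := cox.1 i.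

(** Gathers the relations over the three starting vertices, so that a triangle can be rotated to
    suit the place of k. *)
Definition triangle_relations x y z : Prop :=
  [/\ edge_weight A z x = 2%N -> commute (t x) (t z ^ t y),
      edge_weight A x y = 2%N -> commute (t y) (t x ^ t z)
    & edge_weight A y z = 2%N -> commute (t z) (t y ^ t x)].

Lemma triangle_relations_rot x y z :
  triangle_relations x y z -> triangle_relations y z x.
Proof. by case. Qed.

Lemma triangle_relation_turn x y z : edge_weight A x y = 1%N ->
  commute (t x) (t z ^ t y) <-> commute (t z) (t y ^ t x).
Proof.
move=> w1; rewrite -(coxeter_braid skA cox w1).
split=> [/(commute_conjl _ _ (tt y))/commute_sym //|/commute_sym c].
exact/(commute_conjl _ _ (tt y)).
Qed.

(** A triangle with an edge of weight 2 has exactly two such edges; their relations are equivalent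
    through the braid relation on the third edge. *)
Lemma triangle_relationsP x y z :
  triangle_pattern (edge_weight A x y) (edge_weight A y z) (edge_weight A z x) ->
  edge_weight A z x = 2%N -> commute (t x) (t z ^ t y) -> triangle_relations x y z.
Proof.
move=> pat zx c; move: pat; rewrite zx /triangle_pattern !inE !xpair_eqE !andbF !andbT
  orbF /=.
case/orP=> /andP[/eqP xy /eqP yz]; rewrite /triangle_relations xy yz zx; split=> // _.
  exact: (triangle_relation_turn z xy).1 c.
exact: (triangle_relation_turn x yz).2 c.
Qed.

Lemma square_relation_turn x y z w : edge_weight A x y = 1%N ->
  edge_weight A z w = 1%N ->
  commute (t z) ((t y ^ t x) ^ t w) -> commute (t x) ((t w ^ t z) ^ t y).
Proof.
move=> xy zw /(commute_conjl _ _ (tt w)) c.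
apply/(commute_conjl _ _ (tt y)).
by rewrite (coxeter_braid skA cox xy) -(coxeter_braid skA cox zw); apply/commute_sym.
Qed.

End RotatedRelations.

(** * Cycle relations for the mutated generators *)

Section MutatedCycles.
Variables (n : nat) (G : groupType) (A : 'M[int]_n) (k : 'I_n) (s : 'I_n -> G).
Let B := mutate_matrix k A.
Let t := mutated_generators A k s.
Hypotheses (fA : two_finite A) (cox : coxeter_relations B s).
Hypothesis cyc : cycle_relations B s.
Let fB : two_finite B := two_finite_mutate k fA.
Let skA : skew_symmetrisable A := fA.1.
Let skB : skew_symmetrisable B := fB.1.
Let ss i : s i * s i = 1 := cox.1 i.
Let coxA : coxeter_relations A t := mutated_coxeter_relations fA cox cyc.

(** With at most one neighbour of k on the cycle, [A] and [B] agree there. The generators on it are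
    all unchanged or all conjugated by s_k, since those not adjacent to k commute with s_k. *)
Lemma far_cycle_relation x q z : let c := x :: rcons q z in
  induced_cycle (adjacent A) c -> cycle (arrows A) c ->
  cycle (simply_laced A) c \/ edge_weight A z x = 2%N ->
  k \notin c ->
  {in c &, forall i j, adjacent A k i -> adjacent A k j -> i = j} ->
  commute (t x) (iter_conj t q (t z)).
Proof.
move=> c ic co wc kc nb.
have neqk i : i \in c -> i != k by apply: contraTneq => ->.
have same i j : i \in c -> j \in c -> B i j = A i j.
  move=> ic' jc'; have [ki|ki] := boolP (adjacent A k i); last first.
    by have [] := far_entry fA j (neqk i ic') ki.
  have [kj|kj] := boolP (adjacent A k j); last first.
    by have [] := far_entry fA i (neqk j jc') kj.
  by rewrite (nb i j) // !skew_diag.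
have samew i j : i \in c -> j \in c -> edge_weight B i j = edge_weight A i j.
  by move=> ic' jc'; rewrite /edge_weight !same.
have xc : x \in c by rewrite inE eqxx.
have zc : z \in c by rewrite inE mem_rcons inE eqxx orbT.
have qc i : i \in q -> i \in c by move=> iq; rewrite inE mem_rcons inE iq !orbT.
have Rs : commute (s x) (iter_conj s q (s z)).
  apply: cyc.
  - by apply: induced_cycle_congr ic => i j ic' jc'; rewrite /adjacent same.
  - rewrite (eq_in_cycle (P := mem c) (e' := arrows A)) //; last exact/allP.
    by move=> i j ic' jc'; rewrite /arrows same.
  - rewrite samew //; case: wc => [sl|]; [left | by right].
    rewrite (eq_in_cycle (P := mem c) (e' := simply_laced A)) //; last exact/allP.
    by move=> i j ic' jc'; rewrite /simply_laced samew.
have [/hasP[i0 i0c ki0]|/hasPn h] := boolP (has (fun i => 0 < A k i)%R c).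
  have tJ i : i \in c -> t i = s i ^ s k.
    move=> ic'; have [ki|ki] := boolP (adjacent A k i).
      by apply: mutated_in => //; rewrite (nb i i0) //; apply: lt0r_neq0.
    by rewrite /t mutated_far // commute_conj //; apply: (far_commute fA cox).
  rewrite tJ // tJ // (iter_conjJ (s := s)) => [|i /qc/tJ//].
  exact/commuteJ.
have tid i : i \in c -> t i = s i.
  move=> ic'; have [ki|ki] := boolP (adjacent A k i); last exact: mutated_far.
  apply: mutated_out; case/orP: (arrowVarrow skA ki) => //.
  by rewrite (negbTE (h i ic')).
by rewrite tid // tid // (iter_conj_eq (t := s)) // => i /qc/tid.
Qed.

Lemma arrow_square_far x y z w : induced_cycle (adjacent A) [:: x; y; z; w] ->
  [/\ ~~ adjacent A x z & z != x].
Proof.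
move=> [_ uc /(_ x 0%N 2%N isT)/= ->]; split=> //.
by move: uc; rewrite /= !inE !negb_or [z == x]eq_sym => /and4P[/and3P[_ xz _] _ _ _].
Qed.

(** Conjugating t_a by t_k returns s_a, so the relation amounts to s_a and s_b commuting, which
    holds once mutation deletes their edge. With weights 2, 2, 1 the triangle survives reversed in
    [B], and its own relation is transported. *)
Lemma mutated_triangle_in b a : arrows A b k -> arrows A k a -> arrows A a b ->
  triangle_relations A t b k a.
Proof.
move=> bk ka ab.
have pat := triangle_weights_pattern fA bk ka ab.
have tb : t b = s b by apply: mutated_out.
have ta : t a = s a ^ s k by apply: mutated_in.
have tk : t k = s k by apply: mutated_k.
have R0 : B b a = 0%R -> commute (t b) (t a ^ t k).
  move=> Bba; rewrite tb ta tk conj_involutionK //; apply: (coxeter_commute skB cox).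
  by rewrite /adjacent Bba eqxx.
case: (triangle_weights fA bk ka ab) => -[w1 w2 w3].
- by rewrite /triangle_relations w1 w2 w3.
- by move=> /R0; apply: triangle_relationsP.
- by move=> /R0; apply: triangle_relationsP.
move=> Bba wB; rewrite -/B in Bba wB.
have ak' : arrows B a k by rewrite /arrows mutated_arrow_k.
have kb' : arrows B k b by rewrite /arrows mutated_karrow.
apply: triangle_relations_rot; apply: triangle_relations_rot.
apply: triangle_relationsP => //.
  by rewrite w1 w2 w3.
rewrite tb ta tk conjg_conjg //.
apply/(commute_conjl _ _ (ss k)); rewrite commute_conj; last exact: commute_refl.
apply/(commute_conjl _ _ (ss a)).
have wak : edge_weight B a k = 2 by rewrite weight_k edge_weightC.
have <- : (s k ^ s a) ^ s k = s k ^ s a.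
  by apply/commute_conj/commute_sym/(coxeter_order4 skB cox); rewrite edge_weightC.
apply/commuteJ/commute_sym/(triangle_relation skB cyc Bba ak' kb').
by right; rewrite edge_weightC weight_k.
Qed.

(** In [B] the triangle becomes the square k, b, h, a. Its relation is taken at k or at b, whichever
    start has a closing edge of weight 2; if a -> b has weight 1, the square forces all weights 1
    and nothing is to be shown. *)
Lemma mutated_triangle_out b h a : k \notin [:: b; h; a] ->
  induced_cycle (adjacent A) [:: b; h; a] -> cycle (arrows A) [:: b; h; a] ->
  arrows A b k -> arrows A k a -> ~~ adjacent A k h ->
  triangle_relations A t b h a.
Proof.
move=> kc ic co bk ka kh.
have farq : {in [:: h], forall i, ~~ adjacent A k i} by move=> i; rewrite inE => /eqP->.
have [icB coB Bba pat] := @insert_vertex _ _ _ fA b [:: h] a kc ic co bk ka farq.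
case/and4P: co => bh ha ab _; case/and5P: coB => kb' bh' ha' ak' _.
have := square_weights fB icB kb' bh' ha' ak'.
have hk : h != k by apply: contraNneq kc => <-; rewrite !inE eqxx orbT.
have [_ _ whb] := far_entry fA b hk kh; have [_ _ wha] := far_entry fA a hk kh.
rewrite (edge_weightC B k b) weight_k weight_k (edge_weightC _ a k).
rewrite (edge_weightC _ b h) whb wha (edge_weightC A h b).
have patA := triangle_weights_pattern fA bh ha ab.
have tb : t b = s b by apply: mutated_out.
have ta : t a = s a ^ s k by apply: mutated_in.
have th : t h = s h by apply: mutated_far.
have hkc : commute (s h) (s k) by apply: (far_commute fA cox).
have wkb : edge_weight B k b = edge_weight A b k by rewrite edge_weightC weight_k.
have wak : edge_weight B a k = edge_weight A k a by rewrite weight_k edge_weightC.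
have hkJ : s h ^ s k = s h by apply: commute_conj.
move: pat; rewrite /square_pattern !inE !xpair_eqE.
case/or3P => /andP[/andP[/eqP w1 /eqP w2] /eqP w3];
  rewrite w1 w2 !andbT ?andbF ?orbF /= => sq.
- case/andP: sq => /eqP w4 /eqP w5; by rewrite /triangle_relations w3 w4 w5.
- apply: triangle_relationsP => //; rewrite tb ta th.
  have := cyc (x := k) (q := [:: b; h]) (z := a) icB; rewrite /= => R.
  have {}R : commute (s k) ((s a ^ s h) ^ s b).
    by apply: R; [apply/and5P | right; rewrite wak].
  rewrite -hkJ -conjJg; apply/(commute_conjl _ _ (ss k)).
  rewrite -(coxeter_braid skB cox); last by rewrite wkb.
  exact/(commute_conjl _ _ (ss b)).
- apply: triangle_relationsP => //; rewrite tb ta th.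
  have icr := induced_cycle_rot 1 (adjacentC skB) icB.
  have := cyc (x := b) (q := [:: h; a]) (z := k) icr; rewrite /= => R.
  rewrite (coxeter_braid skB cox) ?wak //.
  by apply: R; [apply/and5P | right; rewrite wkb].
Qed.

Lemma rot_triangle (x y z : 'I_n) m : let c := [:: x; y; z] in
  [\/ rot m c = c, rot m c = [:: y; z; x] | rot m c = [:: z; x; y]].
Proof.
by case: m => [|[|[|m]]]; [constructor 1 | constructor 2 | constructor 3 | constructor
  1].
Qed.

Lemma mutated_triangle_relation x y z : induced_cycle (adjacent A) [:: x; y; z] ->
  cycle (arrows A) [:: x; y; z] -> edge_weight A z x = 2%N ->
  commute (t x) (t z ^ t y).
Proof.
move=> ic co zx2.
have [xy yz zx _] := and4P co.
have [kc|kc] := boolP (k \in [:: x; y; z]).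
  suff [] : triangle_relations A t x y z by move/(_ zx2).
  move: kc; rewrite !inE => /or3P[] /eqP kE; move: xy yz zx; rewrite -kE => xy yz zx.
  - exact/triangle_relations_rot/mutated_triangle_in.
  - exact/mutated_triangle_in.
  - exact/triangle_relations_rot/triangle_relations_rot/mutated_triangle_in.
have [nb|[m [b [q [a [E bk ka ab far]]]]]] := cycle_neighbours fA ic co kc.
  exact: (@far_cycle_relation x [:: y] z ic co (or_intror zx2) kc nb).
have [h qE] : exists h, q = [:: h].
  have : size (rot m [:: x; y; z]) = 3%N by rewrite size_rot.
  by rewrite E /= size_rcons; case: (q) => [|h [|]] // _; exists h.
rewrite qE /= in E far.
have ic1 := induced_cycle_rot m (adjacentC skA) ic.
have co1 : cycle (arrows A) (rot m [:: x; y; z]) by rewrite rot_cycle.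
have kc1 : k \notin rot m [:: x; y; z] by rewrite mem_rot.
rewrite E in ic1 co1 kc1.
have TR : triangle_relations A t b h a.
  by apply: mutated_triangle_out => //; apply: far; rewrite inE.
suff [] : triangle_relations A t x y z by move/(_ zx2).
case: (rot_triangle x y z m); rewrite E => -[<- <- <-] //.
  exact/triangle_relations_rot/triangle_relations_rot.
exact/triangle_relations_rot.
Qed.

Section SquareThrough.
Variables a p b : 'I_n.
Hypotheses (ic : induced_cycle (adjacent A) [:: k; a; p; b])
  (co : cycle (arrows A) [:: k; a; p; b]).

(** Mutation at k turns the square into the triangle a, p, b. When the weights at k are 1 and 2 its
    new edge has weight 2, so the relation of that triangle starting at a is available. *)
Lemma square_shortcut : [/\ arrows B a p, arrows B p b, arrows B b a,
  edge_weight B b a = (edge_weight A b k * edge_weight A k a)%N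
  & commute (s p) (s k)].
Proof.
have [ka ap pb bk _] := and5P co.
have [kp pk] := arrow_square_far ic.
have [_ Bba wB _] := @contract_cycle _ A k a [:: p] b fA isT ic bk ka.
have [pa_ ap_ _] := far_entry fA a pk kp; have [pb_ _ _] := far_entry fA b pk kp.
split=> //; rewrite /arrows ?ap_ ?pb_ //.
exact: (far_commute fA cox).
Qed.

Lemma mutated_square_first : edge_weight A k a = 1%N -> edge_weight A b k = 2%N ->
  commute (t k) ((t b ^ t p) ^ t a).
Proof.
move=> w1 w2; have [ap pb ba wB pk] := square_shortcut.
have [ka _ _ bk _] := and5P co; have [kp _] := arrow_square_far ic.
have -> : t k = s k by apply: mutated_k.
have -> : t b = s b by apply: mutated_out.
have -> : t p = s p by apply: mutated_far.
have -> : t a = s a ^ s k by apply: mutated_in.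
rewrite conjg_conjg //.
apply/(commute_conjl _ _ (ss k)); rewrite commute_conj; last exact: commute_refl.
apply/(commute_conjl _ _ (ss a)).
rewrite (coxeter_braid skB cox); last by rewrite edge_weightC weight_k edge_weightC.
apply/commuteJ/(triangle_relation skB cyc ap pb ba).
by right; rewrite wB w1 w2.
Qed.

Lemma mutated_square_last : edge_weight A k a = 2%N -> edge_weight A b k = 1%N ->
  commute (t a) ((t k ^ t b) ^ t p).
Proof.
move=> w1 w2; have [ap pb ba wB pk] := square_shortcut.
have [ka _ _ bk _] := and5P co; have [kp _] := arrow_square_far ic.
have -> : t k = s k by apply: mutated_k.
have -> : t b = s b by apply: mutated_out.
have -> : t p = s p by apply: mutated_far.
have -> : t a = s a ^ s k by apply: mutated_in.
rewrite [s k ^ s b](coxeter_braid skB cox); last by rewrite edge_weightC weight_k.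
rewrite -[s p](commute_conj pk) -conjJg.
apply/commuteJ/(triangle_relation skB cyc ap pb ba).
by right; rewrite wB w1 w2.
Qed.

End SquareThrough.

Lemma mutated_square_relation x y z w : induced_cycle (adjacent A) [:: x; y; z; w] ->
  cycle (arrows A) [:: x; y; z; w] ->
  edge_weight A x y = 1%N -> edge_weight A y z = 2%N ->
  edge_weight A z w = 1%N -> edge_weight A w x = 2%N ->
  commute (t x) ((t w ^ t z) ^ t y).
Proof.
move=> ic co xy yz zw wx.
have rot_ic m := induced_cycle_rot m (adjacentC skA) ic.
have rot_co m : cycle (arrows A) (rot m [:: x; y; z; w]) by rewrite rot_cycle.
have [kc|kc] := boolP (k \in [:: x; y; z; w]).
  move: kc; rewrite !inE => /or4P[] /eqP kE.
  - by rewrite -kE; apply: mutated_square_first; rewrite kE.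
  - apply: (square_relation_turn skA coxA) => //; rewrite -kE.
    by apply: mutated_square_last; rewrite kE //; [apply: (rot_ic 1%N)| apply: (rot_co
      1%N)].
  - apply: (square_relation_turn skA coxA) => //; rewrite -kE.
    by apply: mutated_square_first; rewrite kE //; [apply: (rot_ic 2%N)| apply: (rot_co
      2%N)].
  - rewrite -kE.
    by apply: mutated_square_last; rewrite kE //; [apply: (rot_ic 3%N)| apply: (rot_co
      3%N)].
have [nb|[m [b [q [a [E bk ka ab far]]]]]] := cycle_neighbours fA ic co kc.
  exact: (@far_cycle_relation x [:: y; z] w ic co (or_intror wx) kc nb).
have [h [h' qE]] : exists h h', q = [:: h; h'].
  have : size (rot m [:: x; y; z; w]) = 4%N by rewrite size_rot.
  by rewrite E /= size_rcons; case: (q) => [|h [|h' []]] // _; exists h, h'.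
rewrite qE /= in E far.
have := rot_ic m; have := rot_co m.
have : k \notin rot m [:: x; y; z; w] by rewrite mem_rot.
rewrite E => kc1 co1 ic1.
(* Inserting k gives a pentagon in [B]; this forces weight 1 on two consecutive edges of the square,
   hence on all four, against the weight 2 of the closing edge. *)
have [icB coB _ _] := @insert_vertex _ _ _ fA b [:: h; h'] a kc1 ic1 co1 bk ka far.
have [bh hh ha _ _] := and5P co1.
have hk : h != k by apply: contraNneq kc1 => <-; rewrite !inE eqxx ?orbT.
have kh : ~~ adjacent A k h by apply: far; rewrite inE eqxx.
have [Bbh _ whb] := far_entry fA b hk kh; have [Bhb Bhh whh] := far_entry fA h' hk kh.
have bh1 : edge_weight A b h = 1%N.
  rewrite edge_weightC -whb edge_weightC.
  apply: (long_cycle_weight (leqnn _) fB (induced_cycle_rot 1 (adjacentC skB) icB)) =>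
    //.
  by case/and3P: coB.
have hh1 : edge_weight A h h' = 1%N.
  rewrite -whh.
  apply: (long_cycle_weight (leqnn _) fB (induced_cycle_rot 2 (adjacentC skB) icB)) =>
    //.
  by case/and4P: coB.
have := square_weights fA ic1 bh hh ha ab; rewrite bh1 hh1 /square_pattern !inE
  !xpair_eqE /=.
rewrite ?andbF ?orbF => /andP[/eqP ha1 /eqP ab1].
have : cycle (simply_laced A) [:: x; y; z; w].
  by rewrite -(rot_cycle m) E /= /simply_laced bh1 hh1 ha1 ab1.
by rewrite /= /simply_laced wx; case/and5P.
Qed.

(** The start is the predecessor b of k. There conjugation by t_a and then by t_k reduces to s_k
    followed by s_a, and this s_k has no effect on an element built from generators far from k. What
    remains is the relation of the contracted cycle. *)
Lemma mutated_laced_through b q a : induced_cycle (adjacent A) (k :: a :: rcons q b) ->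
  cycle (arrows A) (k :: a :: rcons q b) ->
  cycle (simply_laced A) (k :: a :: rcons q b) ->
  exists m q' z', rot m (k :: a :: rcons q b) = b :: rcons q' z' /\
    commute (t b) (iter_conj t q' (t z')).
Proof.
move=> ic co sl; exists (size (k :: a :: q)).
rewrite -rcons_cons rot_rcons.
have ka : arrows A k a by case/andP: co.
have bk : arrows A b k by move: co; rewrite /= rcons_path last_rcons => /and3P[].
have ka1 : edge_weight A k a = 1%N by case/andP: sl => /eqP.
have bk1 : edge_weight A b k = 1%N.
  by move: sl; rewrite /= rcons_path last_rcons => /and3P[_ _ /eqP].
have tk : t k = s k by apply: mutated_k.
have tb : t b = s b by apply: mutated_out.
have ta : t a = s a ^ s k by apply: mutated_in.
case/lastP: q => [|q z] in ic co sl *.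
  have ab : arrows A a b by case/and3P: co.
  exists [:: k], a; split=> //=; rewrite tk tb ta conj_involutionK //.
  apply: (coxeter_commute skB cox).
  case: (triangle_weights fA bk ka ab) => -[w1 w2 w3]; last by rewrite bk1 in w1.
  1-3: by rewrite /B /adjacent => ->; rewrite eqxx.
exists (k :: a :: q), z; split=> //.
have q0 : rcons q z != [::] by case: (q).
have [icB Bba wB _] := contract_cycle fA q0 ic bk ka.
rewrite -/B in icB Bba wB.
have nbk := induced_cycle_neighbours (adjacentC skA) ic.
have uc : uniq (k :: a :: rcons (rcons q z) b) by case: ic.
have far i : i \in rcons q z -> i != k /\ ~~ adjacent A k i.
  move=> iq; have ic' : i \in a :: rcons (rcons q z) b by rewrite !(inE,
    mem_rcons) in iq *; rewrite iq !orbT.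
  split; first by apply: contraTneq ic' => ->; case/andP: uc.
  rewrite nbk //; move: uc; rewrite /= mem_rcons inE negb_or rcons_uniq.
  case/and4P=> _ /andP[_ aq] bq _.
  by rewrite negb_or; apply/andP; split; [apply: contraNneq aq | apply: contraNneq bq]
    => <-.
have tq i : i \in rcons q z -> t i = s i by case/far=> _ ki; apply: mutated_far.
have icr := induced_cycle_rot (size (a :: rcons q z)) (adjacentC skB) icB.
rewrite rot_rcons in icr.
have R : commute (s b) (iter_conj s (a :: q) (s z)).
  apply: cyc => //; first exact: (cycle_oriented fB icr Bba).
  left; rewrite /= rcons_path last_rcons /simply_laced wB ka1 bk1 /=.
  have sub l u : {subset l <= rcons q z} -> path (simply_laced A) u l ->
    path (simply_laced B) u l.
    elim: l u => //= v l IHl u lq /andP[uv vl]; apply/andP; split; last first.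
      by apply: IHl => // w wl; apply: lq; rewrite inE wl orbT.
    have [vk kv] := far v (lq v (mem_head _ _)); have [_ _ wv] := far_entry fA u vk kv.
    by rewrite /simply_laced edge_weightC wv edge_weightC.
  move: sl; rewrite /= !rcons_path !last_rcons => /and3P[_ /andP[sl1 zb1] _].
  move: sl1; rewrite -rcons_path -/(path _ _ _) => sl1.
  apply/andP; split; first by rewrite -rcons_path; apply: sub.
  have [zk kz] : z != k /\ ~~ adjacent A k z by apply: far; rewrite mem_rcons inE eqxx.
  by have [_ _ ->] := far_entry fA b zk kz.
rewrite tb; move: R; rewrite /= tk ta.
rewrite -(iter_conj_eq (s := s) (t := t)) => [|i iq];
  last by rewrite tq // mem_rcons inE iq orbT.
rewrite tq ?mem_rcons ?inE ?eqxx //.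
rewrite conjg_conjg // conj_involutionK //.
set Y := iter_conj _ _ _ => R.
suff -> : Y ^ s k = Y by [].
rewrite -iter_conj_commute => [|i iq].
  by rewrite commute_conj //; apply: (far_commute fA cox); apply: (far z _).2;
    rewrite mem_rcons inE eqxx.
by apply: (far_commute fA cox); apply: (far i _).2; rewrite mem_rcons inE iq orbT.
Qed.

(** In [B] the cycle passes through k. Its relation starting at b has s_k conjugated by s_a
    innermost, and the braid relation turns this into t_a. *)
Lemma mutated_laced_around b q a : k \notin b :: rcons q a ->
  induced_cycle (adjacent A) (b :: rcons q a) -> cycle (arrows A) (b :: rcons q a) ->
  cycle (simply_laced A) (b :: rcons q a) ->
  arrows A b k -> arrows A k a -> {in q, forall i, ~~ adjacent A k i} ->
  commute (t b) (iter_conj t q (t a)).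
Proof.
move=> kc ic co sl bk ka far.
have [icB coB Bba pat] := insert_vertex fA kc ic co bk ka far.
have q0 : q != [::] by case: ic => + _ _; case: (q).
have ab1 : edge_weight A a b = 1%N.
  by move: sl; rewrite /= rcons_path last_rcons => /andP[_ /eqP].
have [bk1 ka1] : edge_weight A b k = 1%N /\ edge_weight A k a = 1%N.
  by move: pat; rewrite ab1 !inE !xpair_eqE !andbF !orbF => /andP[/andP[/eqP-> /eqP->]].
have tb : t b = s b by apply: mutated_out.
have ta : t a = s a ^ s k by apply: mutated_in.
have tq i : i \in q -> t i = s i by move=> iq; apply: mutated_far => //; apply: far.
have icr := induced_cycle_rot 1 (adjacentC skB) icB.
have cor : cycle (arrows B) (rot 1 (k :: b :: rcons q a)) by rewrite rot_cycle.
rewrite rot1_cons rcons_cons in icr cor.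
have sub l u : u \in b :: q -> {subset l <= q} -> path (simply_laced A) u l ->
    path (simply_laced B) u l.
  elim: l u => //= v l IHl u uq lq /andP[uv vl].
  have vq : v \in q by apply/lq/mem_head.
  have vk : v != k by apply: contraNneq kc => <-; rewrite inE mem_rcons inE vq !orbT.
  have [_ _ wv] := far_entry fA u vk (far v vq).
  apply/andP; split; first by rewrite /simply_laced edge_weightC wv edge_weightC.
  apply: IHl => //; first by rewrite inE vq orbT.
  by move=> w wl; apply: lq; rewrite inE wl orbT.
have R : commute (s b) (iter_conj s (rcons q a) (s k)).
  apply: cyc => //; left.
  rewrite /= !rcons_path !last_rcons.
  move: sl; rewrite /= !rcons_path last_rcons => /andP[/andP[sl1 sl2] _].
  rewrite sub ?mem_head //=; rewrite -andbA; apply/and3P; split.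
  - have lq : last b q \in q by case: (q) q0 => // h l _; rewrite /= mem_last.
    have lk : last b q != k by apply: contraNneq kc => <-;
      rewrite inE mem_rcons inE lq !orbT.
    by have [_ _ wl] := far_entry fA a lk (far _ lq); rewrite /simply_laced wl.
  - by rewrite /simply_laced weight_k edge_weightC ka1.
  - by rewrite /simply_laced edge_weightC weight_k bk1.
move: R; rewrite iter_conj_rcons tb ta -(iter_conj_eq (s := s) (t := t)) => [|i iq];
  last by rewrite tq.
by rewrite -(coxeter_braid skB cox) // weight_k edge_weightC.
Qed.

Lemma mutated_cycle_relations : cycle_relations A t.
Proof.
move=> x q z c ic co w.
have [sl|[y qE [zx2 pat]]|[y [y' [qE xy yy' y'z zx]]]] := cycle_patterns fA ic co w;
  last first.
- by rewrite /c qE in ic co *; apply: mutated_square_relation.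
- by rewrite /c qE in ic co *; apply: mutated_triangle_relation.
have from_rot m x' q' z' : rot m c = x' :: rcons q' z' ->
    commute (t x') (iter_conj t q' (t z')) -> commute (t x) (iter_conj t q (t z)).
  move=> E R; have [m' m'E] := rot_back c m.
  apply: (cycle_relation_rotations skA coxA E _ _ R m'E).
    exact: (induced_cycle_rot _ (adjacentC skA)).
  by rewrite rot_cycle.
have [kc|kc] := boolP (k \in c).
  have [m l lE] := rot_to kc.
  have ic1 := induced_cycle_rot m (adjacentC skA) ic.
  have co1 : cycle (arrows A) (rot m c) by rewrite rot_cycle.
  have sl1 : cycle (simply_laced A) (rot m c) by rewrite rot_cycle.
  rewrite lE in ic1 co1 sl1.
  case: l => [|a l] in lE ic1 co1 sl1 *; first by case: ic1.
  case/lastP: l => [|l b] in lE ic1 co1 sl1 *; first by case: ic1.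
  have [m1 [q' [z' [E R]]]] := mutated_laced_through ic1 co1 sl1.
  have [m2 m2E] := rot_rot_exists c m1 m.
  by apply: (from_rot m2) R; rewrite -m2E lE.
have [nb|[m [b [q' [a [E bk ka ab far]]]]]] := cycle_neighbours fA ic co kc.
  exact: far_cycle_relation.
apply: (from_rot _ _ _ _ E); apply: mutated_laced_around => //; rewrite -E.
- by rewrite mem_rot.
- exact: (induced_cycle_rot _ (adjacentC skA)).
- by rewrite rot_cycle.
- by rewrite rot_cycle.
Qed.

End MutatedCycles.

(** * Faithfulness of the geometric representation *)

Section Length.
Variables (I : eqType) (G : groupType) (s : I -> G).
Hypothesis ss : forall i, s i * s i = 1.
Hypothesis gen : forall g, exists w : seq I, g = \prod_(i <- w) s i.

Let wordb g m : bool := `[< exists2 w : seq I, size w = m & g = \prod_(i <- w) s i >].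

Lemma word_exists g : exists m, wordb g m.
Proof. by have [w wE] := gen g; exists (size w); apply/asboolP; exists w. Qed.

Definition word_length g : nat := ex_minn (word_exists g).

Local Notation len := word_length.

Lemma word_length_word g : exists2 w : seq I, size w = len g & g = \prod_(i <- w) s i.
Proof. by rewrite /word_length; case: ex_minnP => m /asboolP. Qed.

Lemma word_length_le w : (len (\prod_(i <- w) s i) <= size w)%N.
Proof.
by rewrite /word_length; case: ex_minnP => m _; apply; apply/asboolP; exists w.
Qed.

Lemma word_length_mul g h : (len (g * h) <= len g + len h)%N.
Proof.
have [w <- {1}->] := word_length_word g; have [w' <- {1}->] := word_length_word h.
by rewrite -big_cat -size_cat; apply: word_length_le.
Qed.

Lemma word_length_gen i : (len (s i) <= 1)%N.
Proof. by have := word_length_le [:: i]; rewrite big_seq1. Qed.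

Lemma word_length1 : len 1 = 0%N.
Proof. by have := word_length_le [::]; rewrite big_nil leqn0 => /eqP. Qed.

Lemma mulg_generatorK g i : g * s i * s i = g.
Proof. by rewrite -mulgA ss mulg1. Qed.

Lemma exists_descent g : g != 1 -> exists i, (len (g * s i) < len g)%N.
Proof.
have [w <- ->] := word_length_word g; case/lastP: w => [|w i];
  first by rewrite big_nil eqxx.
by exists i; rewrite -cats1 big_cat big_seq1 mulg_generatorK size_cat addn1 ltnS
  word_length_le.
Qed.

Section Alternating.
Variables i j : I.

Definition alt_letter l : I := if odd l then i else j.

Fixpoint alternating l : G :=
  if l is l'.+1 then s (alt_letter l') * alternating l' else 1.

Lemma word_length_alternating l : (len (alternating l) <= l)%N.
Proof.
elim: l => [|l IHl] /=; first by rewrite word_length1.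
by apply: leq_trans (word_length_mul _ _) _; rewrite -add1n leq_add // word_length_gen.
Qed.

(** Choose l maximal. If the next letter of the alternating word shortened v, a longer suffix could
    be split off; if the other letter did, the length of g would drop below len v + l. *)
Lemma maximal_alternating g : (len (g * s j) < len g)%N ->
  exists v l, [/\ g = v * alternating l, len g = (len v + l)%N, (0 < l)%N,
    (len v <= len (v * s i))%N & (len v <= len (v * s j))%N].
Proof.
move=> gj; pose P l := `[< exists2 v, g = v * alternating l & len g = (len v + l)%N >].
have P1 : P 1%N.
  apply/asboolP; exists (g * s j); first by rewrite /= /alt_letter /= mulg1
    mulg_generatorK.
  apply/eqP; rewrite addn1 eqn_leq gj andbT.
  rewrite -{1}(mulg_generatorK g j); apply: leq_trans (word_length_mul _ _) _.
  by rewrite -addn1 leq_add2l word_length_gen.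
have Pb l : P l -> (l <= len g)%N by case/asboolP => v _ ->; apply: leq_addl.
have := ex_maxnP (ex_intro P _ P1) Pb.
case=> l /asboolP[v gE lE] lmax; exists v, l.
have l0 : (0 < l)%N := lmax _ P1.
have next : (len v <= len (v * s (alt_letter l)))%N.
  rewrite leqNgt; apply/negP=> lt.
  suff /lmax : P l.+1 by rewrite ltnn.
  apply/asboolP; exists (v * s (alt_letter l)); first by rewrite /= mulgA
    mulg_generatorK.
  have : (len g <= len (v * s (alt_letter l)) + l.+1)%N.
    rewrite gE -{1}(mulg_generatorK v (alt_letter l)) -mulgA -[s _ * _]/(alternating
      l.+1).
    by apply: leq_trans (word_length_mul _ _) _; rewrite leq_add2l
      word_length_alternating.
  by lia.
have prev : (len v <= len (v * s (alt_letter l.-1)))%N.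
  rewrite leqNgt; apply/negP=> lt.
  move: gE lE l0 {next lmax}; case: l lt => // l /= lt gE lE _.
  have : (len g <= len (v * s (alt_letter l)) + l)%N.
    by rewrite gE mulgA; apply: leq_trans (word_length_mul _ _) _;
      rewrite leq_add2l word_length_alternating.
  by rewrite lE; lia.
by split=> //; move: next prev; case: l l0 {gE lE lmax} => // l _;
  rewrite /alt_letter /=;
  case: (odd l).
Qed.

Lemma alternatingS2 l : alternating l.+2 = if odd l then s j * s i * alternating l
  else s i * s j * alternating l.
Proof. by rewrite /= mulgA /alt_letter /=; case: (odd l). Qed.

Lemma alternating_double h : alternating h.*2 = (s i * s j) ^+ h.
Proof.
by elim: h => // h IHh; rewrite doubleS alternatingS2 odd_double IHh expgS.
Qed.

Lemma alternatingD l m : exists2 c, alternating (l + m) = c * alternating m & (len c <=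
  l)%N.
Proof.
elim: l => [|l [c cE lc]]; first by exists 1; rewrite ?mul1g ?word_length1.
exists (s (alt_letter (l + m)) * c); first by rewrite addSn /= cE mulgA.
by apply: leq_trans (word_length_mul _ _) _; rewrite -add1n leq_add // word_length_gen.
Qed.

(** An alternating word as long as the exponent m of the relation equals the one with the two
    letters exchanged. It can thus be read as ending in s_i, which then cancels. *)
Lemma alternating_even_exchange h : (0 < h)%N -> (s i * s j) ^+ h.*2 = 1 ->
  (len (alternating h.*2 * s i) < h.*2)%N.
Proof.
case: h => // h _ e.
have -> : alternating h.+1.*2 * s i = (s j * s i) ^+ h * s j.
  rewrite alternating_double.
  have -> : (s i * s j) ^+ h.+1 = (s j * s i) ^+ h.+1.
    rewrite -[RHS]invgK -expVgn invgM (involutionV (ss i)) (involutionV (ss j)).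
    apply: (@mulIg _ ((s i * s j) ^+ h.+1)); rewrite mulVg -expgnDr addnn //.
  by rewrite expgSr mulgA mulg_generatorK.
have lh : (len ((s j * s i) ^+ h) <= h.*2)%N.
  elim: (h) => [|h' IH]; first by rewrite word_length1.
  rewrite expgS doubleS; apply: leq_trans (word_length_mul _ _) _;
    rewrite -[_.+2]add2n leq_add //.
  by apply: leq_trans (word_length_mul _ _) _; rewrite -addn1 leq_add //
    word_length_gen.
rewrite doubleS ltnS; apply: leq_trans (word_length_mul _ _) _.
by rewrite -[_.+1]addn1 leq_add // word_length_gen.
Qed.

Lemma alternating_odd_exchange : (s i * s j) ^+ 3 = 1 ->
  (len (alternating 3 * s i) < 3)%N.
Proof.
move=> e; have := involution_braid (ss i) (ss j) e.
rewrite !conjgE (involutionV (ss i)) (involutionV (ss j)) /= /alt_letter /= mulg1 mulgA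
  => ->.
rewrite mulgA mulg_generatorK ltnS; apply: leq_trans (word_length_mul _ _) _.
by rewrite -addn1 leq_add // word_length_gen.
Qed.

Lemma alternating_exchange w : (w <= 3)%N -> (s i * s j) ^+ bond_order w = 1 ->
  (len (alternating (bond_order w) * s i) < bond_order w)%N.
Proof.
case: w => [|[|[|[|]]]] //= _.
- exact: (alternating_even_exchange (h := 1)).
- exact: alternating_odd_exchange.
- exact: (alternating_even_exchange (h := 2)).
- exact: (alternating_even_exchange (h := 3)).
Qed.

(** Otherwise a suffix of length m could be shortened by s_i, and so could g. *)
Lemma alternating_bound g v l w : (w <= 3)%N -> (s i * s j) ^+ bond_order w = 1 ->
  g = v * alternating l -> len g = (len v + l)%N -> (len g <= len (g * s i))%N ->
  (l < bond_order w)%N.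
Proof.
move=> w3 e gE lE gi; rewrite ltnNge; apply/negP=> ml.
have := alternating_exchange w3 e; set M := bond_order w in ml * => exM.
have [c cE lc] := alternatingD (l - M) M; rewrite subnK // in cE.
move: gi; rewrite leqNgt => /negP; apply; rewrite lE gE cE.
have -> : v * (c * alternating M) * s i = (v * c) * (alternating M * s i).
  by rewrite !mulgA.
apply: leq_ltn_trans (word_length_mul _ _) _.
apply: leq_ltn_trans (leq_add (word_length_mul v c) (leqnn _)) _.
rewrite -addnA ltn_add2l; apply: leq_ltn_trans (leq_add lc (leqnn _)) _.
by rewrite -[X in (_ < X)%N](subnK ml) ltn_add2l.
Qed.

End Alternating.
End Length.

Local Close Scope group_scope.
Local Open Scope ring_scope.

(** * Positivity of roots and faithfulness *)

Definition finite_cartan (r : nat) (C : 'M[int]_r) : Prop :=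
  [/\ forall i, C i i = 2, forall i j, i != j -> C i j <= 0
    & forall i j, i != j -> (edge_weight C i j <= 3)%N].

Section Tits.
Variables (r : nat) (C : 'M[int]_r).
Hypothesis fC : finite_cartan C.

Definition simple_root i : 'cV[rat]_r := delta_mx i 0.
Local Notation alpha := simple_root.

Lemma simple_reflection_root i j :
  simple_reflection C i *m alpha j = alpha j - (C i j)%:~R *: alpha i.
Proof.
rewrite /simple_reflection mulmxBl mul1mx; congr (_ - _).
apply/matrixP=> a b; rewrite -mulmxA mxE (bigD1 i) //= big1 => [|c ci]; last first.
  by rewrite mxE (negbTE ci) andbF mul0r.
rewrite addr0 !mxE (bigD1 j) //= big1 => [|c cj]; last first.
  by rewrite !mxE (negbTE cj) mulr0.
by rewrite !mxE !eqxx andbT addr0 ord1 !andbT mulr1 mulrC.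
Qed.

Variables (G : groupType) (s : 'I_r -> G).
Hypothesis ss : forall i, (s i * s i)%g = 1%g.
Hypothesis gen : forall g, exists w : seq 'I_r, g = (\prod_(i <- w) s i)%g.
Hypothesis cox : forall i j, i != j ->
  ((s i * s j) ^+ bond_order (edge_weight C i j) = 1)%g.
Variable rho : G -> 'M[rat]_r.
Hypothesis rho1 : rho 1%g = 1%:M.
Hypothesis rhoM : forall g h, rho (g * h)%g = rho g *m rho h.
Hypothesis rho_s : forall i, rho (s i) = simple_reflection C i.

Local Notation len := (word_length gen).

Definition nonneg (v : 'cV[rat]_r) : Prop := forall l, 0 <= v l 0.

Lemma nonnegD u v : nonneg u -> nonneg v -> nonneg (u + v).
Proof. by move=> u0 v0 l; rewrite mxE addr_ge0. Qed.

Lemma nonnegZ a v : 0 <= a -> nonneg v -> nonneg (a *: v).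
Proof. by move=> a0 v0 l; rewrite mxE mulr_ge0. Qed.

Section RankTwo.
Variables i j : 'I_r.
Hypothesis ij : i != j.
Let p : rat := - (C i j)%:~R.
Let q : rat := - (C j i)%:~R.

Let comb (x y : rat) := x *: alpha i + y *: alpha j.

Lemma rho_comb_i x y : rho (s i) *m comb x y = comb (p * y - x) y.
Proof.
have [Cii _ _] := fC.
rewrite rho_s mulmxDr -!scalemxAr !simple_reflection_root Cii /comb /p.
by apply/matrixP=> a b; rewrite !mxE; ring.
Qed.

Lemma rho_comb_j x y : rho (s j) *m comb x y = comb x (q * x - y).
Proof.
have [Cii _ _] := fC.
rewrite rho_s mulmxDr -!scalemxAr !simple_reflection_root Cii /comb /q.
by apply/matrixP=> a b; rewrite !mxE; ring.
Qed.

Lemma alternating_root l : (l < bond_order (edge_weight C i j))%N ->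
  exists x y, [/\ 0 <= x, 0 <= y & rho (alternating s i j l) *m alpha i = comb x y].
Proof.
have [_ Cneg Cb] := fC.
have p0 : 0 <= p by rewrite oppr_ge0 lerz0 Cneg.
have q0 : 0 <= q by rewrite oppr_ge0 lerz0 Cneg // eq_sym.
have pq : p * q = (edge_weight C i j)%:R.
  rewrite mulrNN -rmorphM /= -[RHS]/((edge_weight C i j)%:Z%:~R) gez0_abs //.
  by rewrite mulr_le0 ?Cneg // eq_sym.
have := Cb i j ij; move: pq; case: (edge_weight _ _ _) => [|[|[|[|//]]]] /= pq _ lt.
all: rewrite -[alpha i]scale1r -[1 *: _]addr0 -[X in _ + X](scale0r (alpha j)) -/(comb
  1 0).
all: move: l lt => [|[|[|[|[|[|//]]]]]] // _.
all: rewrite /= /alt_letter /= ?rhoM rho1 -?mulmxA ?mul1mx ?(rho_comb_i, rho_comb_j).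
all: do 2![eexists]; split; last reflexivity.
all: try nra.
(* The goal left is the coefficient of alpha_j for l = 5 and weight 3. It factors as b (ab - 1)(ab -
   3) and vanishes. *)
suff -> : forall a b : rat, a * b = 3 ->
  b * (a * (b * (a * (b * 1 - 0) - 1) - (b * 1 - 0)) - (a * (b * 1 - 0) - 1)) -
  (b * (a * (b * 1 - 0) - 1) - (b * 1 - 0)) = 0 by [].
move=> a b ab; transitivity (b * ((a * b) ^+ 2 - 4 * (a * b) + 3)); first by ring.
by rewrite ab; ring.
Qed.

End RankTwo.

Lemma root_positive g i : (len g <= len (g * s i)%g)%N -> nonneg (rho g *m alpha i).
Proof.
have [m] := ubnP (len g); elim: m => // m IHm in g i *; rewrite ltnS => gm gi.
have [->|g1] := eqVneq g 1%g.
  by rewrite rho1 mul1mx => l; rewrite mxE; case: (_ && _).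
have [j gj] := exists_descent ss gen g1.
have ij : i != j by apply: contraTneq gj => <-; rewrite -leqNgt.
(* Strip from g the longest alternating word in s_i and s_j: what remains cannot
   be shortened by s_i or s_j, and the rank two word keeps alpha_i positive. *)
have [v [l [gE lE l0 vi vj]]] := maximal_alternating ss i gj.
have [_ _ Cb] := fC.
have lb := alternating_bound ss (Cb i j ij) (cox ij) gE lE gi.
have [x [y [x0 y0 E]]] := alternating_root ij lb.
have vm : (len v < m)%N by apply: leq_trans gm; rewrite lE -addn1 leq_add2l.
rewrite gE rhoM -mulmxA E mulmxDr -!scalemxAr.
by apply: nonnegD; apply: nonnegZ => //; apply: IHm.
Qed.

(** A nontrivial g in the kernel is shortened by some s_j. Then g s_j should send alpha_j to a
    nonnegative vector, but it acts as s_j, which negates alpha_j. *)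
Theorem geometric_faithful g : rho g = 1%:M -> g = 1%g.
Proof.
move=> g1; apply/eqP/negPn/negP => /(exists_descent ss gen)[j gj].
have /root_positive/(_ j) : (len (g * s j)%g <= len (g * s j * s j)%g)%N.
  by rewrite (mulg_generatorK ss) ltnW.
have [Cii _ _] := fC.
rewrite rhoM g1 mul1mx rho_s simple_reflection_root Cii !mxE !eqxx /=.
by lra.
Qed.

End Tits.

(** * Coxeter relations of the simple reflections *)

Section SimpleReflections.
Variables (r : nat) (C : 'M[int]_r).
Hypothesis fC : finite_cartan C.
Hypothesis C0 : forall i j, C i j = 0 -> C j i = 0.
Let Cii i : C i i = 2. Proof. by case: fC. Qed.

Let coroot i (v : 'cV[rat]_r) : rat := (map_mx intr C *m v) i 0.

Lemma simple_reflectionE i v :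
  simple_reflection C i *m v = v - coroot i v *: simple_root i.
Proof.
rewrite /simple_reflection mulmxBl mul1mx -mulmxA; congr (_ - _).
apply/matrixP=> a b; rewrite ord1 mxE (bigD1 i) //= big1 => [|c ci]; last first.
  by rewrite mxE (negbTE ci) andbF mul0r.
by rewrite addr0 /coroot [in RHS]mxE [delta_mx _ _ _ _]mxE [simple_root _ _ _]mxE !eqxx
  !andbT mulrC.
Qed.

Lemma coroot_simple_root i j : coroot i (simple_root j) = (C i j)%:~R.
Proof.
rewrite /coroot mxE (bigD1 j) //= big1 => [|c cj]; last by rewrite !mxE (negbTE cj)
  mulr0.
by rewrite !mxE !eqxx mulr1 addr0.
Qed.

Section Pair.
Variables (i j : 'I_r) (v : 'cV[rat]_r).
Let comb (x y : rat) := v - x *: simple_root i - y *: simple_root j.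

Lemma coroot_comb k x y :
  coroot k (comb x y) = coroot k v - x * (C k i)%:~R - y * (C k j)%:~R.
Proof.
rewrite /coroot /comb !mulmxBr -!scalemxAr -!coroot_simple_root /coroot.
by rewrite !mxE.
Qed.

Lemma simple_reflection_pair x y :
  simple_reflection C i *m simple_reflection C j *m comb x y =
  comb (coroot i v - (C i j)%:~R * (coroot j v - (C j i)%:~R * x - y) - x)
       (coroot j v - (C j i)%:~R * x - y).
Proof.
rewrite -mulmxA (simple_reflectionE j) coroot_comb Cii.
have -> : comb x y - (coroot j v - x * (C j i)%:~R - y * 2%:~R) *: simple_root j =
   comb x (coroot j v - (C j i)%:~R * x - y).
  by apply/matrixP=> a b; rewrite !mxE; ring.
rewrite simple_reflectionE coroot_comb Cii.
by apply/matrixP=> a b; rewrite !mxE; ring.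
Qed.

End Pair.

(** On an arbitrary vector the two reflections change only the coefficients of alpha_i and alpha_j.
    The claim becomes an identity in two coefficients for each of the six possible pairs of Cartan
    entries. *)
Lemma simple_reflections_order i j : i != j ->
  iter (bond_order (edge_weight C i j))
    (mulmx (simple_reflection C i *m simple_reflection C j)) (1%:M : 'M[rat]_r) = 1%:M.
Proof.
move=> ij; set m := bond_order _; set M := _ *m _.
suff iterE (v : 'cV[rat]_r) : iter m (mulmx M) v = v.
  have mulE l (N : 'M[rat]_r) w : iter l (mulmx M) N *m w = iter l (mulmx M) (N *m w)
    :> 'cV_r.
    by elim: l => //= l <-; rewrite mulmxA.
  apply/matrixP=> a b; have := mulE m 1%:M (delta_mx b 0).
  rewrite mul1mx iterE => /matrixP/(_ a 0); rewrite -colE mxE => ->.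
  by rewrite !mxE andbT.
have [_ Cneg Cb] := fC.
have Cij := Cneg i j ij; have Cji : C j i <= 0 by apply: Cneg; rewrite eq_sym.
have w3 := Cb i j ij.
have cases : (C i j, C j i) \in
    ([:: (0, 0); (-1, -1); (-1, -2); (-2, -1); (-1, -3); (-3, -1)] : seq (int * int)).
  have [a Ea] : exists a : nat, C i j = - a%:Z by exists (absz (C i j)); lia.
  have [b Eb] : exists b : nat, C j i = - b%:Z by exists (absz (C j i)); lia.
  have a0 : a = 0%N -> b = 0%N by move=> az; have := @C0 i j; rewrite Ea Eb az; lia.
  have b0 : b = 0%N -> a = 0%N by move=> bz; have := @C0 j i; rewrite Ea Eb bz; lia.
  move: w3; rewrite /edge_weight Ea Eb mulrNN abszM !absz_nat.
  clear - a0 b0 => w3'.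
  have [az|ap] := posnP a; first by rewrite (a0 az) az.
  have [bz|bp] := posnP b; first by rewrite (b0 bz) bz.
  have a3 : (a <= 3)%N by apply: leq_trans w3'; apply: leq_pmulr.
  have b3 : (b <= 3)%N by apply: leq_trans w3'; apply: leq_pmull.
  by move: ap bp a3 b3 w3'; case: (a) => [|[|[|[|]]]] //; case: (b) => [|[|[|[|]]]].
have v0 : v = v - 0 *: simple_root i - 0 *: simple_root j.
  by rewrite !scale0r !subr0.
rewrite {1}v0 /m /edge_weight.
move: cases; rewrite !inE !xpair_eqE.
case/or4P => [|||/or3P[]]; case/andP=> /eqP E1 /eqP E2; rewrite E1 E2 /=.
all: rewrite !simple_reflection_pair E1 E2.
all: apply/matrixP=> a b; rewrite !mxE; ring.
Qed.

End SimpleReflections.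

(** * Dynkin diagrams are forests *)

Lemma seq_maximum (T : eqType) (h : T -> nat) (c : seq T) : (0 < size c)%N ->
  exists2 x, x \in c & {in c, forall y, (h y <= h x)%N}.
Proof.
elim: c => // a [|b c] IHc _.
  by exists a; rewrite ?mem_head // => y; rewrite inE => /eqP->.
have [//|x xc xm] := IHc; have [ax|xa] := leqP (h a) (h x).
  exists x; first by rewrite inE xc orbT.
  by move=> y; rewrite inE => /predU1P[->//|]; apply: xm.
exists a; first exact: mem_head.
move=> y; rewrite inE => /predU1P[->//|/xm yx].
exact: leq_trans yx (ltnW xa).
Qed.

(** At a highest vertex of the cycle, both neighbours are at most as high. *)
Lemma no_induced_cycle (T : eqType) (e : rel T) (h : T -> nat) (c : seq T) :
  ssrbool.symmetric e ->
  (forall x y z, y != z -> e x y -> e x z -> (h y <= h x)%N -> (h z <= h x)%N ->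
    False) ->
  ~ induced_cycle e c.
Proof.
move=> se hP ic; have [sc _ _] := ic.
have [x xc xm] := seq_maximum h (ltnW (ltnW sc)).
have [m l lE] := rot_to xc.
have := induced_cycle_rot m se ic; rewrite lE => {}ic.
case: l => [|y l] in lE ic; first by case: ic.
case/lastP: l => [|l z] in lE ic; first by case: ic.
have nb := induced_cycle_neighbours se ic.
have [_ uc _] := ic.
have mc w : w \in y :: rcons l z -> w \in c.
  by move=> wl; rewrite -(mem_rot m) lE inE wl orbT.
have zl : z \in y :: rcons l z by rewrite inE mem_rcons inE eqxx orbT.
apply: (hP x y z).
- apply: contraTneq uc => ->; by rewrite /= mem_rcons mem_head andbF.
- by rewrite nb ?mem_head ?eqxx.
- by rewrite nb // eqxx orbT.
- exact/xm/mc/mem_head.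
- exact/xm/mc.
Qed.

(** With Bourbaki numbering from 0, the branch vertex 3 of type E has the two lower neighbours 1 and
    2, but no vertex has two upper ones. In the other types no vertex has two lower neighbours, so
    type E is ordered backwards. *)
Definition exceptional_E (t : connected_dynkin) : bool :=
  match t with TypeE6 | TypeE7 | TypeE8 => true | _ => false end.

Lemma dynkin_lower_unique t a b c : ~~ exceptional_E t ->
  dynkin_bond t a b != 0%N -> dynkin_bond t a c != 0%N -> (b < a)%N -> (c < a)%N ->
    b = c.
Proof.
case: t => [n|n|n|n|||||] //= _; rewrite ?eqb0 ?negbK.
- lia.
- by case: ifP => h1; case: ifP => h2; lia.
- by case: ifP => h1; case: ifP => h2; lia.
- by case: ifP => h1; case: ifP => h2; lia.
- by case: ifP => h1; case: ifP => h2; lia.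
- by case: ifP => h1; case: ifP => h2; lia.
Qed.

Lemma dynkin_upper_unique t a b c : exceptional_E t ->
  dynkin_bond t a b != 0%N -> dynkin_bond t a c != 0%N -> (a < b)%N -> (a < c)%N ->
    b = c.
Proof.
by case: t => [n|n|n|n|||||] //= _; case: ifP => h1; case: ifP => h2; lia.
Qed.

Section CartanMatrix.
Variable D : dynkin_type.
Let r := total_rank D.
Let block (x : 'I_r) : 'I_(size D) := tagnat.sig1 x.
Let index (x : 'I_r) : nat := tagnat.sig2 x.

Lemma index_lt x : (index x < dynkin_rank (component (block x)))%N.
Proof. exact: ltn_ord. Qed.

Lemma block_index_inj x y : block x = block y -> index x = index y -> x = y.
Proof.
move=> bE iE; apply: tagnat.sig_inj; rewrite !tagnat.sigE12.
rewrite /block /index in bE iE; move: (tagnat.sig2 x) (tagnat.sig2 y) iE; rewrite bE.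
by move=> u v /val_inj ->.
Qed.

Lemma cartan_matrixE x y : cartan_matrix D x y =
  if block x == block y then
    if index x == index y then 2 else - (dynkin_bond (component (block x)) (index x)
      (index y))%:Z
  else 0.
Proof.
rewrite /cartan_matrix mxE; rewrite -/(block x) -/(block y).
case: eqP => [bE|_]; last by rewrite mxE.
rewrite /index; move: (tagnat.sig2 y); rewrite -[tagnat.sig1 y]/(block y) -bE => v.
by rewrite conform_mx_id mxE.
Qed.

(* Orders each component so that every vertex has at most one neighbour below it. *)
Definition height (x : 'I_r) : nat :=
  let t := component (block x) in
  (if exceptional_E t then dynkin_rank t - index x else index x)%N.

Lemma cartan_matrix_forest x y z : y != z -> x != y -> x != z ->
  cartan_matrix D x y != 0 -> cartan_matrix D x z != 0 ->
  (height y <= height x)%N -> (height z <= height x)%N -> False.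
Proof.
move=> yz xy xz; rewrite !cartan_matrixE.
case: (block x =P block y) => // bxy; case: (block x =P block z) => // bxz.
have ne u v : block u = block v -> u != v -> index u != index v.
  by move=> buv; apply: contraNneq => /(block_index_inj buv) ->.
have ixy := ne _ _ bxy xy; have ixz := ne _ _ bxz xz.
have iyz : index y != index z by apply: ne yz; rewrite -bxy.
rewrite (negbTE ixy) (negbTE ixz) !oppr_eq0 !eqz_nat => bond_y bond_z.
have lx := index_lt x; have ly := index_lt y; have lz := index_lt z.
rewrite -bxy in ly; rewrite -bxz in lz.
rewrite /height -bxy -bxz; case: (boolP (exceptional_E _)) => ex hy hz.
  by case/eqP: iyz; apply: dynkin_upper_unique ex bond_y bond_z _ _; lia.
by case/eqP: iyz; apply: dynkin_lower_unique ex bond_y bond_z _ _; lia.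
Qed.

End CartanMatrix.

Local Close Scope ring_scope.
Local Open Scope group_scope.

(** * Isomorphisms of diagram groups *)

Lemma isomorphic_intro (G H : groupType) (f : G -> H) :
  {morph f : x y / x * y} -> bijective f -> isomorphic G H.
Proof.
move=> fM bf; pose fm := isMultiplicative.Build G H f fM.
pose F : {multiplicative G -> H} := HB.pack f fm.
by exists F.
Qed.

Lemma isomorphic_refl (G : groupType) : isomorphic G G.
Proof. by apply: (@isomorphic_intro _ _ id) => //; exists id. Qed.

Lemma isomorphic_sym (G H : groupType) : isomorphic G H -> isomorphic H G.
Proof.
case=> f [g fK gK]; apply: (@isomorphic_intro _ _ g); last by exists f.
by move=> x y; apply: (canLR fK); rewrite gmulfM !gK.
Qed.

Lemma isomorphic_trans (G H K : groupType) :
  isomorphic G H -> isomorphic H K -> isomorphic G K.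
Proof.
case=> f bf [g bg]; apply: (@isomorphic_intro _ _ (g \o f)); last exact: bij_comp.
by move=> x y; rewrite /= !gmulfM.
Qed.

Section Presentation.
Variables (I : choiceType) (R : word I -> Prop).

Definition generator (i : I) : presented R := class_of R [:: (i, false)].

Lemma class_of_mul u v : class_of R (u ++ v) = class_of R u * class_of R v.
Proof. by rewrite -class_of_cat. Qed.

Lemma class_of_letter i b :
  class_of R [:: (i, b)] = if b then (generator i)^-1 else generator i.
Proof.
case: b => //; apply: (@mulgI _ (generator i)); rewrite mulgV -class_of_mul.
exact/class_ofP/(cong_cancel R (i, false)).
Qed.

Lemma class_of_pos_word l : class_of R (pos_word l) = \prod_(i <- l) generator i.
Proof.
elim: l => [|i l IHl]; first by rewrite big_nil.
by rewrite big_cons -IHl -class_of_mul.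
Qed.

Lemma class_of_relator r : R r -> class_of R r = 1.
Proof. by move=> Rr; apply/class_ofP/cong_relator. Qed.

Section Lift.
Variables (H : groupType) (f : I -> H).

Definition eval_word (w : word I) : H :=
  \prod_(l <- w) (if l.2 then (f l.1)^-1 else f l.1).

Lemma eval_word_cat u v : eval_word (u ++ v) = eval_word u * eval_word v.
Proof. exact: big_cat. Qed.

Lemma eval_pos_word l : eval_word (pos_word l) = \prod_(i <- l) f i.
Proof. by rewrite /eval_word big_map. Qed.

Hypothesis fR : forall r, R r -> eval_word r = 1.

Lemma eval_word_cong u v : word_cong R u v -> eval_word u = eval_word v.
Proof.
elim=> {u v} [//|u v _ -> //|u v w _ -> _ -> //|u u' v v' _ uu' _ vv'||r /fR->].
- by rewrite !eval_word_cat uu' vv'.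
- by case=> i [] ; rewrite /eval_word big_cons big_seq1 big_nil /= ?mulVg ?mulgV.
- by rewrite /eval_word big_nil.
Qed.

Definition presented_lift (x : presented R) : H := eval_word (repr x).

Lemma presented_lift_class w : presented_lift (class_of R w) = eval_word w.
Proof. exact/eval_word_cong/repr_class. Qed.

Lemma presented_liftM : {morph presented_lift : x y / x * y}.
Proof.
elim/class_of_ind=> u; elim/class_of_ind=> v.
by rewrite -class_of_mul !presented_lift_class eval_word_cat.
Qed.

Lemma presented_lift_generator i : presented_lift (generator i) = f i.
Proof. by rewrite presented_lift_class /eval_word big_seq1. Qed.

End Lift.

Hypothesis inv : forall i, generator i * generator i = 1.

Lemma generated_by_involutions x : exists l, x = \prod_(i <- l) generator i.
Proof.
elim/class_of_ind: x; elim=> [|[i b] w [l lE]]; first by exists [::]; rewrite big_nil.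
exists (i :: l); rewrite big_cons -lE -cat1s class_of_mul class_of_letter.
by case: b => //; rewrite involutionV.
Qed.

End Presentation.

Lemma morph_prod (G H : groupType) (f : G -> H) (I : Type) (l : seq I) (F : I -> G) :
  {morph f : x y / x * y} -> f (\prod_(i <- l) F i) = \prod_(i <- l) f (F i).
Proof.
move=> fM; apply: (big_morph f fM); apply: (@mulgI _ (f 1)).
by rewrite -fM !mulg1.
Qed.

Lemma next_nth_mod (T : eqType) (x0 : T) c i : uniq c -> (i < size c)%N ->
  next c (nth x0 c i) = nth x0 c (if i.+1 == size c then 0 else i.+1).
Proof.
case: c => // x p uc ic; rewrite next_nth mem_nth // index_uniq //.
case: eqP => [[ip]|ip] /=; first by rewrite nth_default // ip.
by rewrite (set_nth_default x0) //; move: ic ip => /=; lia.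
Qed.

Lemma induced_cycleP (T : eqType) (e : rel T) c :
    ssrbool.symmetric e -> irreflexive e ->
  [/\ (2 < size c)%N, uniq c, cycle e c &
    {in c &, forall i j, e i j -> (j == next c i) || (i == next c j)}]
  <-> induced_cycle e c.
Proof.
move=> se ie; split.
  case=> sc uc cc ch; split=> // x0 i j ij.
  have [si sj] : (i < size c)%N /\ (j < size c)%N by lia.
  have nb k : (k < size c)%N -> e (nth x0 c k) (nth x0 c (if k.+1 == size c then 0 else
    k.+1)).
    by move=> sk; rewrite -next_nth_mod //; apply: next_cycle; rewrite ?mem_nth.
  apply/idP/idP => [aij|].
    have := ch _ _ (mem_nth x0 si) (mem_nth x0 sj) aij.
    have lt k : (k < size c)%N -> ((if k.+1 == size c then 0 else k.+1) < size c)%N.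
      by move=> kc; case: eqP => kc'; lia.
    rewrite !next_nth_mod // !nth_uniq ?lt // {lt nb ch aij}.
    by case: (i.+1 =P size c) => hi; case: (j.+1 =P size c) => hj; lia.
  case/orP=> [/eqP ji|/andP[/eqP i0 /eqP jc]].
    by have := nb i si; case: eqP => [ic|_]; [lia | rewrite ji].
  by have := nb j sj; rewrite jc eqxx i0 se.
case=> sc uc ec; split=> //.
  apply: cycle_from_next => // x xc.
  rewrite -{1}(nth_index x xc) -[X in next c X](nth_index x xc) next_nth_mod ?index_mem
    //.
  have := xc; rewrite -index_mem; set i := index x c => ic.
  by case: eqP => ics; [rewrite se ec|rewrite ec]; lia.
move=> x y xc yc.
rewrite -(nth_index x xc) -(nth_index x yc) !next_nth_mod ?index_mem //.
have := xc; have := yc; rewrite -!index_mem; set i := index x c; set j :=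
  index y c => jc ic.
have [ij|ji|->] := ltngtP i j.
- rewrite ec ?ij // => /orP[/eqP ->|/andP[/eqP-> /eqP->]]; rewrite ?eqxx ?orbT //.
  by rewrite ifF ?eqxx //; lia.
- rewrite se ec ?ji // => /orP[/eqP ->|/andP[/eqP-> /eqP->]]; rewrite ?eqxx ?orbT //.
  by rewrite [X in _ || (_ == nth _ _ X)]ifF ?eqxx ?orbT //; lia.
by rewrite ie.
Qed.

Section DiagramGroup.
Variable n : nat.
Implicit Types (B : 'M[int]_n).

Lemma edge_adjacent B : skew_symmetrisable B ->
  edge (diagram_of B) =2 adjacent B.
Proof.
move=> skB i j; rewrite /edge /= /adjacent neq_lt orbC.
by rewrite (skew_gt0 skB j i).
Qed.

Lemma coxeter_exponentE B i j : skew_symmetrisable B ->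
  coxeter_exponent (diagram_of B) i j = bond_order (edge_weight B i j).
Proof.
move=> skB; rewrite /coxeter_exponent edge_adjacent //.
have := edge_weight_eq0 i j skB; rewrite -/(edge_weight B i j) /=.
rewrite -[absz _]/(edge_weight B i j).
by case: (adjacent B i j); case: (edge_weight B i j) => [|[|[|[|]]]].
Qed.

Lemma chordless_cycleP B c : skew_symmetrisable B ->
  chordless_cycle (diagram_of B) c <-> induced_cycle (adjacent B) c.
Proof.
move=> skB; have eE := edge_adjacent skB.
rewrite -(induced_cycleP _ (adjacentC skB)) => [|i];
  last by rewrite /adjacent skew_diag ?eqxx.
by split=> -[sc uc cc ch]; split=> //; rewrite ?(eq_cycle eE) // in cc *;
  move=> i j ic jc; [rewrite -eE | rewrite eE]; apply: ch.
Qed.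

End DiagramGroup.

Lemma prod_palindrome (I : eqType) (G : groupType) (s : I -> G) q z :
  (forall i, s i * s i = 1) ->
  \prod_(i <- rcons q z ++ behead (rev (rcons q z))) s i = iter_conj s q (s z).
Proof.
move=> ss; rewrite rev_rcons /=.
elim: q => [|x q IHq]; first by rewrite big_seq1.
rewrite rcons_cons rev_cons cat_cons -rcons_cat big_cons big_rcons IHq /=.
by rewrite conjgE (involutionV (ss x)).
Qed.

Section DiagramGenerators.
Variables (n : nat) (B : 'M[int]_n).
Hypothesis skB : skew_symmetrisable B.
Let R := diagram_relator (diagram_of B).
Let g : 'I_n -> diagram_group (diagram_of B) := @generator _ R.

Lemma diagram_generator_inv i : g i * g i = 1.
Proof.
have := class_of_relator (rel_involution (diagram_of B) i).
by rewrite class_of_pos_word big_cons big_seq1.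
Qed.

Lemma prod_flatten_pair (G : groupType) (s : 'I_n -> G) m i j :
  \prod_(l <- flatten (nseq m [:: i; j])) s l = (s i * s j) ^+ m.
Proof.
by elim: m => [|m IHm] /=; rewrite ?big_nil // !big_cons IHm expgS mulgA.
Qed.

Lemma diagram_generator_coxeter : coxeter_relations B g.
Proof.
split=> [|i j ij]; first exact: diagram_generator_inv.
have := class_of_relator (rel_braid (diagram_of B) ij).
by rewrite class_of_pos_word prod_flatten_pair coxeter_exponentE.
Qed.

Lemma cycle_weightsE c : uniq c ->
  {in c, forall i, weight (diagram_of B) i (next c i) = 1%N} <->
    cycle (simply_laced B) c.
Proof.
move=> uc; split=> [h|h i ic].
  by apply: cycle_from_next => // i ic; apply/eqP/h.
by have /eqP := next_cycle h ic.
Qed.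

Lemma cycle_word_prod (G : groupType) (s : 'I_n -> G) x q z :
  (forall i, s i * s i = 1) ->
  let w := x :: rcons q z ++ behead (rev (rcons q z)) in
  \prod_(i <- w ++ w) s i = (s x * iter_conj s q (s z)) ^+ 2.
Proof. by move=> ss w; rewrite big_cat big_cons prod_palindrome // expg2. Qed.

Lemma iter_conj_involution (G : groupType) (s : 'I_n -> G) q h :
  h * h = 1 -> iter_conj s q h * iter_conj s q h = 1.
Proof. by move=> hh; elim: q => //= x q IHq; apply: involutionJ. Qed.

Lemma diagram_generator_cycle : cycle_relations B g.
Proof.
move=> x q z c ic co w.
have [_ uc _] := ic.
have gg := diagram_generator_inv.
apply/involution_commute; rewrite ?iter_conj_involution //.
have := @rel_cycle _ (diagram_of B) x (rcons q z) (iffRL (chordless_cycleP _ skB) ic)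
  co.
rewrite last_rcons => H; rewrite -cycle_word_prod // -class_of_pos_word.
apply: class_of_relator; apply: H.
by case: w => [sl|w]; [left; apply/(cycle_weightsE uc) | right].
Qed.

Section Lift.
Variables (H : groupType) (s : 'I_n -> H).
Hypotheses (cox : coxeter_relations B s) (cyc : cycle_relations B s).

Lemma diagram_relator_eval r : R r -> eval_word s r = 1.
Proof.
case=> [i|i j ij|x p c /(chordless_cycleP _ skB) ic co w].
- by rewrite eval_pos_word big_cons big_seq1 cox.1.
- by rewrite eval_pos_word prod_flatten_pair coxeter_exponentE // cox.2.
move=> w0; rewrite eval_pos_word /w0 {w0}.
have [_ uc _] := ic.
case/lastP: p => [|q z] in c ic co w uc *; first by case: ic.
rewrite cycle_word_prod; last exact: cox.1.
apply/involution_commute; rewrite ?iter_conj_involution ?cox.1 //.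
apply: cyc => //; case: w => [w|]; last by rewrite last_rcons; right.
by left; apply/cycle_weightsE.
Qed.

Lemma diagram_lift : exists2 f : diagram_group (diagram_of B) -> H,
  {morph f : x y / x * y} & forall i, f (g i) = s i.
Proof.
exists (@presented_lift _ R H s); first exact: (presented_liftM diagram_relator_eval).
exact: (presented_lift_generator diagram_relator_eval).
Qed.

End Lift.

Lemma diagram_morph_eq (H : groupType) (f1 f2 : diagram_group (diagram_of B) -> H) :
  {morph f1 : x y / x * y} -> {morph f2 : x y / x * y} ->
  (forall i, f1 (g i) = f2 (g i)) -> f1 =1 f2.
Proof.
move=> m1 m2 e x; have [l ->] := generated_by_involutions diagram_generator_inv x.
by rewrite !morph_prod //; apply: eq_bigr => i _; apply: e.
Qed.

End DiagramGenerators.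

(** * Isomorphisms induced by mutation and relabelling *)

Section MutationIsomorphism.
Variables (n : nat) (k : 'I_n).

(** The entries at k change sign, so for a neighbour i of k exactly one of the two maps conjugates
    by s_k; for every other i conjugation by s_k is trivial. *)
Lemma mutation_conj (A B : 'M[int]_n) (f : diagram_group (diagram_of A) ->
  diagram_group (diagram_of B))
    (h : diagram_group (diagram_of B) -> diagram_group (diagram_of A)) :
  skew_symmetrisable A -> skew_symmetrisable B -> B = mutate_matrix k A ->
  {morph f : x y / x * y} -> {morph h : x y / x * y} ->
  (forall i, f (@generator _ _ i) = mutated_generators A k (@generator _ _) i) ->
  (forall i, h (@generator _ _ i) = mutated_generators B k (@generator _ _) i) ->
  forall x, h (f x) = x ^ (@generator _ _ k).
Proof.
move=> skA skB EB fM hM fE hE.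
have eq12 := @diagram_morph_eq _ A _ (h \o f) (fun x => x ^ @generator _ _ k).
apply: eq12 => [x y|x y|i] /=.
- by rewrite fM hM.
- by rewrite conjMg.
have gg := @diagram_generator_inv _ A.
have gB := @diagram_generator_inv _ B.
have Bk j : (B j k = - A j k)%R by rewrite EB mutate_matrix_k // eqxx orbT.
have hk : h (@generator _ _ k) = @generator _ _ k.
  by rewrite hE /mutated_generators skew_diag.
rewrite fE {1}/mutated_generators; case: ifP => Aik.
  rewrite conjgE (involutionV (gB k)) !hM hk hE /mutated_generators Bk.
  rewrite ifF; first by rewrite conjgE (involutionV (gg k)).
  by rewrite oppr_lt0 ltNge ltW.
rewrite hE /mutated_generators Bk oppr_lt0; case: ifP => Aik' //.
rewrite commute_conj //; apply: (coxeter_commute skA (diagram_generator_coxeter skA)).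
rewrite /adjacent negbK; apply/eqP; move: Aik Aik'; lia.
Qed.

Lemma mutation_isomorphic (A : 'M[int]_n) : two_finite A ->
  isomorphic (diagram_group (diagram_of A)) (diagram_group (diagram_of (mutate_matrix k
    A))).
Proof.
move=> fA; set B := mutate_matrix k A.
have fB : two_finite B := two_finite_mutate k fA.
have EA : A = mutate_matrix k B by rewrite /B mutate_matrixK.
have coxB := diagram_generator_coxeter fB.1.
have cycB : cycle_relations B (@generator _ (diagram_relator (diagram_of B))).
  exact: (@diagram_generator_cycle _ _ fB.1).
have [f fM fE] := diagram_lift fA.1 (mutated_coxeter_relations fA coxB cycB)
  (@mutated_cycle_relations _ _ _ _ _ fA coxB cycB).
have coxA := diagram_generator_coxeter fA.1.

have {}coxA : coxeter_relations (mutate_matrix k B) (@generator _ (diagram_relator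
  (diagram_of A))).
  by rewrite -EA.
have cycA : cycle_relations (mutate_matrix k B) (@generator _ (diagram_relator
  (diagram_of A))).
  by rewrite -EA; apply: (@diagram_generator_cycle _ _ fA.1).
have [h hM hE] := diagram_lift fB.1 (mutated_coxeter_relations fB coxA cycA)
  (@mutated_cycle_relations _ _ _ _ _ fB coxA cycA).
have hf := mutation_conj fA.1 fB.1 erefl fM hM fE hE.
have fh := mutation_conj fB.1 fA.1 EA hM fM hE fE.
apply: (isomorphic_intro fM).
(* Since h after f is conjugation by s_k, the inverse of f is h corrected by s_k^-1; the other
   composite uses that f fixes s_k. *)
exists (fun y => h y ^ (@generator _ _ k)^-1) => x.
  by rewrite hf conjgK.
have hgk : f (@generator _ _ k) = @generator _ _ k.
  by rewrite fE /mutated_generators skew_diag //; case: fA.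
have fJ u v : f (u ^ v) = f u ^ f v.
  apply: (@mulgI _ (f v)); rewrite -fM !conjgE !mulgA !mulgV !mul1g.
  by rewrite fM.
by apply: (@conjg_inj _ (@generator _ _ k)); rewrite -{1}hgk -fJ conjgKV fh.
Qed.

End MutationIsomorphism.

Section Relabelling.
Variables (n : nat) (G : groupType) (B B' : 'M[int]_n) (sigma : 'S_n).
Hypothesis BB' : forall i j, B' (sigma i) (sigma j) = B i j.

Lemma skew_relabel : skew_symmetrisable B -> skew_symmetrisable B'.
Proof.
move=> /skew_symmetrisableP[d [d0 sd]]; apply/skew_symmetrisableP.
exists (d \o (sigma^-1)%g); split=> [i|i j]; first exact: d0.
by rewrite -[i in B' i j](permKV sigma) -[j in B' _ j](permKV sigma) BB' sd /= -BB'
  !permKV.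
Qed.

Lemma relations_relabel (s : 'I_n -> G) :
  coxeter_relations B' s -> cycle_relations B' s ->
  coxeter_relations B (s \o sigma) /\ cycle_relations B (s \o sigma).
Proof.
move=> cox cyc; split.
  split=> [i|i j ij]; first exact: cox.1.
  by rewrite /edge_weight -!BB'; apply: cox.2; rewrite (inj_eq perm_inj).
move=> x q z c ic co w /=.
have icE (f : 'I_n -> G) q' h : iter_conj (f \o sigma) q' h = iter_conj f (map sigma
  q') h.
  by elim: q' => //= a q' ->.
rewrite icE; have cE : map sigma c = sigma x :: rcons (map sigma q) (sigma z).
  by rewrite /c /= map_rcons.
apply: cyc; rewrite -cE.
- have [sc uc ec] := ic; split; rewrite ?size_map ?(map_inj_uniq perm_inj) // => x0 i j
  ij.
  have [ij' sj] := andP ij; have si := ltn_trans ij' sj.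
  rewrite !(nth_map x) //.
  by rewrite /adjacent BB' -[_ != _]/(adjacent B _ _) ec.
- by rewrite cycle_map; rewrite (eq_cycle (e' := arrows B)) // => i j;
  rewrite /= /arrows BB'.
- rewrite /edge_weight !BB' cycle_map; case: w => [sl|w]; [left | by right].
  by rewrite (eq_cycle (e' := simply_laced B)) // => i j;
    rewrite /= /simply_laced /edge_weight !BB'.
Qed.

End Relabelling.

Lemma relabel_isomorphic n (B B' : 'M[int]_n) (sigma : 'S_n) :
  skew_symmetrisable B -> (forall i j, B' (sigma i) (sigma j) = B i j) ->
  isomorphic (diagram_group (diagram_of B)) (diagram_group (diagram_of B')).
Proof.
move=> skB BB'; have skB' := skew_relabel BB' skB.
have B'B i j : B ((sigma^-1)%g i) ((sigma^-1)%g j) = B' i j by rewrite -BB' !permKV.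
have [c1 c2] := relations_relabel BB' (diagram_generator_coxeter skB')
  (@diagram_generator_cycle _ _ skB').
have [c1' c2'] := relations_relabel B'B (diagram_generator_coxeter skB)
  (@diagram_generator_cycle _ _ skB).
have [f fM fE] := diagram_lift skB c1 c2.
have [h hM hE] := diagram_lift skB' c1' c2'.
apply: (isomorphic_intro fM); exists h.
  apply: (@diagram_morph_eq _ B _ (h \o f) id) => [x y||i] //=; first by rewrite fM hM.
  by rewrite fE hE /= permK.
apply: (@diagram_morph_eq _ B' _ (f \o h) id) => [x y||i] //=; first by rewrite hM fM.
by rewrite hE fE /= permKV.
Qed.

(** * Comparison with the reflection group *)

Section Dynkin.
Variables (n : nat) (B : 'M[int]_n) (D : dynkin_type).
Let r := total_rank D.
Let C := cartan_matrix D.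
Hypotheses (skB : skew_symmetrisable B) (wB : forall i j, (edge_weight B i j <= 3)%N).
Variables (sigma : 'I_n -> 'I_r) (tau : 'I_r -> 'I_n).
Hypotheses (sigmaK : cancel sigma tau) (tauK : cancel tau sigma).
Hypothesis BC : forall i j, C (sigma i) (sigma j) = cartan_counterpart B i j.

Let CE x y : x != y -> C x y = (- `|B (tau x) (tau y)|)%R.
Proof.
by move=> xy; rewrite -[x]tauK -[y]tauK BC mxE !sigmaK (inj_eq (can_inj tauK)) (negbTE
  xy).
Qed.

Let weightE x y : x != y -> edge_weight C x y = edge_weight B (tau x) (tau y).
Proof.
by move=> xy; rewrite /edge_weight !CE // 1?eq_sym // mulrNN !abszM !absz_nat.
Qed.

Lemma dynkin_finite_cartan : finite_cartan C.
Proof.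
split=> [i|i j ij|i j ij]; first exact: cartan_matrix_diag.
  by rewrite CE // oppr_le0.
by rewrite weightE.
Qed.

Lemma dynkin_entry_eq0 x y : C x y = 0%R -> C y x = 0%R.
Proof.
have [->//|xy] := eqVneq x y.
rewrite !CE // 1?eq_sym // => /eqP; rewrite oppr_eq0 normr_eq0 (skew_eq0 skB) => /eqP->.
by rewrite normr0 oppr0.
Qed.

Lemma dynkin_no_cycle c : ~ induced_cycle (adjacent B) c.
Proof.
apply: (@no_induced_cycle _ _ (fun i => height (sigma i))); first exact: adjacentC.
move=> x y z yz xy xz; have si := inj_eq (can_inj sigmaK).
have ne u v : adjacent B u v -> u != v.
  by apply: contraTneq => ->; rewrite /adjacent skew_diag ?eqxx.
have nz u v : adjacent B u v -> C (sigma u) (sigma v) != 0%R.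
  by move=> uv; rewrite CE ?si ?ne // !sigmaK oppr_eq0 normr_eq0.
apply: (@cartan_matrix_forest D (sigma x) (sigma y) (sigma z)); first by rewrite si.
- by rewrite si (ne _ _ xy).
- by rewrite si (ne _ _ xz).
- exact: nz.
- exact: nz.
Qed.

Let S (x : 'I_r) : reflection_group D := to_reflection_group (refl_gen x).

Lemma val_expg (g : reflection_group D) m :
  val (g ^+ m)%g = iter m (mulmx (val g)) (1%:M)%R.
Proof. by elim: m => // m IHm; rewrite expgS /= -IHm. Qed.

Lemma reflections_coxeter : coxeter_relations B (S \o sigma).
Proof.
split=> [i|i j ij]; first exact/val_inj/simple_reflection_sqr.
have sij : sigma i != sigma j by rewrite (inj_eq (can_inj sigmaK)).
have -> : edge_weight B i j = edge_weight C (sigma i) (sigma j).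
  by rewrite weightE // !sigmaK.
apply: val_inj; rewrite val_expg.
exact: (simple_reflections_order dynkin_finite_cartan dynkin_entry_eq0).
Qed.

Lemma dynkin_isomorphic :
  isomorphic (diagram_group (diagram_of B)) (reflection_group D).
Proof.
have cyc : cycle_relations B (S \o sigma).
  by move=> x q z c ic; case: (dynkin_no_cycle ic).
have [f fM fE] := diagram_lift skB reflections_coxeter cyc.
have f1 : f 1 = 1 by apply: (@mulgI _ (f 1)); rewrite -fM !mulg1.
have fV x : f x^-1 = (f x)^-1 by apply: (@mulgI _ (f x)); rewrite -fM !mulgV.
pose g : 'I_r -> diagram_group (diagram_of B) := fun x => @generator _ _ (tau x).
have cox := diagram_generator_coxeter skB.
(* The representation is the matrix of f x itself, so its faithfulness is the injectivity of f;
   [tau] reindexes the generators by the rows of the Cartan matrix. *)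
have inj x : f x = 1 -> x = 1.
  move=> fx; apply: (@geometric_faithful r C dynkin_finite_cartan _ g _ _ _ (fun x =>
    val (f x))).
  - by move=> i; apply: cox.1.
  - move=> y; have [l ->] := generated_by_involutions (@diagram_generator_inv _ B) y.
    exists (map sigma l); rewrite big_map; apply: eq_bigr => i _.
    by rewrite /g sigmaK.
  - by move=> i j ij; rewrite weightE //; apply: cox.2; rewrite (inj_eq (can_inj tauK)).
  - by rewrite f1.
  - by move=> y z; rewrite fM.
  - by move=> i; rewrite /g fE /= tauK.
  - by rewrite fx.
have finj : injective f.
  move=> x y xy; apply/divg1_eq/inj; by rewrite fM fV xy mulgV.
have surj (M : 'M[rat]_r) (hM : in_reflection_group M) : exists x, val (f x) = M.
  elim: hM => {M} [i||M N _ [x <-] _ [y <-]|M _ [x <-]].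
  - by exists (g i); rewrite /g fE /= tauK.
  - by exists 1; rewrite f1.
  - by exists (x * y); rewrite fM.
  - by exists x^-1; rewrite fV.
have fsurj y : exists x, f x = y.
  by have [x xE] := surj _ (in_reflection_groupP y); exists x; apply: val_inj.
apply: (isomorphic_intro fM).
have [h hE] := choice fsurj.
by exists h => x //; apply: finj; rewrite hE.
Qed.

End Dynkin.

Local Close Scope group_scope.
Local Open Scope ring_scope.

(** * Finite type implies 2-finiteness *)

(* The partial homomorphism given by evaluating rational functions at a point. *)
Record is_place (F : fieldType) (V : F -> rat -> Prop) : Prop := IsPlace {
  place_functional : forall f u v, V f u -> V f v -> u = v;
  place1 : V 1 1;
  placeD : forall f g u v, V f u -> V g v -> V (f + g) (u + v);
  placeM : forall f g u v, V f u -> V g v -> V (f * g) (u * v);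
  placeF : forall f g u v, V f u -> V g v -> v != 0 -> V (f / g) (u / v)
}.

(** What mutation needs from free generation: any positive point can be prescribed. Unlike free
    generation, this passes to mutated seeds by evaluating exchange relations alone. *)
Definition has_places n (x : {ffun 'I_n -> ambient_field n}) : Prop :=
  forall a : 'I_n -> rat, (forall i, 0 < a i) ->
  exists2 V, is_place V & forall i, V (x i) (a i).

Lemma free_generating_places n (x : {ffun 'I_n -> ambient_field n}) :
  free_generating x -> has_places x.
Proof.
move=> [free _] a a0.
pose c : {rmorphism rat -> ambient_field n} := @tofrac _ \o @mpolyC n rat.
have evE p : poly_eval x p = mmap c x p by [].
have evD p q : poly_eval x (p + q) = poly_eval x p + poly_eval x q.
  by rewrite !evE rmorphD.
have evN p : poly_eval x (- p) = - poly_eval x p by rewrite !evE rmorphN.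
have evM p q : poly_eval x (p * q) = poly_eval x p * poly_eval x q.
  by rewrite !evE rmorphM.
have ev1 : poly_eval x 1 = 1 by rewrite evE rmorph1.
have evX i : poly_eval x 'X_i = x i by rewrite evE mmapX mmap1U.
have nz q : q.@[a] != 0 -> poly_eval x q != 0.
  by apply: contraNneq => /free ->; rewrite meval0.
(* The values of the fractions defined at a; algebraic independence of x makes the value unique. *)
exists (fun f v => exists p q, [/\ q.@[a] != 0, f = poly_eval x p / poly_eval x q
                                  & v = p.@[a] / q.@[a]]); last first.
  by move=> i; exists 'X_i, 1; rewrite ev1 evX !divr1 mevalXU meval1 divr1 oner_eq0.
split.
- move=> f u v [p [q [q0 -> ->]]] [p' [q' [q0' /eqP E ->]]].
  move: E; rewrite eqr_div ?nz // -!evM -subr_eq0 -evN -evD => /eqP/free/eqP.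
  rewrite subr_eq0 => /eqP/(congr1 (meval a)); rewrite !mevalM => E.
  by apply/eqP; rewrite eqr_div // E.
- by exists 1, 1; rewrite ev1 meval1 divr1 oner_eq0.
- move=> f g u v [p [q [q0 -> ->]]] [p' [q' [q0' -> ->]]].
  exists (p * q' + p' * q), (q * q'); rewrite !mevalM mevalD !mevalM mulf_neq0 //.
  by rewrite evD !evM !addf_div ?nz.
- move=> f g u v [p [q [q0 -> ->]]] [p' [q' [q0' -> ->]]].
  exists (p * p'), (q * q'); rewrite !mevalM !evM mulf_neq0 //.
  by rewrite !mulf_div.
- move=> f g u v [p [q [q0 -> ->]]] [p' [q' [q0' -> ->]]] v0.
  have p0' : p'.@[a] != 0 by apply: contraNneq v0 => ->; rewrite mul0r.
  exists (p * q'), (q * p'); rewrite !mevalM !evM mulf_neq0 //.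
  by rewrite !invf_div !mulf_div.
Qed.

Section PlaceMutation.
Variables (n : nat) (V : ambient_field n -> rat -> Prop).
Hypothesis pV : is_place V.
Implicit Types (x : {ffun 'I_n -> ambient_field n}) (B : 'M[int]_n) (a : 'I_n -> rat).

Lemma placeX f u m : V f u -> V (f ^+ m) (u ^+ m).
Proof.
by move=> fu; elim: m => [|m IHm]; rewrite ?expr0 ?exprS;
  [apply: place1 | apply: placeM].
Qed.

Lemma place_prod (P : pred 'I_n) x a (e : 'I_n -> nat) :
  (forall i, V (x i) (a i)) ->
  V (\prod_(i < n | P i) x i ^+ e i) (\prod_(i < n | P i) a i ^+ e i).
Proof.
move=> xa; apply: (big_ind2 (fun f u => V f u)) => [|f u g v|i _].
- exact: place1.
- exact: placeM.
- exact: placeX.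
Qed.

Definition exchange_value B k a : rat :=
  \prod_(i < n | (0 < B i k)%R) a i ^+ absz (B i k)
  + \prod_(i < n | (B i k < 0)%R) a i ^+ absz (B i k).

Lemma place_mutate x B k a : (forall i, V (x i) (a i)) -> a k != 0 ->
  forall i, V (mutate_cluster k (x, B) i)
              (if i == k then exchange_value B k a / a k else a i).
Proof.
move=> xa ak i; rewrite ffunE; case: eqP => // _.
apply: (placeF pV) => //; apply: (placeD pV); exact: place_prod.
Qed.

End PlaceMutation.

Lemma exchange_value_gt0 n (B : 'M[int]_n) k a :
  (forall i, 0 < a i) -> 0 < exchange_value B k a.
Proof. by move=> a0; rewrite addr_gt0 // prodr_gt0 // => i _; rewrite exprn_gt0. Qed.

Lemma exchange_value_eq n (B : 'M[int]_n) k a a' : B k k = 0 ->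
  (forall i, i != k -> a i = a' i) -> exchange_value B k a = exchange_value B k a'.
Proof.
move=> Bkk aa; congr (_ + _); apply: eq_bigr => i Bi; rewrite aa //;
  by apply: contraTneq Bi => ->; rewrite Bkk.
Qed.

Lemma has_places_mutate n (s : labelled_pair n) k : skew_symmetrisable s.2 ->
  has_places s.1 -> has_places (mutate k s).1.
Proof.
case: s => x B /= skB px a a0.
(* Mutation of points is an involution: the old k-th coordinate is the exchange value divided by the
   new one, and the exchange value does not involve the k-th coordinate since B k k = 0. *)
pose a' i := if i == k then exchange_value B k a / a k else a i.
have Bkk : B k k = 0 by rewrite skew_diag.
have aa' i : i != k -> a' i = a i by rewrite /a' => /negbTE->.
have a'0 i : 0 < a' i.
  by rewrite /a'; case: eqP => // _; rewrite divr_gt0 ?exchange_value_gt0.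
have [V pV xV] := px a' a'0; exists V => // i.
have := place_mutate pV B xV (lt0r_neq0 (a'0 k)) i.
case: eqP => [->|/eqP ik]; last by rewrite aa'.
rewrite (exchange_value_eq Bkk aa') /a' eqxx invf_div mulrCA divff ?mulr1 //.
exact/lt0r_neq0/exchange_value_gt0.
Qed.

Lemma reachable_places n (s0 s : labelled_pair n) :
  is_seed_pair s0 -> mutation_reachable s0 s -> has_places s.1 /\ skew_symmetrisable
    s.2.
Proof.
move=> [f0 sk0]; elim=> [|{}s k _ [ps sks]]; first by split=> //;
  apply: free_generating_places.
by split; [apply: has_places_mutate | apply: mutate_matrix_skew].
Qed.

Lemma reachable_trans n (s0 s1 s2 : labelled_pair n) :
  mutation_reachable s0 s1 -> mutation_reachable s1 s2 -> mutation_reachable s0 s2.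
Proof. by move=> r01; elim=> // s k _ r0s; apply: reach_step. Qed.

(** * Growth under alternating mutations *)

Section RankTwoPoint.
Variables (n : nat) (i j : 'I_n).
Hypothesis ij : i != j.

Definition point (u v : rat) (l : 'I_n) : rat :=
  if l == i then u else if l == j then v else 1.

Lemma exchange_value_point B (u v : rat) : skew_symmetrisable B -> B j i != 0 ->
  exchange_value B i (point u v) = v ^+ absz (B j i) + 1.
Proof.
move=> skB Bji; rewrite /exchange_value.
have prod1 (P : pred 'I_n) : ~~ P j -> ~~ P i ->
    \prod_(l < n | P l) point u v l ^+ absz (B l i) = 1.
  move=> Pj Pi; apply: big1 => l Pl; rewrite /point.
  have -> : (l == i) = false by apply: contraNF Pi => /eqP <-.
  have -> : (l == j) = false by apply: contraNF Pj => /eqP <-.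
  by rewrite expr1n.
have prodj (P : pred 'I_n) : P j -> ~~ P i ->
    \prod_(l < n | P l) point u v l ^+ absz (B l i) = v ^+ absz (B j i).
  move=> Pj Pi; rewrite (bigD1 j) //= big1 ?mulr1 => [|l /andP[Pl lj]].
    by rewrite /point eq_sym (negbTE ij) eqxx.
  have -> : point u v l = 1.
    rewrite /point (negbTE lj); case: eqP => // li.
    by rewrite li (negbTE Pi) in Pl.
  by rewrite expr1n.
have Bii := skew_diag skB i.
have [pos|neg] : 0 < B j i \/ B j i < 0 by apply/orP; rewrite orbC -neq_lt.
  rewrite prodj //= ?Bii ?ltxx // prod1 ?Bii ?ltxx //.
  by rewrite -leNgt ltW.
rewrite prod1 /= ?Bii ?ltxx //; last by rewrite -leNgt ltW.
by rewrite prodj ?Bii ?ltxx // addrC.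
Qed.

End RankTwoPoint.

Section RankTwoState.
Variables (n : nat) (V : ambient_field n -> rat -> Prop).
Hypothesis pV : is_place V.

(** Mutations at i and j only change the signs of the two entries between them, so b and c persist
    and the pair (u, v) evolves by a recurrence of its own. *)
Definition rank2_state (i j : 'I_n) (t : labelled_pair n) (u v : rat) (b c : nat) :
  Prop :=
  [/\ skew_symmetrisable t.2, absz (t.2 j i) = b, absz (t.2 i j) = c
    & forall l, V (t.1 l) (point i j u v l)].

Lemma rank2_state_swap i j t u v b c : i != j ->
  rank2_state i j t u v b c -> rank2_state j i t v u c b.
Proof.
move=> ij [sk tb tc tV]; split=> // l.
have := tV l; rewrite /point; case: (l =P j) => // ->.
by rewrite eq_sym (negbTE ij).
Qed.

Lemma rank2_state_mutate i j t u v b c : i != j -> (0 < b)%N -> u != 0 ->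
  rank2_state i j t u v b c ->
  rank2_state i j (mutate i t) ((v ^+ b + 1) / u) v b c.
Proof.
case: t => x B ij b0 u0 [/= sk tb tc tV]; split=> /=.
- exact: mutate_matrix_skew.
- by rewrite mutate_matrix_k ?eqxx ?orbT // abszN.
- by rewrite mutate_matrix_k ?eqxx ?orbT // abszN.
have Bji : B j i != 0 by rewrite -absz_gt0 tb.
have pi : point i j u v i = u by rewrite /point eqxx.
have pi0 : point i j u v i != 0 by rewrite pi.
move=> l; have := place_mutate pV B tV pi0 l.
rewrite exchange_value_point // tb pi /point.
by case: (l == i).
Qed.

Lemma ler_expn_exponent (x : rat) m k : 1 <= x -> (m <= k)%N -> x ^+ m <= x ^+ k.
Proof. by move=> x1 mk; apply: ler_weXn2l. Qed.

Lemma exchange_growth_balanced (u v : rat) b c : 1 <= u -> 2 * u <= v ->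
  (2 <= b)%N -> (2 <= c)%N ->
  let u' := (v ^+ b + 1) / u in let v' := (u' ^+ c + 1) / v in
  2 * u <= u' /\ 2 * u' <= v'.
Proof.
move=> u1 uv b2 c2 u' v'.
have vb : v ^+ 2 <= v ^+ b by apply: ler_expn_exponent => //; lra.
have uu' : 2 * v <= u'.
  rewrite /u' ler_pdivlMr; last by lra.
  apply: le_trans (_ : v ^+ 2 + 1 <= _); last by rewrite lerD2r.
  by rewrite expr2; nra.
have uc : u' ^+ 2 <= u' ^+ c by apply: ler_expn_exponent => //; lra.
split; first by lra.
rewrite /v' ler_pdivlMr; last by lra.
apply: le_trans (_ : u' ^+ 2 + 1 <= _); last by rewrite lerD2r.
by rewrite expr2; nra.
Qed.

(** For b = 1 a linear invariant is too weak. From u' u >= v and v >= 2 u^2 one gets u'^2 >= 2 v,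
    and then v' >= u'^4 / v >= 2 u'^2. *)
Lemma exchange_growth_skewed (u v : rat) b c : 1 <= u -> 2 * u ^+ 2 <= v ->
  (1 <= b)%N -> (4 <= c)%N ->
  let u' := (v ^+ b + 1) / u in let v' := (u' ^+ c + 1) / v in
  2 * u <= u' /\ 2 * u' ^+ 2 <= v'.
Proof.
move=> u1 uv b1 c4 u' v'.
have v1 : 1 <= v by rewrite expr2 in uv; nra.
have vb : v ^+ 1 <= v ^+ b by apply: ler_expn_exponent.
rewrite expr1 in vb.
have uE : u' * u = v ^+ b + 1 by rewrite /u' divfK //; lra.
have uu' : 2 * u <= u'.
  rewrite /u' ler_pdivlMr; last by lra.
  by rewrite expr2 in uv; nra.
have uc : u' ^+ 4 <= u' ^+ c by apply: ler_expn_exponent => //; lra.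
split=> //.
have vu' : 2 * v <= u' ^+ 2.
  have h : v <= u' * u by lra.
  have h2 : v * v <= (u' ^+ 2) * (u ^+ 2).
    by rewrite -exprMn -expr2 ler_sqr ?nnegrE //; nra.
  have u2 : 0 < u ^+ 2 by rewrite exprn_gt0 //; lra.
  rewrite -(ler_pM2r u2); apply: le_trans h2; rewrite mulrAC -mulrA; nra.
rewrite /v' ler_pdivlMr; last by lra.
apply: le_trans (_ : u' ^+ 4 + 1 <= _); last by rewrite lerD2r.
have -> : u' ^+ 4 = u' ^+ 2 * u' ^+ 2 by rewrite -exprD.
have : 0 <= u' ^+ 2 by apply: sqr_ge0.
by nra.
Qed.

(** The values u = 1 and v = 2 meet both growth invariants with equality, and every pair of
    mutations at least doubles u. *)
Lemma rank2_unbounded i j s b c : i != j -> rank2_state i j s 1 2 b c ->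
  ((2 <= b) && (2 <= c) || (1 <= b) && (4 <= c))%N ->
  forall N, exists t u, [/\ mutation_reachable s t, V (t.1 i) u & N%:R <= u].
Proof.
move=> ij st bc N.
have b0 : (0 < b)%N by move: bc; lia.
have c0 : (0 < c)%N by move: bc; lia.
have ji : j != i by rewrite eq_sym.
have step t u v : 1 <= u -> 1 <= v -> rank2_state i j t u v b c ->
    let u' := (v ^+ b + 1) / u in
    rank2_state i j (mutate j (mutate i t)) u' ((u' ^+ c + 1) / v) b c.
  move=> u1 v1 tst u'.
  have /(rank2_state_swap ij) := rank2_state_mutate ij b0 (lt0r_neq0 (lt_le_trans ltr01
    u1)) tst.
  move=> /(rank2_state_mutate ji c0 (lt0r_neq0 (lt_le_trans ltr01 v1))).
  exact: rank2_state_swap.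
suff [t [u [v [rt tst Nu]]]] : exists t u v,
    [/\ mutation_reachable s t, rank2_state i j t u v b c & N%:R + 1 <= u].
  by exists t, u; split=> //; [have [_ _ _ /(_ i)] := tst; rewrite /point eqxx | lra].
case/orP: bc => /andP[b2 c2].
  suff [t [u [v [rt tst Nu _]]]] : exists t u v,
    [/\ mutation_reachable s t, rank2_state i j t u v b c, N%:R + 1 <= u & 2 * u <= v].
    by exists t, u, v.
  elim: N => [|N [t [u [v [rt tst Nu uv]]]]].
    by exists s, 1, 2; split; [exact: reach_refl | exact: st | lra | lra].
  have N0 : 0 <= N%:R :> rat by [].
  have u1 : 1 <= u by lra.
  have v1 : 1 <= v by lra.
  have [g1 g2] := exchange_growth_balanced u1 uv b2 c2.
  exists (mutate j (mutate i t)), ((v ^+ b + 1) / u),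
    ((((v ^+ b + 1) / u) ^+ c + 1) / v).
  by split; [do 2![apply: reach_step] | apply: step | rewrite -natr1; lra | ].
suff [t [u [v [rt tst Nu _]]]] : exists t u v,
  [/\ mutation_reachable s t, rank2_state i j t u v b c,
    N%:R + 1 <= u & 2 * u ^+ 2 <= v].
  by exists t, u, v.
elim: N => [|N [t [u [v [rt tst Nu uv]]]]].
  by exists s, 1, 2; split; [exact: reach_refl | exact: st | lra | rewrite expr1n; lra].
have N0 : 0 <= N%:R :> rat by [].
have u1 : 1 <= u by lra.
have v1 : 1 <= v by rewrite expr2 in uv; nra.
have [g1 g2] := exchange_growth_skewed u1 uv b2 c2.
exists (mutate j (mutate i t)), ((v ^+ b + 1) / u), ((((v ^+ b + 1) / u) ^+ c + 1) / v).
by split; [do 2![apply: reach_step] | apply: step | rewrite -natr1; lra | ].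
Qed.

End RankTwoState.

(** * The bound on the weights *)

Section FiniteType.
Variables (n : nat) (s0 : labelled_pair n).
Hypotheses (seed0 : is_seed_pair s0) (fin0 : finite_type s0).

Lemma relabelled_refl (s : labelled_pair n) : relabelled s s.
Proof. by exists 1%g; split=> *; rewrite !perm1. Qed.

(** Relabelling permutes the variables of a seed, so finitely many cluster variables occur in all,
    and each has at most one value under the place. *)
Lemma place_values_bounded (V : ambient_field n -> rat -> Prop) : is_place V ->
  exists M, forall t l u, mutation_reachable s0 t -> V (t.1 l) u -> u <= M.
Proof.
move=> pV; have [L LP] := fin0.
have bound (fs : seq (ambient_field n)) : exists M, forall f u, f \in fs -> V f u ->
  u <= M.
  elim: fs => [|f fs [M MP]]; first by exists 0.
  have [[u fu]|nf] := pselect (exists u, V f u).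
    exists (Num.max u M) => g v; rewrite inE => /predU1P[-> fv|gfs gv].
      by rewrite (place_functional pV fv fu) le_max lexx.
    by rewrite le_max (MP _ _ gfs gv) orbT.
  exists M => g v; rewrite inE => /predU1P[-> fv|]; last exact: MP.
  by case: nf; exists v.
have [M MP] := bound (flatten [seq [seq t.1 l | l <- enum 'I_n] | t : labelled_pair n
  <- L]).
exists M => t l u rt; apply: MP.
have [t' t'L [sigma [st _]]] : exists2 t', t' \in L & relabelled t t'.
  by apply: LP; exists t => //; apply: relabelled_refl.
apply/flattenP; exists [seq t'.1 l | l <- enum 'I_n]; first exact: map_f.
by rewrite -st; apply: map_f; rewrite mem_enum.
Qed.

Lemma finite_type_weight s i j : mutation_reachable s0 s ->
  (edge_weight s.2 i j <= 3)%N.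
Proof.
move=> rs; have [ps sks] := reachable_places seed0 rs.
have [->|ij] := eqVneq i j; first by rewrite /edge_weight skew_diag.
rewrite leqNgt; apply/negP=> w4.
(* The place is centred at the seed s, with all its variables 1 except the one at j'. A weight of at
   least 4 means both factors are at least 2, or one is 1 and the other at least 4; hence both
   orders of the pair are needed. *)
have no i' j' : i' != j' ->
    ~ ((2 <= absz (s.2 j' i')) && (2 <= absz (s.2 i' j'))
       || (1 <= absz (s.2 j' i')) && (4 <= absz (s.2 i' j')))%N.
  move=> ij' bc; have pos l : 0 < point i' j' 1 2 l.
    by rewrite /point; case: (l == i'); case: (l == j').
  have [V pV xV] := ps _ pos.
  have [M MP] := place_values_bounded pV.
  have st : rank2_state V i' j' s 1 2 (absz (s.2 j' i')) (absz (s.2 i' j')) by split.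
  have [t [u [rt tu Nu]]] := rank2_unbounded pV ij' st bc (Num.bound `|M|).
  have := MP _ _ _ (reachable_trans rs rt) tu.
  have := archi_boundP (normr_ge0 M); have := ler_norm M; lra.
have ji : j != i by rewrite eq_sym.
have := no i j ij; have := no j i ji; move: w4; rewrite /edge_weight abszM.
move: (absz _) (absz _) => b c bc n1 n2.
have [c0 b0] : (0 < c)%N /\ (0 < b)%N by nia.
have : (2 <= b)%N && (2 <= c)%N || (b == 1)%N || (c == 1)%N by lia.
by case/orP=> [/orP[h|/eqP E]|/eqP E]; [apply: n1 | apply: n2 | apply: n1]; nia.
Qed.

Lemma reachable_mutations s ks : mutation_reachable s0 s ->
  exists2 t, mutation_reachable s0 t & t.2 = mutations ks s.2.
Proof.
elim: ks s => [|k ks IHks] s rs; first by exists s.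
exact: (IHks (mutate k s) (reach_step k rs)).
Qed.

Lemma finite_type_two_finite s : mutation_reachable s0 s -> two_finite s.2.
Proof.
move=> rs; split=> [|ks i j]; first by case: (reachable_places seed0 rs).
by have [t rt <-] := reachable_mutations ks rs; apply: finite_type_weight.
Qed.

Lemma reachable_isomorphic s : mutation_reachable s0 s ->
  isomorphic (diagram_group (diagram_of s0.2)) (diagram_group (diagram_of s.2)).
Proof.
elim=> [|{}s k rs IHs]; first exact: isomorphic_refl.
exact: isomorphic_trans IHs (mutation_isomorphic k (finite_type_two_finite rs)).
Qed.

End FiniteType.

Theorem theoremA (n : nat) (s0 s : labelled_pair n) (Delta : dynkin_type) :
  is_seed_pair s0 ->
  finite_type s0 ->
  seed_of s0 s ->
  has_dynkin_type s0 Delta ->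
  isomorphic (diagram_group (diagram_of s.2)) (reflection_group Delta).
Proof.
move=> seed0 fin0 [s' rs' [sigma [_ s's]]] [t [t' rt' [rho [_ t't]]] [phi [[psi phiK
  psiK] phiE]]].
have tf' := finite_type_two_finite seed0 fin0 rs'.
have tft := finite_type_two_finite seed0 fin0 rt'.
(* The chain runs from s back through its unrelabelled form s' to the initial seed, then forward to
   t' and its relabelling t, which carries the Cartan matrix. *)
apply: isomorphic_trans (isomorphic_sym (relabel_isomorphic tf'.1 s's)) _.
apply: isomorphic_trans (isomorphic_sym (reachable_isomorphic seed0 fin0 rs')) _.
apply: isomorphic_trans (reachable_isomorphic seed0 fin0 rt') _.
apply: isomorphic_trans (relabel_isomorphic tft.1 t't) _.
have skt : skew_symmetrisable t.2 := skew_relabel t't tft.1.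
have wt i j : (edge_weight t.2 i j <= 3)%N.
  rewrite /edge_weight -[i](permKV rho) -[j](permKV rho) !t't.
  exact: (tft.2 [::]).
exact: (dynkin_isomorphic skt wt phiK psiK).
Qed.
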